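(* Let $\mathcal{U}\subset\mathbb{R}^5=\mathbb{R}\times\mathbb{R}^4$ be a domain with global Cartesian coordinates $(t,x^1,x^2,y^1,y^2)$ on $\mathbb{R}^5$ and let $\sigma=\pm1$. Let the functions $(f_1,u)$, $(f_2,v)$ on $\mathcal{U}$ satisfy $$f_1=f_1(x^1,x^2,y^1),\quad\frac{\partial f_1}{\partial y^1}\neq0,\quad\frac{\partial u}{\partial y^1}+y^1\frac{\partial f_1}{\partial y^1}=0,$$ $$f_2=f_2(x^1,x^2,y^2),\quad\frac{\partial f_2}{\partial y^2}\neq0,\quad\frac{\partial v}{\partial y^2}-y^2\frac{\partial f_2}{\partial y^2}=0,\qquad(1)$$ and let $f_3$ be an arbitrary function on $\mathcal{U}$. Define the coframe $$\theta^0=dt,\quad\theta^1=dx^1,\quad\theta^2=dx^2,$$ $$\theta^3=\frac{\partial f_1}{\partial y^1}dy^1+\Big(u-t+\frac{\partial f_1}{\partial x^1}\Big)dx^1+\Big(f_3+\frac{\partial f_1}{\partial x^2}\Big)dx^2,\qquad(2)$$ $$\theta^4=\frac{\partial f_2}{\partial y^2}dy^2+\Big(-f_3+\frac{\partial f_2}{\partial x^1}\Big)dx^1+\Big(v-\sigma t+\frac{\partial f_2}{\partial x^2}\Big)dx^2,$$ and the almost para-contact metric structure $(\varphi,\xi,\eta,g)$ $$\xi=\tfrac{\partial}{\partial t},\quad\eta=\theta^0=dt,\quad\theta^0\circ\varphi=0,\ \theta^1\circ\varphi=\theta^1,\ \theta^2\circ\varphi=-\theta^2,\ \theta^3\circ\varphi=-\theta^3,\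 \theta^4\circ\varphi=\theta^4,$$ $$g=dt\odot dt+2\theta^1\odot\theta^3+2\theta^2\odot\theta^4.\qquad(3)$$ Then $\mathcal{U}$ equipped with this structure is a weakly para-cosymplectic manifold with para-K\''ahler leaves, hyperbolic for $\sigma=-1$, elliptic for $\sigma=+1$, and with a contact Ricci potential $$\eta-\tau_1+\tau_2=dt+y^1dx^1+y^2dx^2.\qquad(4)$$ The eigen-functions $\alpha$, $\beta$ of the Ricci tensor are given by $$\alpha=\left(\frac{\partial f_1}{\partial y^1}\right)^{-1},\qquad\beta=-\left(\frac{\partial f_2}{\partial y^2}\right)^{-1}.$$ Conversely, if $\mathcal{M}$ is a 5-dimensional weakly para-cosymplectic manifold with para-K\''ahler leaves, elliptic ($\sigma=1$) or hyperbolic ($\sigma=-1$), with contact Ricci potential $\eta-\tau_1+\tau_2$, then near an arbitrary point $p\in\mathcal{M}$ there is a local coordinate system $(t,x^1,x^2,y^1,y^2)$ such that (1), (2), (3), (4) are satisfied.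
   Context: All manifolds, tensor fields and functions are smooth. An almost para-contact metric structure on $\mathcal{M}$, $\dim\mathcal{M}=2n+1$, is a quadruple $(\varphi,\xi,\eta,g)$ ($\varphi$ a $(1,1)$-tensor field, $\xi$ a vector field, $\eta$ a 1-form, $g$ a pseudo-Riemannian metric) with $\varphi^2=Id-\eta\otimes\xi$, $\eta(\xi)=1$, $g(\varphi X,\varphi Y)=-g(X,Y)+\eta(X)\eta(Y)$, $\eta(X)=g(\xi,X)$. With $\varPhi(X,Y)=g(\varphi X,Y)$, the manifold is almost para-cosymplectic if $d\eta=0$ and $d\varPhi=0$; it is then weakly para-cosymplectic if $R(X,Y)\varphi Z=\varphi R(X,Y)Z$ for all $X,Y,Z$, where $R(X,Y)Z=\nabla_X\nabla_YZ-\nabla_Y\nabla_XZ-\nabla_{[X,Y]}Z$ and $\nabla$ is the Levi-Civita connection. $Ric(X,Y)=\mathrm{Tr}\{Z\mapsto R(Z,X)Y\}$. Put $AX=-\nabla_X\xi$. Each leaf of the foliation $\eta=0$ inherits an almost para-Hermitian structure $(P,H)$ by restricting $\varphi$ and $g$; the manifold has para-K\''ahler leaves if $P$ is parallel for the Levi-Civita connection of $H$ on every leaf, equivalently $(\nabla_X\varphi)Y=g(A\varphi X,Y)\xi-\eta(Y)A\varphi X$. Elliptic/hyperbolic (dimension 5): near each point there are smooth nowhere zero vector fields $V_1,V_2$ (unique up to sign) with $\varphi V_1=-V_1$, $\varphi V_2=V_2$, $g(V_1,V_2)=0$ and $AX=\varepsilon\left(g(X,V_1)V_1+\sigma g(X,V_2)V_2\right)$,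 $\varepsilon=\pm1$, where $\sigma=1$ in the elliptic and $\sigma=-1$ in the hyperbolic case. Replacing $(\xi,\eta)$ by $(-\xi,-\eta)$ if necessary, it is always assumed that $\varepsilon=1$. The 1-forms $\tau_1,\tau_2$ are defined by $\nabla_XV_1=\tau_1(X)V_1$, $\nabla_XV_2=\tau_2(X)V_2$ (such forms exist, and they are globally defined). The Ricci form $\rho(X,Y)=Ric(\varphi X,Y)$ satisfies $\rho=2d(\eta-\tau_1+\tau_2)$ (with the convention $2d\alpha(X,Y)=X\alpha(Y)-Y\alpha(X)-\alpha([X,Y])$), and $\eta-\tau_1+\tau_2$ is called the Ricci potential. The Ricci potential is contact if it is a contact form on the 5-dimensional manifold, equivalently if $\eta\wedge\rho\wedge\rho\neq0$ everywhere. $\alpha\odot\beta=\frac12(\alpha\otimes\beta+\beta\otimes\alpha)$ for 1-forms.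
   Formalization: With the stated convention for Ric the eigen-functions are −α and −β (belonging to V₁ and V₂, besides 0), so the sign is corrected; and u, v are required to depend only on (x¹,x²,y¹) and (x¹,x²,y²) respectively, like f₁, f₂, since the claim fails otherwise. *)

(* Defs.v *)
From HB Require Import structures.
From mathcomp Require Import all_boot all_order all_algebra all_fingroup.
From mathcomp Require Import all_classical all_reals all_analysis.

Set Implicit Arguments.
Unset Strict Implicit.
Unset Printing Implicit Defensive.

Import Order.TTheory GRing.Theory Num.Theory.
Import numFieldNormedType.Exports.

Local Open Scope classical_set_scope.
Local Open Scope ring_scope.

(* Tangent vectors and covectors at a point of R^n are both row vectors of
   components; matrices act on tangent vectors from the right.  A field on an
   open set U is a total function on R^n of which only the values on U matter. *)

Definition pd {R : realType} {n : nat} (i : 'I_n.+1) (f : 'rV[R]_n.+1 -> R)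
  (x : 'rV[R]_n.+1) : R := 'D_(delta_mx 0 i) f x.

(* C^oo: all iterated partial derivatives exist and are continuous. *)
Definition smooth {R : realType} {n : nat} (U : set 'rV[R]_n.+1)
    (f : 'rV[R]_n.+1 -> R) : Prop :=
  forall (s : seq 'I_n.+1) (x : 'rV[R]_n.+1), U x ->
    {for x, continuous (foldr pd f s)} /\
    (forall i, derivable (foldr pd f s) x (delta_mx 0 i)).

Definition smooth_mx {R : realType} {n p q : nat} (U : set 'rV[R]_n.+1)
    (A : 'rV[R]_n.+1 -> 'M[R]_(p, q)) : Prop :=
  forall i j, smooth U (fun x => A x i j).

(* Row i of the Jacobian is the i-th partial derivative of F, so the
   differential of F at x is v |-> v *m jac F x. *)
Definition jac {R : realType} {n m : nat} (F : 'rV[R]_n.+1 -> 'rV[R]_m.+1)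
    (x : 'rV[R]_n.+1) : 'M[R]_(n.+1, m.+1) :=
  \matrix_(i, a) pd i (fun y => F y 0 a) x.

Definition ev {R : realType} {n : nat} (a v : 'rV[R]_n) : R :=
  (v *m a^T) 0 0.

Definition bil {R : realType} {n : nat} (G : 'M[R]_n) (v w : 'rV[R]_n) : R :=
  (v *m G *m w^T) 0 0.

Definition endo {R : realType} {n : nat} (P : 'rV[R]_n.+1 -> 'M[R]_n.+1)
    (X : 'rV[R]_n.+1 -> 'rV[R]_n.+1) (x : 'rV[R]_n.+1) : 'rV[R]_n.+1 :=
  X x *m P x.

(* (d a)(X, Y) = X a(Y) - Y a(X) - a([X, Y]) on the coordinate fields i, j;
   this is twice the exterior derivative in the other usual normalization. *)
Definition ext_d {R : realType} {n : nat} (a : 'rV[R]_n.+1 -> 'rV[R]_n.+1)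
    (x : 'rV[R]_n.+1) (i j : 'I_n.+1) : R :=
  pd i (fun y => a y 0 j) x - pd j (fun y => a y 0 i) x.

Definition christoffel {R : realType} {n : nat}
    (g : 'rV[R]_n.+1 -> 'M[R]_n.+1) (x : 'rV[R]_n.+1) (i j k : 'I_n.+1) : R :=
  2^-1 * \sum_l invmx (g x) k l *
    (pd i (fun y => g y j l) x + pd j (fun y => g y i l) x
     - pd l (fun y => g y i j) x).

Definition nabla {R : realType} {n : nat} (g : 'rV[R]_n.+1 -> 'M[R]_n.+1)
    (X Y : 'rV[R]_n.+1 -> 'rV[R]_n.+1) (x : 'rV[R]_n.+1) : 'rV[R]_n.+1 :=
  'D_(X x) Y x
  + \row_k \sum_i \sum_j christoffel g x i j k * X x 0 i * Y x 0 j.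

Definition lie {R : realType} {n : nat} (X Y : 'rV[R]_n.+1 -> 'rV[R]_n.+1)
    (x : 'rV[R]_n.+1) : 'rV[R]_n.+1 :=
  'D_(X x) Y x - 'D_(Y x) X x.

Definition curv {R : realType} {n : nat} (g : 'rV[R]_n.+1 -> 'M[R]_n.+1)
    (X Y Z : 'rV[R]_n.+1 -> 'rV[R]_n.+1) (x : 'rV[R]_n.+1) : 'rV[R]_n.+1 :=
  nabla g X (nabla g Y Z) x - nabla g Y (nabla g X Z) x
  - nabla g (lie X Y) Z x.

(* Ric(X, Y) = Tr (Z |-> R(Z, X) Y) *)
Definition ric {R : realType} {n : nat} (g : 'rV[R]_n.+1 -> 'M[R]_n.+1)
    (X Y : 'rV[R]_n.+1 -> 'rV[R]_n.+1) (x : 'rV[R]_n.+1) : R :=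
  \sum_k curv g (fun=> delta_mx 0 k) X Y x 0 k.

(* The endomorphism Q with g(Q v, w) = Ric(v, w). *)
Definition ricci_op {R : realType} {n : nat} (g : 'rV[R]_n.+1 -> 'M[R]_n.+1)
    (x : 'rV[R]_n.+1) : 'M[R]_n.+1 :=
  (\matrix_(i, j) ric g (fun=> delta_mx 0 i) (fun=> delta_mx 0 j) x)
    *m invmx (g x).

Record pcstruct (R : realType) (n : nat) := PCStruct {
  phi : 'rV[R]_n.+1 -> 'M[R]_n.+1;
  xi  : 'rV[R]_n.+1 -> 'rV[R]_n.+1;
  eta : 'rV[R]_n.+1 -> 'rV[R]_n.+1;
  met : 'rV[R]_n.+1 -> 'M[R]_n.+1 }.

Definition pseudo_riemannian {R : realType} {n : nat} (U : set 'rV[R]_n.+1)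
    (g : 'rV[R]_n.+1 -> 'M[R]_n.+1) : Prop :=
  smooth_mx U g /\
  (forall x, U x -> (g x)^T = g x /\ g x \in unitmx).

Definition almost_paracontact_metric {R : realType} {n : nat}
    (U : set 'rV[R]_n.+1) (S : pcstruct R n) : Prop :=
  [/\ smooth_mx U (phi S), smooth_mx U (xi S), smooth_mx U (eta S),
      pseudo_riemannian U (met S) &
      forall x, U x -> forall v w : 'rV[R]_n.+1,
        [/\ v *m phi S x *m phi S x = v - ev (eta S x) v *: xi S x,
            ev (eta S x) (xi S x) = 1,
            bil (met S x) (v *m phi S x) (w *m phi S x) =
              - bil (met S x) v w + ev (eta S x) v * ev (eta S x) w &
            ev (eta S x) v = bil (met S x) (xi S x) v]].

(* Components of Phi(X, Y) = g(phi X, Y). *)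
Definition fund_form {R : realType} {n : nat} (S : pcstruct R n)
    (x : 'rV[R]_n.+1) : 'M[R]_n.+1 := phi S x *m met S x.

Definition almost_para_cosymplectic {R : realType} {n : nat}
    (U : set 'rV[R]_n.+1) (S : pcstruct R n) : Prop :=
  [/\ almost_paracontact_metric U S,
      (forall x, U x -> forall i j, ext_d (eta S) x i j = 0) &
      (forall x, U x -> forall i j k,
        pd i (fun y => fund_form S y j k) x
        + pd j (fun y => fund_form S y k i) x
        + pd k (fun y => fund_form S y i j) x = 0)].

Definition weakly_para_cosymplectic {R : realType} {n : nat}
    (U : set 'rV[R]_n.+1) (S : pcstruct R n) : Prop :=
  almost_para_cosymplectic U S /\
  (forall X Y Z : 'rV[R]_n.+1 -> 'rV[R]_n.+1,
    smooth_mx U X -> smooth_mx U Y -> smooth_mx U Z ->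
    forall x, U x ->
      curv (met S) X Y (endo (phi S) Z) x
      = endo (phi S) (curv (met S) X Y Z) x).

(* The leaves of eta = 0 are given by their local parametrizations: immersions F
   of open subsets of R^(n-1) into U tangent to ker eta (with n = m.+2 the
   ambient dimension).  H and P are the metric and the endomorphism induced on
   the leaf by g and phi, read in the parametrization F. *)
Definition leaf_param {R : realType} {m : nat} (U : set 'rV[R]_m.+2)
    (S : pcstruct R m.+1) (W : set 'rV[R]_m.+1)
    (F : 'rV[R]_m.+1 -> 'rV[R]_m.+2) : Prop :=
  [/\ open W, smooth_mx W F &
      forall y, W y ->
        [/\ U (F y), row_free (jac F y) & jac F y *m (eta S (F y))^T = 0]].

Definition para_kaehler_leaves {R : realType} {m : nat} (U : set 'rV[R]_m.+2)
    (S : pcstruct R m.+1) : Prop :=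
  forall (W : set 'rV[R]_m.+1) (F : 'rV[R]_m.+1 -> 'rV[R]_m.+2)
         (P : 'rV[R]_m.+1 -> 'M[R]_m.+1),
    leaf_param U S W F ->
    smooth_mx W P ->
    (forall y, W y -> P y *m jac F y = jac F y *m phi S (F y)) ->
    let H := fun y => jac F y *m met S (F y) *m (jac F y)^T in
    forall X Y : 'rV[R]_m.+1 -> 'rV[R]_m.+1,
      smooth_mx W X -> smooth_mx W Y ->
      forall y, W y -> nabla H X (endo P Y) y = endo P (nabla H X Y) y.

Definition shape {R : realType} {n : nat} (S : pcstruct R n)
    (x v : 'rV[R]_n.+1) : 'rV[R]_n.+1 := - nabla (met S) (fun=> v) (xi S) x.

(* The sign of (xi, eta) is chosen so that epsilon = 1. *)
Definition adapted_pair {R : realType} (S : pcstruct R 4) (sigma : R)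
    (W : set 'rV[R]_5) (V1 V2 : 'rV[R]_5 -> 'rV[R]_5) : Prop :=
  [/\ open W, smooth_mx W V1, smooth_mx W V2 &
      forall x, W x ->
        [/\ V1 x != 0 /\ V2 x != 0,
            V1 x *m phi S x = - V1 x,
            V2 x *m phi S x = V2 x,
            bil (met S x) (V1 x) (V2 x) = 0 &
            forall v : 'rV[R]_5,
              shape S x v = bil (met S x) v (V1 x) *: V1 x
                            + (sigma * bil (met S x) v (V2 x)) *: V2 x]].

Definition sigma_type {R : realType} (sigma : R) (U : set 'rV[R]_5)
    (S : pcstruct R 4) : Prop :=
  forall x, U x -> exists (W : set 'rV[R]_5) (V1 V2 : 'rV[R]_5 -> 'rV[R]_5),
    [/\ W x, W `<=` U & adapted_pair S sigma W V1 V2].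

Definition elliptic {R : realType} (U : set 'rV[R]_5) (S : pcstruct R 4) :=
  sigma_type 1 U S.

Definition hyperbolic {R : realType} (U : set 'rV[R]_5) (S : pcstruct R 4) :=
  sigma_type (-1) U S.

Definition tau_forms {R : realType} (sigma : R) (U : set 'rV[R]_5)
    (S : pcstruct R 4) (tau1 tau2 : 'rV[R]_5 -> 'rV[R]_5) : Prop :=
  [/\ smooth_mx U tau1, smooth_mx U tau2 &
      forall (W : set 'rV[R]_5) (V1 V2 : 'rV[R]_5 -> 'rV[R]_5),
        W `<=` U -> adapted_pair S sigma W V1 V2 ->
        forall x, W x -> forall v : 'rV[R]_5,
          nabla (met S) (fun=> v) V1 x = ev (tau1 x) v *: V1 x /\
          nabla (met S) (fun=> v) V2 x = ev (tau2 x) v *: V2 x].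

Definition ricci_potential {R : realType} (S : pcstruct R 4)
    (tau1 tau2 : 'rV[R]_5 -> 'rV[R]_5) (x : 'rV[R]_5) : 'rV[R]_5 :=
  eta S x - tau1 x + tau2 x.

Definition ct  : 'I_5 := @Ordinal 5 0 isT.
Definition cx1 : 'I_5 := @Ordinal 5 1 isT.
Definition cx2 : 'I_5 := @Ordinal 5 2 isT.
Definition cy1 : 'I_5 := @Ordinal 5 3 isT.
Definition cy2 : 'I_5 := @Ordinal 5 4 isT.

(* The sum is, up to a positive factor, the value of a /\ da /\ da on the
   coordinate basis. *)
Definition contact_form {R : realType} (U : set 'rV[R]_5)
    (a : 'rV[R]_5 -> 'rV[R]_5) : Prop :=
  smooth_mx U a /\
  (forall x, U x ->
    \sum_(s : 'S_5) (-1) ^+ s * a x 0 (s ct) *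
      ext_d a x (s cx1) (s cx2) * ext_d a x (s cy1) (s cy2) != 0).

Record chart (R : realType) (M : topologicalType) (n : nat) := Chart {
  cdom   : set M;
  ccoord : M -> 'rV[R]_n.+1;
  cpar   : 'rV[R]_n.+1 -> M }.

Definition cimg {R : realType} {M : topologicalType} {n : nat}
    (c : chart R M n) : set 'rV[R]_n.+1 := ccoord c @` cdom c.

Definition is_chart {R : realType} {M : topologicalType} {n : nat}
    (c : chart R M n) : Prop :=
  [/\ open (cdom c), open (cimg c),
      (forall p, cdom c p -> cpar c (ccoord c p) = p),
      (forall p, cdom c p -> {for p, continuous (ccoord c)}) &
      (forall x, cimg c x -> {for x, continuous (cpar c)})].

Definition trans {R : realType} {M : topologicalType} {n : nat}
    (c d : chart R M n) (x : 'rV[R]_n.+1) : 'rV[R]_n.+1 := ccoord d (cpar c x).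

Definition compatible {R : realType} {M : topologicalType} {n : nat}
    (c d : chart R M n) : Prop :=
  smooth_mx (ccoord c @` (cdom c `&` cdom d)) (trans c d).

(* A is the maximal atlas, i.e. the set of all local coordinate systems. *)
Definition smooth_manifold {R : realType} {M : topologicalType} {n : nat}
    (A : set (chart R M n)) : Prop :=
  [/\ hausdorff_space M /\ @second_countable M,
      (forall c, A c -> is_chart c),
      (forall p, exists2 c, A c & cdom c p),
      (forall c d, A c -> A d -> compatible c d) &
      (forall c, is_chart c ->
         (forall d, A d -> compatible c d /\ compatible d c) -> A c)].

(* A tensor field on the manifold is the family of its components in all local
   coordinate systems; the following are the transformation rules. *)
Definition covector_field {R : realType} {M : topologicalType} {n : nat}
    (A : set (chart R M n))
    (a : chart R M n -> 'rV[R]_n.+1 -> 'rV[R]_n.+1) : Prop :=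
  forall c d p, A c -> A d -> cdom c p -> cdom d p ->
    a c (ccoord c p) = a d (ccoord d p) *m (jac (trans c d) (ccoord c p))^T.

Definition structure_field {R : realType} {M : topologicalType} {n : nat}
    (A : set (chart R M n)) (S : chart R M n -> pcstruct R n) : Prop :=
  covector_field A (fun c => eta (S c)) /\
  (forall c d p, A c -> A d -> cdom c p -> cdom d p ->
    let x := ccoord c p in
    let y := ccoord d p in
    let J := jac (trans c d) x in
    [/\ xi (S d) y = xi (S c) x *m J,
        phi (S c) x *m J = J *m phi (S d) y &
        met (S c) x = J *m met (S d) y *m J^T]).

Definition domain {R : realType} {n : nat} (U : set 'rV[R]_n.+1) : Prop :=
  open U /\ connected U.

Definition depends_on {R : realType} {n : nat} (U : set 'rV[R]_n.+1)
    (s : seq 'I_n.+1) (f : 'rV[R]_n.+1 -> R) : Prop :=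
  forall x y, U x -> U y -> (forall i, i \in s -> x 0 i = y 0 i) -> f x = f y.

Definition model_functions {R : realType} (U : set 'rV[R]_5)
    (f1 u f2 v f3 : 'rV[R]_5 -> R) : Prop :=
  [/\ smooth U f1 /\ smooth U u, smooth U f2 /\ smooth U v, smooth U f3,
      [/\ depends_on U [:: cx1; cx2; cy1] f1,
          depends_on U [:: cx1; cx2; cy1] u &
          forall x, U x ->
            pd cy1 f1 x != 0 /\ pd cy1 u x + x 0 cy1 * pd cy1 f1 x = 0] &
      [/\ depends_on U [:: cx1; cx2; cy2] f2,
          depends_on U [:: cx1; cx2; cy2] v &
          forall x, U x ->
            pd cy2 f2 x != 0 /\ pd cy2 v x - x 0 cy2 * pd cy2 f2 x = 0]].

Definition dcoord {R : realType} (i : 'I_5) : 'rV[R]_5 := delta_mx 0 i.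

Definition theta3 {R : realType} (f1 u f3 : 'rV[R]_5 -> R) (x : 'rV[R]_5) :
    'rV[R]_5 :=
  pd cy1 f1 x *: dcoord cy1
  + (u x - x 0 ct + pd cx1 f1 x) *: dcoord cx1
  + (f3 x + pd cx2 f1 x) *: dcoord cx2.

Definition theta4 {R : realType} (sigma : R) (f2 v f3 : 'rV[R]_5 -> R)
    (x : 'rV[R]_5) : 'rV[R]_5 :=
  pd cy2 f2 x *: dcoord cy2
  + (- f3 x + pd cx1 f2 x) *: dcoord cx1
  + (v x - sigma * x 0 ct + pd cx2 f2 x) *: dcoord cx2.

Definition sym_prod {R : realType} (a b : 'rV[R]_5) : 'M[R]_5 :=
  2^-1 *: (a^T *m b + b^T *m a).

Definition model_structure {R : realType} (sigma : R) (U : set 'rV[R]_5)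
    (f1 u f2 v f3 : 'rV[R]_5 -> R) (S : pcstruct R 4) : Prop :=
  forall x, U x ->
    let th0 : 'rV[R]_5 := dcoord ct in
    let th1 : 'rV[R]_5 := dcoord cx1 in
    let th2 : 'rV[R]_5 := dcoord cx2 in
    let th3 := theta3 f1 u f3 x in
    let th4 := theta4 sigma f2 v f3 x in
    [/\ xi S x = delta_mx 0 ct,
        eta S x = th0,
        (forall w : 'rV[R]_5,
          [/\ ev th0 (w *m phi S x) = 0,
              ev th1 (w *m phi S x) = ev th1 w,
              ev th2 (w *m phi S x) = - ev th2 w,
              ev th3 (w *m phi S x) = - ev th3 w &
              ev th4 (w *m phi S x) = ev th4 w]) &
        met S x = sym_prod th0 th0 + 2 *: sym_prod th1 th3
                  + 2 *: sym_prod th2 th4].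

Definition normal_potential {R : realType} (x : 'rV[R]_5) : 'rV[R]_5 :=
  dcoord ct + x 0 cy1 *: dcoord cx1 + x 0 cy2 *: dcoord cx2.

(* Main.v *)
Require Import Defs.
From HB Require Import structures.
From mathcomp Require Import all_boot all_order all_algebra all_fingroup.
From mathcomp Require Import all_classical all_reals all_analysis.
From mathcomp Require Import ring lra.

(** For the model structure, [phi] and [g] have constant matrices in the
    coframe [theta], and they do not depend on [f3].  The Levi-Civita connection
    is therefore given in this coframe by explicit skew matrices [Om], and their
    curvature commutes with [phi]; the same matrices, restricted to [ker eta],
    give the connection of the leaves.

    Conversely, let [th_i = g(V_i, -)].  From [nabla V_i = tau_i V_i] one gets
    [d th_i = tau_i /\ th_i], and [R(X,Y) phi xi = phi R(X,Y) xi] forces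
    [tau_i /\ th_i = 0].  Hence [eta = dt] and [th_i = dx_i] locally, with
    [tau_1 = - y_1 dx_1] and [tau_2 = y_2 dx_2]; the contact condition says
    precisely that [(t, x_1, x_2, y_1, y_2)] is a coordinate system.  In it the
    Christoffel symbols with upper index [t], [x_1], [x_2] are known, and
    lowering the index gives linear equations for the derivatives of [g] whose
    compatibility conditions kill the components of [g] absent from the normal
    form; the remaining equations are integrated by quadratures. *)

Set Implicit Arguments.
Unset Strict Implicit.
Unset Printing Implicit Defensive.

Import Order.TTheory GRing.Theory Num.Theory.
Import numFieldNormedType.Exports.

Local Open Scope classical_set_scope.
Local Open Scope ring_scope.

(** * Calculus in R^n *)

(** Smoothness here only speaks of iterated partial derivatives, so differentiability, symmetry of
    mixed partials, the inverse function theorem and the Poincare lemma are all derived from it; the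
    coinduction principle [smooth_coind] carries smoothness through inverses and through integrals
    with parameters. Connections are computed by Cartan's method: by [frame_chr], matrices that
    satisfy the two structure equations in a coframe are the Levi-Civita connection. The same lemma
    serves the model coframe, the leaves and the changes of coordinates.

    In the converse, the Christoffel symbols with upper index [y1], [y2] stay unknown, but in an
    equation lowered to index [l] they only occur multiplied by [g(d/dy_i, d/dl)]. This vanishes for
    [l] among [t], [y1], [y2], which singles out the usable equations. What is finally left to
    integrate involves [d f1/d x2] and [d f2/d x1] only through their sum, an entry of the metric,
    so that [f3 = 0] can be chosen. *)

Section Lines.
Context {R : realType} {V : normedModType R}.
Implicit Types (f : V -> R) (x v : V).

Lemma is_derive_line f x v (t : R) : derivable f (x + t *: v) v ->
  is_derive t 1 (fun s : R => f (x + s *: v)) ('D_v f (x + t *: v)).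
Proof.
move=> df; rewrite /derive.
have E : (fun h : R => h^-1 *: (((fun s : R => f (x + s *: v)) \o shift t) (h *: 1)
          - f (x + t *: v))) =
         (fun h : R => h^-1 *: ((f \o shift (x + t *: v)) (h *: v) - f (x + t *: v))).
  apply/funext => h /=; congr (_ *: (f _ - _)).
  by rewrite [h *: 1]mulr1 scalerDl addrCA addrA addrC [h *: v + _]addrC addrA.
by split; rewrite /derivable /derive E.
Qed.

(** Running through the segment as [t * h] with [t] in [0, 1] allows [h] to be negative or zero, so
    that later estimates need no case distinction on signs. *)
Lemma mvt_line f x v (h : R) :
  (forall t : R, 0 <= t <= 1 -> derivable f (x + (t * h) *: v) v) ->
  exists2 t : R, 0 <= t <= 1 & f (x + h *: v) - f x = h * 'D_v f (x + (t * h) *: v).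
Proof.
move=> df.
pose g (t : R) := f (x + (t * h) *: v).
have dg (t : R) : 0 <= t <= 1 -> is_derive t 1 g (h * 'D_v f (x + (t * h) *: v)).
  move=> t01.
  have d1 := is_derive_line (df _ t01).
  have d2 : is_derive t 1 (fun s : R => s * h) h.
    have -> : (fun s : R => s * h) = h \*: id.
      by apply/funext => s /=; rewrite mulrC.
    by apply: is_derive_eq; rewrite [_ *: _]mulr1.
  have -> : g = (fun s : R => f (x + s *: v)) \o (fun s : R => s * h) by [].
  rewrite mulrC.
  exact: (@is_derive1_comp _ (fun s : R => f (x + s *: v)) (fun s : R => s * h) t _ _ d1 d2).
have cg : {within `[0, 1], continuous g}.
  apply: derivable_within_continuous => t; rewrite in_itv /= => t01.
  by have [] := dg _ t01.
have [|t] := @MVT_segment _ g (fun t => h * 'D_v f (x + (t * h) *: v)) 0 1 ler01 _ cg.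
  by move=> t; rewrite in_itv /= => /andP[a b]; apply: dg; rewrite !ltW.
rewrite in_itv /= subr0 mulr1 /g mul1r mul0r scale0r addr0 => t01 ->.
by exists t.
Qed.

End Lines.

Lemma cvg_bigsum {R : numFieldType} {V : normedModType R} {T I : Type} (F : set_system T)
    {FF : Filter F} (r : seq I) (f : I -> T -> V) (l : I -> V) :
  (forall i, f i @ F --> l i) -> (fun x => \sum_(i <- r) f i x) @ F --> \sum_(i <- r) l i.
Proof.
move=> H; elim: r => [|i r IH].
  under eq_fun do rewrite big_nil.
  by rewrite big_nil; exact: cvg_cst.
under eq_fun do rewrite big_cons.
by rewrite big_cons; apply: cvgD.
Qed.

Section ContinuousPartials.
Context {R : realType} {n : nat}.
Local Notation E := 'rV[R]_n.+1.
Implicit Types (f g : E -> R) (x v : E).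

Lemma norm_rV_coord (v : E) i : `|v 0 i| <= `|v|.
Proof.
by rewrite [leRHS]/Num.Def.normr /= mx_normrE; apply/bigmax_geP; right => /=; exists (ord0, i).
Qed.

Lemma norm_rV_le (v : E) e : 0 <= e -> (forall i, `|v 0 i| <= e) -> `|v| <= e.
Proof.
move=> e0 H; rewrite [leLHS]/Num.Def.normr /= mx_normrE; apply/bigmax_leP; split => // -[i j] _.
by rewrite /= (ord1 i).
Qed.

Lemma norm_rV_lt (v : E) e : 0 < e -> (forall i, `|v 0 i| < e) -> `|v| < e.
Proof.
move=> e0 H; rewrite [ltLHS]/Num.Def.normr /= mx_normrE; apply/bigmax_ltP; split => // -[i j] _.
by rewrite /= (ord1 i).
Qed.

(** The candidate differential with partial derivatives [l]; it is registered as linear so that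
    [diff_unique] can identify it. *)
Definition linpart (l : 'I_n.+1 -> R) (v : E) : R := \sum_i v 0 i * l i.

Lemma linpart_is_linear l : linear (linpart l).
Proof.
move=> a u v; rewrite /linpart scaler_sumr -big_split /=; apply: eq_bigr => i _.
by rewrite !mxE mulrDl -mulrA.
Qed.

HB.instance Definition _ l := GRing.isLinear.Build R E R _ (linpart l) (linpart_is_linear l).

(** The vertices of the staircase from 0 to [v] that moves along one axis at a time. *)
Definition trunc (v : E) (k : nat) : E := \row_i (if (i < k)%N then v 0 i else 0).

Lemma truncS v (k : 'I_n.+1) : trunc v k.+1 = trunc v k + v 0 k *: delta_mx 0 k.
Proof.
apply/rowP => i; rewrite !mxE eqxx /=.
rewrite ltnS leq_eqVlt -val_eqE /=; case: eqP => /= [e|_].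
  by rewrite e ltnn mulr1 add0r; congr (v 0 _); apply: val_inj.
by rewrite mulr0 addr0.
Qed.

(** The increment of [f] telescopes along the staircase [trunc v k]. The mean value theorem replaces
    each edge by a partial derivative at a nearby point, and continuity at [x] allots to each of the
    [n.+1] edges the error [e' = e / n.+1]. *)
Lemma C1_expand f x (e : R) : 0 < e ->
  (forall i, \forall y \near x, derivable f y (delta_mx 0 i)) ->
  (forall i, {for x, continuous (pd i f)}) ->
  \forall v \near (0 : E),
     `|f (x + v) - f x - linpart (fun i => pd i f x) v| <= e * `|v|.
Proof.
move=> e0 df cf.
pose e' := e / n.+1%:R.
have e'0 : 0 < e' by rewrite divr_gt0.
have P i : \forall y \near x, derivable f y (delta_mx 0 i) /\ `|pd i f x - pd i f y| <= e'.
  apply: filterI; first exact: df.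
  by move/cvgrPdist_le : (cf i) => /(_ _ e'0).
have /nbhs_ballP[r /= r0 rP] : nbhs x [set y | forall i, derivable f y (delta_mx 0 i) /\
    `|pd i f x - pd i f y| <= e'].
  exact: (filter_forall _ P).
apply/nbhs_ballP; exists r => //= v; rewrite -ball_normE /ball_ /= sub0r normrN => vr.
have H (w : E) : `|w| <= `|v| -> forall i, derivable f (x + w) (delta_mx 0 i) /\
    `|pd i f x - pd i f (x + w)| <= e'.
  move=> wv; apply: rP; rewrite -ball_normE /ball_ /= opprD addNKr normrN.
  exact: le_lt_trans vr.
have -> : f (x + v) - f x = \sum_(k < n.+1) (f (x + trunc v k.+1) - f (x + trunc v k)).
  rewrite -(big_mkord xpredT (fun k => f (x + trunc v k.+1) - f (x + trunc v k))).
  rewrite telescope_sumr //; congr (f (x + _) - f _).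
    by apply/rowP => i; rewrite mxE ltn_ord.
  by apply/rowP => i; rewrite !mxE addr0.
rewrite /linpart -sumrB.
apply: le_trans (ler_norm_sum _ _ _) _.
have -> : e * `|v| = \sum_(i < n.+1) (e' * `|v|).
  by rewrite sumr_const card_ord -mulrnAl /e' -mulr_natr divfK // pnatr_eq0.
apply: ler_sum => k _.
rewrite truncS addrA.
(* Points of the k-th edge are dominated by [v] coordinate by coordinate, hence also in the sup
   norm. *)
have inb (t : R) : 0 <= t <= 1 -> `|trunc v k + (t * v 0 k) *: delta_mx 0 k| <= `|v|.
  move=> /andP[t0 t1]; apply: norm_rV_le => // i; rewrite !mxE eqxx /=.
  case: (eqVneq i k) => [->|_]; last first.
    rewrite mulr0 addr0; case: ifP => _; first exact: norm_rV_coord.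
    by rewrite normr0.
  rewrite ltnn add0r mulr1 normrM ger0_norm //.
  by apply: le_trans (norm_rV_coord v k); rewrite ler_piMl.
have [|t t01 ->] := @mvt_line R E f (x + trunc v k) (delta_mx 0 k) (v 0 k).
  move=> t t01; rewrite -addrA.
  by have [] := H _ (inb _ t01) k.
rewrite -mulrBr normrM mulrC.
apply: ler_pM => //; last exact: norm_rV_coord.
by rewrite -addrA distrC; have [] := H _ (inb _ t01) k.
Qed.

Lemma C1_diff f x :
  (forall i, \forall y \near x, derivable f y (delta_mx 0 i)) ->
  (forall i, {for x, continuous (pd i f)}) ->
  differentiable f x /\ (forall v, 'D_v f x = linpart (fun i => pd i f x) v).
Proof.
move=> df cf.
have cL : continuous (linpart (fun i => pd i f x)).
  move=> y; rewrite /linpart; apply: (@cvg_bigsum _ _ _ _ (nbhs y)) => i.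
  by apply: cvgMl; exact: coord_continuous.
have L : f \o shift x = cst (f x) + linpart (fun i => pd i f x) +o_ (0 : E) id.
  apply/eqaddoP => e e0; near=> v.
  rewrite /= -![(_ + _ : _ -> _) _]/(_ + _) /cst /= opprD addrA [v + x]addrC.
  by near: v; exact: C1_expand.
have dE := diff_unique cL L.
have D : differentiable f x.
  by apply/diff_locallyP; rewrite dE.
by split => // v; rewrite deriveE // dE.
Unshelve. all: by end_near. Qed.

End ContinuousPartials.

Section DirectionalDerivatives.
Context {R : realType} {V W : normedModType R}.

Lemma derive_line0 (f : V -> W) x v :
  'D_v f x = 'D_1 (fun h : R => f (h *: v + x)) 0.
Proof.
rewrite /derive; set g1 := fun h => h^-1 *: _; set g2 := fun h => h^-1 *: _.
suff -> : g1 = g2 by [].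
by rewrite funeqE /g1 /g2 => h /=; rewrite addr0 scale0r add0r [_%:A]mulr1.
Qed.

End DirectionalDerivatives.

Section DirectionalComposition.
Context {R : realType} {V W : normedModType R}.

(** [F] is only derivable in the direction [v]. Restricting it to the line through [x] makes the
    source one-dimensional, where derivability is differentiability, and the chain rule for
    differentials applies there. *)
Lemma is_derive_comp_diff (F : V -> W) (f : W -> R) x v :
  derivable F x v -> differentiable f (F x) ->
  is_derive x v (f \o F) ('D_('D_v F x) f (F x)).
Proof.
move=> /derivable1P/derivable1_diffP dF df.
have df' : differentiable f ((fun h : R => F (h *: v + x)) 0).
  by rewrite /= scale0r add0r.
have dc := differentiable_comp dF df'.
split; first by apply/derivable1P/derivable1_diffP.
have -> : 'D_v (f \o F) x = 'D_1 (f \o (fun h : R => F (h *: v + x))) 0.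
  exact: derive_line0.
rewrite (deriveE _ dc) diff_comp //= -(deriveE _ dF) -derive_line0.
by rewrite -deriveE //= scale0r add0r.
Qed.

Lemma derivable_shift (f : V -> R) c x v :
  derivable f (x + c) v -> derivable (fun y => f (y + c)) x v.
Proof.
rewrite /derivable.
set g1 := fun h => h^-1 *: _; set g2 := fun h => h^-1 *: _.
suff -> : g1 = g2 by [].
by rewrite funeqE /g1 /g2 => h /=; rewrite addrA.
Qed.

Lemma derive_shift_arg (f : V -> R) c x v :
  'D_v (fun y => f (y + c)) x = 'D_v f (x + c).
Proof.
rewrite /derive.
set g1 := fun h => h^-1 *: _; set g2 := fun h => h^-1 *: _.
suff -> : g1 = g2 by [].
by rewrite funeqE /g1 /g2 => h /=; rewrite addrA.
Qed.

End DirectionalComposition.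

Lemma near_open {T : topologicalType} (U : set T) (P : T -> Prop) x :
  open U -> U x -> (forall y, U y -> P y) -> \forall y \near x, P y.
Proof. by move=> oU Ux H; apply: filterS (open_nbhs_nbhs (conj oU Ux)). Qed.

Section PartialDerivatives.
Context {R : realType} {n : nat}.
Local Notation E := 'rV[R]_n.+1.
Implicit Types (f g : E -> R) (x v : E) (i j k : 'I_n.+1) (U : set E).
Local Notation drv f x i := (derivable f x (delta_mx 0 i)).

Lemma pd_near f g x i : (\forall y \near x, f y = g y) -> pd i f x = pd i g x.
Proof. exact: near_eq_derive. Qed.

Lemma pd_eq U f g x i : open U -> U x -> (forall y, U y -> f y = g y) ->
  pd i f x = pd i g x.
Proof. by move=> oU Ux H; apply: pd_near; exact: near_open H. Qed.

Lemma drvD f g x v : derivable f x v -> derivable g x v ->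
  derivable (fun y => f y + g y) x v.
Proof. exact: (@derivableD _ _ _ f g x v). Qed.

Lemma drvB f g x v : derivable f x v -> derivable g x v ->
  derivable (fun y => f y - g y) x v.
Proof. exact: (@derivableB _ _ _ f g x v). Qed.

Lemma drvN f x v : derivable f x v -> derivable (fun y => - f y) x v.
Proof. exact: (@derivableN _ _ _ f x v). Qed.

Lemma drvM f g x v : derivable f x v -> derivable g x v ->
  derivable (fun y => f y * g y) x v.
Proof. exact: (@derivableM _ _ f g x v). Qed.

Lemma drvV f x v : f x != 0 -> derivable f x v -> derivable (fun y => (f y)^-1) x v.
Proof. exact: (@derivableV _ _ f x v). Qed.

Lemma pdD f g x i : drv f x i -> drv g x i ->
  pd i (fun y => f y + g y) x = pd i f x + pd i g x.
Proof. exact: (@deriveD _ _ _ f g). Qed.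

Lemma pdB f g x i : drv f x i -> drv g x i ->
  pd i (fun y => f y - g y) x = pd i f x - pd i g x.
Proof. exact: (@deriveB _ _ _ f g). Qed.

Lemma pdN f x i : drv f x i -> pd i (fun y => - f y) x = - pd i f x.
Proof. exact: (@deriveN _ _ _ f). Qed.

Lemma pdM f g x i : drv f x i -> drv g x i ->
  pd i (fun y => f y * g y) x = pd i f x * g x + f x * pd i g x.
Proof.
move=> df dg; rewrite /pd.
have -> : (fun y => f y * g y) = f * g by apply/funext.
rewrite (deriveM df dg) addrC [in RHS]mulrC; congr (_ + _).
Qed.

Lemma pdV f x i : f x != 0 -> drv f x i ->
  pd i (fun y => (f y)^-1) x = - ((f x)^-1 * (f x)^-1 * pd i f x).
Proof.
move=> f0 df; rewrite /pd.
rewrite (deriveV f0 df); rewrite scaleNr; congr (- (_ * _)).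
by rewrite -expr2 exprVn.
Qed.

Lemma pd_cst (c : R) x i : pd i (fun=> c) x = 0.
Proof. exact: derive_cst. Qed.

Lemma is_derive_coord x v j : is_derive x v (fun y : E => y 0 j) (v 0 j).
Proof.
have d := @differentiable_coord R 1 n.+1 x 0 j.
split; first exact: diff_derivable.
have dx : derivable (id : E -> E) x v by exact: derivable_id.
by have := derive_mx dx; rewrite derive_id => /rowP /(_ j); rewrite mxE => <-.
Qed.

Lemma pd_coord x i j : pd i (fun y : E => y 0 j) x = (i == j)%:R.
Proof. by rewrite /pd (derive_val (is_derive := is_derive_coord _ _ _)) mxE eqxx eq_sym. Qed.

Lemma pd_sum (I : Type) (r : seq I) (F : I -> E -> R) x i :
  (forall k : I, drv (F k) x i) ->
  drv (fun y => \sum_(k <- r) F k y) x i /\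
  pd i (fun y => \sum_(k <- r) F k y) x = \sum_(k <- r) pd i (F k) x.
Proof.
move=> dF; elim: r => [|k r [d1 d2]].
  under eq_fun do rewrite big_nil.
  by rewrite big_nil pd_cst; split => //; exact: derivable_cst.
under eq_fun do rewrite big_cons.
rewrite big_cons -d2; split; [exact: (drvD (dF k) d1) | exact: (pdD (dF k) d1)].
Qed.

End PartialDerivatives.

(** * Symmetry of mixed partial derivatives *)

Section Schwarz.
Context {R : realType} {n : nat}.
Local Notation E := 'rV[R]_n.+1.
Implicit Types (f g : E -> R) (x v : E) (i j k : 'I_n.+1) (U : set E).
Local Notation drv f x i := (derivable f x (delta_mx 0 i)).

Lemma norm_delta i : `|delta_mx 0 i : E| <= 1.
Proof.
apply: norm_rV_le => // j; rewrite mxE eqxx /=; case: eqP => _; rewrite ?normr1 ?normr0 //.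
Qed.

(** Two uses of the mean value theorem: along axis [i] for the increment
    [ph y = f (y + h e_j) - f y], then along axis [j] for [pd i f]. *)
Lemma second_difference f x r i j (h : R) : 0 < h -> h + h < r ->
  (forall y, ball x r y -> drv f y i) ->
  (forall y, ball x r y -> drv (pd i f) y j) ->
  exists2 y, `|y - x| <= h + h &
    f (x + h *: delta_mx 0 j + h *: delta_mx 0 i) - f (x + h *: delta_mx 0 i)
    - (f (x + h *: delta_mx 0 j) - f x) = h * (h * pd j (pd i f) y).
Proof.
move=> h0 hr d1 d2.
have bnd (s t : R) : 0 <= s <= 1 -> 0 <= t <= 1 ->
    `|(s * h) *: delta_mx 0 i + (t * h) *: delta_mx 0 j : E| <= h + h.
  move=> /andP[s0 s1] /andP[t0 t1]; apply: le_trans (ler_normD _ _) _.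
  have aux (s' : R) k : 0 <= s' -> s' <= 1 -> `|(s' * h) *: delta_mx 0 k : E| <= h.
    move=> s0' s1'; rewrite normrZ ger0_norm ?mulr_ge0 // ?(ltW h0) //.
    apply: (@le_trans _ _ (s' * h * 1)); first by rewrite ler_wpM2l ?norm_delta ?mulr_ge0 // ltW.
    by rewrite mulr1 ler_piMl // ltW.
  by apply: lerD; apply: aux.
have inb (s t : R) : 0 <= s <= 1 -> 0 <= t <= 1 ->
    ball x r (x + (s * h) *: delta_mx 0 i + (t * h) *: delta_mx 0 j).
  move=> s01 t01; rewrite -ball_normE /ball_ /= -addrA opprD addNKr normrN.
  exact: le_lt_trans (bnd _ _ s01 t01) hr.
have z01 : 0 <= (0 : R) <= 1 by rewrite lexx ler01.
have o01 : 0 <= (1 : R) <= 1 by rewrite lexx ler01.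
pose ph (y : E) := f (y + h *: delta_mx 0 j) - f y.
have dph (t : R) : 0 <= t <= 1 -> is_derive (x + (t * h) *: delta_mx 0 i) (delta_mx 0 i) ph
    (pd i f (x + (t * h) *: delta_mx 0 i + h *: delta_mx 0 j)
     - pd i f (x + (t * h) *: delta_mx 0 i)).
  move=> t01.
  have a1 : drv (fun y => f (y + h *: delta_mx 0 j)) (x + (t * h) *: delta_mx 0 i) i.
    apply: derivable_shift; apply: d1.
    by have := inb t 1 t01 o01; rewrite mul1r.
  have a2 : drv f (x + (t * h) *: delta_mx 0 i) i.
    by apply: d1; have := inb t 0 t01 z01; rewrite mul0r scale0r addr0.
  split; first exact: (drvB a1 a2).
  have := deriveB a1 a2; rewrite derive_shift_arg; apply: etrans.
  by [].
have [t|s s01 E1] := @mvt_line R E ph x (delta_mx 0 i) h.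
  by move=> t01; have [] := dph _ t01.
have [t t01|t t01 E2] := @mvt_line R E (pd i f) (x + (s * h) *: delta_mx 0 i) (delta_mx 0 j) h.
  by apply: d2; apply: inb.
exists (x + (s * h) *: delta_mx 0 i + (t * h) *: delta_mx 0 j).
  by rewrite -[x + _ + _]addrA [x + _]addrC addrK; exact: bnd.
have [_ D] := dph _ s01.
rewrite D E2 in E1; rewrite -E1 /ph [x + h *: delta_mx 0 j + _]addrAC.
by rewrite opprB !addrA; ring.
Qed.

(** The second difference is symmetric in [i] and [j], so it equals [h * h] times either mixed
    derivative, each taken at some point near [x]; continuity at [x] then makes the two agree. *)
Lemma schwarz f x i j :
  (\forall y \near x, drv f y i) -> (\forall y \near x, drv f y j) ->
  (\forall y \near x, drv (pd i f) y j) -> (\forall y \near x, drv (pd j f) y i) ->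
  {for x, continuous (pd j (pd i f))} -> {for x, continuous (pd i (pd j f))} ->
  pd j (pd i f) x = pd i (pd j f) x.
Proof.
move=> d1 d2 d3 d4 c1 c2; apply/eqP; rewrite -subr_eq0 -normr_le0.
apply/ler_addgt0Pl => e e0; rewrite addr0.
have e20 : 0 < e / 2 by rewrite divr_gt0.
have /nbhs_ballP[r /= r0 H] : nbhs x [set y | [/\ drv f y i, drv f y j, drv (pd i f) y j,
   drv (pd j f) y i & `|pd j (pd i f) x - pd j (pd i f) y| <= e / 2 /\
     `|pd i (pd j f) x - pd i (pd j f) y| <= e / 2]].
  move/cvgrPdist_le : c1 => /(_ _ e20) c1; move/cvgrPdist_le : c2 => /(_ _ e20) c2.
  apply: filterS (filterI (filterI d1 d2) (filterI (filterI d3 d4) (filterI c1 c2))).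
  move=> y [[a1 a2] [[a3 a4] a5]]; exact: And5 a1 a2 a3 a4 a5.
(* With [h = r / 4] the points supplied by [second_difference] lie within [2 h < r] of [x]. *)
have h0 : 0 < r / 4 by rewrite divr_gt0.
have hr : r / 4 + r / 4 < r by lra.
have inb y : `|y - x| <= r / 4 + r / 4 -> ball x r y.
  by move=> yx; rewrite -ball_normE /ball_ /= distrC; exact: le_lt_trans hr.
have [| |y1 /inb y1r E1] := @second_difference f x r i j _ h0 hr.
- by move=> y /H[].
- by move=> y /H[].
have [| |y2 /inb y2r E2] := @second_difference f x r j i _ h0 hr.
- by move=> y /H[].
- by move=> y /H[].
have L (a b c d : R) : a - b - (c - d) = a - c - (b - d) by ring.
have E3 : pd j (pd i f) y1 = pd i (pd j f) y2.
  have h1 : r / 4 != 0 by rewrite gt_eqF.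
  move: E1; rewrite L [x + _ + _]addrAC E2 => /(mulfI h1)/(mulfI h1) E3.
  exact/esym.
have [_ _ _ _ [A1 _]] := H _ y1r; have [_ _ _ _ [_ A2]] := H _ y2r.
have L2 (a b c : R) : a - b = (a - c) - (b - c) by ring.
rewrite (L2 _ _ (pd j (pd i f) y1)) {2}E3.
apply: le_trans (ler_normB _ _) _.
by rewrite [leRHS]splitr; exact: (lerD A1 A2).
Qed.

End Schwarz.

(** * Stability of smoothness under composition and algebraic operations *)

Section Smooth.
Context {R : realType}.

Lemma smooth_pd n (U : set 'rV[R]_n.+1) f i : smooth U f -> smooth U (pd i f).
Proof. by move=> sf s x Ux; have := sf (rcons s i) x Ux; rewrite foldr_rcons. Qed.

Lemma smoothS n (U V : set 'rV[R]_n.+1) f : V `<=` U -> smooth U f -> smooth V f.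
Proof. by move=> VU sf s x /VU; exact: sf. Qed.

Lemma smooth_continuous n (U : set 'rV[R]_n.+1) f x : smooth U f -> U x -> {for x, continuous f}.
Proof. by move=> sf Ux; have [] := sf [::] x Ux. Qed.

Lemma smooth_derivable n (U : set 'rV[R]_n.+1) f x i : smooth U f -> U x ->
  derivable f x (delta_mx 0 i).
Proof. by move=> sf Ux; have [_] := sf [::] x Ux. Qed.

Lemma smooth_diff n (U : set 'rV[R]_n.+1) f x : open U -> smooth U f -> U x ->
  differentiable f x /\ (forall v, 'D_v f x = \sum_i v 0 i * pd i f x).
Proof.
move=> oU sf Ux; apply: C1_diff => i.
  by apply: (near_open oU Ux) => y Uy; exact: smooth_derivable Uy.
exact: smooth_continuous (smooth_pd i sf) Ux.
Qed.

Lemma smooth_schwarz n (U : set 'rV[R]_n.+1) f x i j : open U -> smooth U f -> U x ->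
  pd j (pd i f) x = pd i (pd j f) x.
Proof.
move=> oU sf Ux; apply: schwarz; do ?[apply: (near_open oU Ux) => y Uy].
- exact: smooth_derivable Uy.
- exact: smooth_derivable Uy.
- exact: smooth_derivable (smooth_pd i sf) Uy.
- exact: smooth_derivable (smooth_pd j sf) Uy.
- exact: smooth_continuous (smooth_pd j (smooth_pd i sf)) Ux.
- exact: smooth_continuous (smooth_pd i (smooth_pd j sf)) Ux.
Qed.

(** By induction on the list of indices, every iterated partial derivative agrees on [U] with a
    member of [P]. Agreement is asked on [U] only, because values outside are arbitrary; openness of
    [U] makes it survive differentiation. *)
Lemma smooth_coind n (U : set 'rV[R]_n.+1) (P : ('rV[R]_n.+1 -> R) -> Prop) :
  open U ->
  (forall f, P f -> forall x, U x -> {for x, continuous f} /\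
     forall i, derivable f x (delta_mx 0 i)) ->
  (forall f i, P f -> exists2 g, P g & forall x, U x -> pd i f x = g x) ->
  forall f, P f -> smooth U f.
Proof.
move=> oU P1 P2 f Pf s.
have [g Pg E] : exists2 g, P g & forall x, U x -> foldr pd f s x = g x.
  elim: s => [|i s [g Pg E]]; first by exists f.
  have [g' Pg' E'] := P2 _ i Pg; exists g' => // x Ux.
  by rewrite /= -E' //; exact: pd_eq oU Ux E.
move=> x Ux; have nE : \forall y \near x, g y = foldr pd f s y.
  by apply: (near_open oU Ux) => y /E.
have [cg dg] := P1 _ Pg _ Ux; split.
  change (foldr pd f s @ x --> foldr pd f s x); rewrite (E _ Ux).
  by apply: cvg_trans cg; exact: (near_eq_cvg nE).
by move=> i; exact: near_eq_derivable (dg i).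
Qed.

Lemma is_pd_comp m n (F : 'rV[R]_m.+1 -> 'rV[R]_n.+1) (f : 'rV[R]_n.+1 -> R) x i :
  (forall l, derivable (fun y => F y 0 l) x (delta_mx 0 i)) ->
  differentiable f (F x) ->
  (forall v, 'D_v f (F x) = \sum_l v 0 l * pd l f (F x)) ->
  is_derive x (delta_mx 0 i : 'rV[R]_m.+1) (fun y => f (F y))
    (\sum_l pd i (fun y => F y 0 l) x * pd l f (F x)).
Proof.
move=> dF df E.
have dF' : derivable F x (delta_mx 0 i).
  by apply/derivable_mxP => a b; rewrite (ord1 a).
have := is_derive_comp_diff dF' df.
rewrite E derive_mx //; set S := (X in is_derive _ _ _ X -> _).
suff -> : S = \sum_l pd i (fun y => F y 0 l) x * pd l f (F x) by [].
by apply: eq_bigr => l _; rewrite mxE.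
Qed.

(* This class is stable under partial derivatives, so its members are smooth by [smooth_coind]. *)
Inductive sgen {n} (U : set 'rV[R]_n.+1) : ('rV[R]_n.+1 -> R) -> Prop :=
| sgen_base f : smooth U f -> sgen U f
| sgen_cst c : sgen U (fun=> c)
| sgen_coord i : sgen U (fun x => x 0 i)
| sgen_add f g : sgen U f -> sgen U g -> sgen U (fun x => f x + g x)
| sgen_opp f : sgen U f -> sgen U (fun x => - f x)
| sgen_mul f g : sgen U f -> sgen U g -> sgen U (fun x => f x * g x)
| sgen_inv f : (forall x, U x -> f x != 0) -> sgen U f -> sgen U (fun x => (f x)^-1)
| sgen_comp m (W : set 'rV[R]_m.+1) (F : 'rV[R]_n.+1 -> 'rV[R]_m.+1) f :
    open W -> smooth W f -> (forall x, U x -> W (F x)) ->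
    (forall l, sgen U (fun x => F x 0 l)) -> sgen U (fun x => f (F x)).

Lemma sgen_sum n (U : set 'rV[R]_n.+1) (I : Type) (r : seq I) F :
  (forall k : I, sgen U (F k)) -> sgen U (fun x => \sum_(k <- r) F k x).
Proof.
move=> sF; elim: r => [|k r IH].
  by under eq_fun do rewrite big_nil; exact: sgen_cst.
by under eq_fun do rewrite big_cons; apply: sgen_add.
Qed.

Lemma continuous_mx m n (T : topologicalType) (F : T -> 'M[R]_(m, n)) x :
  (forall i j, {for x, continuous (fun y => F y i j)}) -> {for x, continuous F}.
Proof.
move=> cF A [P HP sA].
have : \forall y \near x, forall i j, P i j (F y i j).
  apply: filter_forall => i; apply: filter_forall => j; exact: (cF i j _ (HP i j)).
by apply: filterS => y; exact: sA.
Qed.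

Lemma sgen_spec n (U : set 'rV[R]_n.+1) f : sgen U f ->
  (forall x, U x -> {for x, continuous f} /\ forall i, derivable f x (delta_mx 0 i)) /\
  (forall i, exists2 g, sgen U g & forall x, U x -> pd i f x = g x).
Proof.
elim=> {f} [f sf|c|i|f g sf [IH1 IH1'] sg [IH2 IH2']|f sf [IH IH']
   |f g sf [IH1 IH1'] sg [IH2 IH2']|f f0 sf [IH IH']|m W F f oW sf UW sF IH].
- split=> [x Ux|i].
    by split; [exact: smooth_continuous Ux | move=> i; exact: smooth_derivable Ux].
  by exists (pd i f) => //; apply: sgen_base; exact: smooth_pd.
- split=> [x Ux|i].
    split; [exact: (@cst_continuous _ _ c x) | move=> i; exact: (@derivable_cst _ _ _ c)].
  by exists (fun=> 0) => [|x _]; [exact: sgen_cst | rewrite pd_cst].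
- split=> [x Ux|j].
    split; first exact: coord_continuous.
    by move=> j; have [] := is_derive_coord x (delta_mx 0 j) i.
  by exists (fun=> (j == i)%:R) => [|x _]; [exact: sgen_cst | rewrite pd_coord].
- split=> [x Ux|i].
    have [c1 d1] := IH1 _ Ux; have [c2 d2] := IH2 _ Ux.
    by split; [exact: (cvgD c1 c2) | move=> i; exact: (drvD (d1 i) (d2 i))].
  have [f' sf' Ef] := IH1' i; have [g' sg' Eg] := IH2' i.
  exists (fun x => f' x + g' x) => [|x Ux]; first exact: sgen_add.
  by rewrite (pdD ((IH1 _ Ux).2 i) ((IH2 _ Ux).2 i)) Ef ?Eg.
- split=> [x Ux|i].
    have [c1 d1] := IH _ Ux.
    by split; [exact: (cvgN c1) | move=> i; exact: (drvN (d1 i))].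
  have [f' sf' Ef] := IH' i.
  exists (fun x => - f' x) => [|x Ux]; first exact: sgen_opp.
  by rewrite (pdN ((IH _ Ux).2 i)) Ef.
- split=> [x Ux|i].
    have [c1 d1] := IH1 _ Ux; have [c2 d2] := IH2 _ Ux.
    by split; [exact: (cvgM c1 c2) | move=> i; exact: (drvM (d1 i) (d2 i))].
  have [f' sf' Ef] := IH1' i; have [g' sg' Eg] := IH2' i.
  exists (fun x => f' x * g x + f x * g' x) => [|x Ux].
    by apply: sgen_add; apply: sgen_mul.
  by rewrite (pdM ((IH1 _ Ux).2 i) ((IH2 _ Ux).2 i)) Ef ?Eg.
- split=> [x Ux|i].
    have [c1 d1] := IH _ Ux.
    by split; [exact: (cvgV (f0 _ Ux) c1) | move=> i; exact: (drvV (f0 _ Ux) (d1 i))].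
  have [f' sf' Ef] := IH' i.
  exists (fun x => - ((f x)^-1 * (f x)^-1 * f' x)) => [|x Ux].
    by apply: sgen_opp; do !apply: sgen_mul => //; exact: sgen_inv.
  by rewrite (pdV (f0 _ Ux) ((IH _ Ux).2 i)) Ef.
- split=> [x Ux|i].
    have [df E] := smooth_diff oW sf (UW _ Ux).
    split.
      apply: (@continuous_comp _ _ _ F f); last exact: smooth_continuous sf (UW _ Ux).
      apply: continuous_mx => a b; rewrite (ord1 a); exact: ((IH b).1 _ Ux).1.
    move=> i; have [] // := @is_pd_comp _ _ F f x i _ df E.
    by move=> l; exact: ((IH l).1 _ Ux).2.
  (* The induction hypothesis only asserts that a generated function agrees with each [pd i (F_l)];
     one is chosen for every [l] in order to write down the chain rule as a sum. *)
  pose G l := projT1 (cid2 ((IH l).2 i)).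
  have sG l : sgen U (G l) by rewrite /G; case: cid2.
  have EG l x : U x -> pd i (fun y => F y 0 l) x = G l x.
    by rewrite /G; case: cid2 => g /= _; apply.
  exists (fun x => \sum_l G l x * pd l f (F x)) => [|x Ux].
    apply: sgen_sum => l; apply: sgen_mul => //.
    by apply: sgen_comp oW (smooth_pd l sf) UW sF.
  have [df E] := smooth_diff oW sf (UW _ Ux).
  have [_ H] := @is_pd_comp _ _ F f x i (fun l => ((IH l).1 _ Ux).2 i) df E.
  by apply: etrans H _; apply: eq_bigr => l _; rewrite EG.
Qed.

Lemma sgen_smooth n (U : set 'rV[R]_n.+1) f : open U -> sgen U f -> smooth U f.
Proof.
move=> oU; apply: (smooth_coind oU) => {}f; first by case/sgen_spec.
by move=> i /sgen_spec [_]; apply.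
Qed.

End Smooth.

Lemma smooth_mxP {R : realType} {n p q : nat} (U : set 'rV[R]_n.+1) (A : 'rV[R]_n.+1 -> 'M[R]_(p, q)) :
  smooth_mx U A <-> forall i j, smooth U (fun x => A x i j).
Proof. by []. Qed.

Lemma smooth_entry {R : realType} {n p q : nat} (U : set 'rV[R]_n.+1) (A : 'rV[R]_n.+1 -> 'M[R]_(p, q)) :
  smooth_mx U A -> forall i j, smooth U (fun x => A x i j).
Proof. by []. Qed.

(* Otherwise [done] tries to unify goals with the unfolded smoothness hypotheses, which diverges in practice. *)
Opaque smooth smooth_mx.

(** * Smooth matrix-valued functions and their derivatives *)

Section SmoothMatrices.
Context {R : realType} {n : nat}.
Local Notation E := 'rV[R]_n.+1.
Implicit Types (U : set E) (f g : E -> R).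

Lemma smooth_eq U f g : open U -> (forall x, U x -> f x = g x) -> smooth U f -> smooth U g.
Proof.
move=> oU fg sf; apply: (@smooth_coind _ _ U (fun g => exists2 f, smooth U f &
  forall x, U x -> f x = g x) oU).
- move=> {fg sf}f0 [h sh E0] x Ux; have nE := near_open oU Ux E0; split.
    change (f0 @ x --> f0 x); rewrite -(E0 _ Ux); apply: cvg_trans (smooth_continuous sh Ux).
    exact: (near_eq_cvg nE).
  by move=> i; have dh := smooth_derivable (i:=i) sh Ux; exact: near_eq_derivable dh.
- move=> {fg sf}f0 i [h sh E0]; exists (pd i f0) => //; exists (pd i h); first exact: smooth_pd.
  by move=> x Ux; apply: pd_eq oU Ux E0.
- by exists f.
Qed.

Lemma smooth_cst U c : open U -> smooth U (fun=> c).
Proof. by move=> oU; apply: sgen_smooth => //; exact: sgen_cst. Qed.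

Lemma smooth_coord U i : open U -> smooth U (fun x => x 0 i).
Proof. by move=> oU; apply: sgen_smooth => //; exact: sgen_coord. Qed.

Lemma smoothD U f g : open U -> smooth U f -> smooth U g -> smooth U (fun x => f x + g x).
Proof. by move=> oU sf sg; exact: (sgen_smooth oU (sgen_add (sgen_base sf) (sgen_base sg))). Qed.

Lemma smoothN U f : open U -> smooth U f -> smooth U (fun x => - f x).
Proof. by move=> oU sf; exact: (sgen_smooth oU (sgen_opp (sgen_base sf))). Qed.

Lemma smoothB U f g : open U -> smooth U f -> smooth U g -> smooth U (fun x => f x - g x).
Proof. by move=> oU sf sg; exact: (smoothD oU sf (smoothN oU sg)). Qed.

Lemma smoothM U f g : open U -> smooth U f -> smooth U g -> smooth U (fun x => f x * g x).
Proof. by move=> oU sf sg; exact: (sgen_smooth oU (sgen_mul (sgen_base sf) (sgen_base sg))). Qed.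

Lemma smoothV U f : open U -> (forall x, U x -> f x != 0) -> smooth U f ->
  smooth U (fun x => (f x)^-1).
Proof. by move=> oU f0 sf; exact: (sgen_smooth oU (sgen_inv f0 (sgen_base sf))). Qed.

Lemma smooth_comp m U (V : set 'rV[R]_m.+1) (F : E -> 'rV[R]_m.+1) (f : 'rV[R]_m.+1 -> R) : open U -> open V ->
  smooth V f -> (forall x, U x -> V (F x)) -> smooth_mx U F -> smooth U (fun x => f (F x)).
Proof.
move=> oU oV sf UV sF; apply: sgen_smooth => //; apply: sgen_comp oV sf UV _ => l.
exact: (sgen_base (smooth_entry sF 0 l)).
Qed.

Lemma smooth_sum U (I : Type) (r : seq I) (P : pred I) (F : I -> E -> R) : open U ->
  (forall i, P i -> smooth U (F i)) -> smooth U (fun x => \sum_(i <- r | P i) F i x).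
Proof.
move=> oU sF; elim: r => [|i r IH].
  by under eq_fun do rewrite big_nil; exact: smooth_cst.
under eq_fun do rewrite big_cons.
case Pi: (P i); [exact: (smoothD oU (sF _ Pi) IH) | exact: IH].
Qed.

Lemma smooth_prod U (I : Type) (r : seq I) (P : pred I) (F : I -> E -> R) : open U ->
  (forall i, P i -> smooth U (F i)) -> smooth U (fun x => \prod_(i <- r | P i) F i x).
Proof.
move=> oU sF; elim: r => [|i r IH].
  by under eq_fun do rewrite big_nil; exact: smooth_cst.
under eq_fun do rewrite big_cons.
case Pi: (P i); [exact: (smoothM oU (sF _ Pi) IH) | exact: IH].
Qed.

Lemma smooth_det U p (A : E -> 'M[R]_p) : open U -> smooth_mx U A ->
  smooth U (fun x => \det (A x)).
Proof.
move=> oU sA; apply: smooth_sum => // s _; apply: smoothM => //; first exact: smooth_cst.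
by apply: smooth_prod => // i _; exact: smooth_entry.
Qed.

Lemma smooth_mx_eq U p q (A B : E -> 'M[R]_(p, q)) : open U ->
  (forall x, U x -> A x = B x) -> smooth_mx U A -> smooth_mx U B.
Proof.
move=> oU AB sA; apply/smooth_mxP => i j; apply: (smooth_eq oU _ (smooth_entry sA i j)) => x Ux /=.
by rewrite AB.
Qed.

Lemma smooth_mxS U V p q (A : E -> 'M[R]_(p, q)) : V `<=` U -> smooth_mx U A -> smooth_mx V A.
Proof. by move=> VU sA; apply/smooth_mxP => i j; exact: smoothS VU (smooth_entry sA i j). Qed.

Lemma smooth_mx_cst U p q (A : 'M[R]_(p, q)) : open U -> smooth_mx U (fun=> A).
Proof. by move=> oU; apply/smooth_mxP => i j; exact: smooth_cst. Qed.

Lemma smooth_mx_matrix U p q (F : 'I_p -> 'I_q -> E -> R) :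
  (forall i j, smooth U (F i j)) -> smooth_mx U (fun x => \matrix_(i, j) F i j x).
Proof. by move=> sF; apply/smooth_mxP => i j; under eq_fun do rewrite mxE; exact: sF. Qed.

Lemma smooth_mxD U p q (A B : E -> 'M[R]_(p, q)) : open U ->
  smooth_mx U A -> smooth_mx U B -> smooth_mx U (fun x => A x + B x).
Proof. by move=> oU sA sB; apply/smooth_mxP => i j; under eq_fun do rewrite mxE; exact: (smoothD oU (smooth_entry sA i j) (smooth_entry sB i j)). Qed.

Lemma smooth_mxN U p q (A : E -> 'M[R]_(p, q)) : open U ->
  smooth_mx U A -> smooth_mx U (fun x => - A x).
Proof. by move=> oU sA; apply/smooth_mxP => i j; under eq_fun do rewrite mxE; exact: (smoothN oU (smooth_entry sA i j)). Qed.

Lemma smooth_mxB U p q (A B : E -> 'M[R]_(p, q)) : open U ->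
  smooth_mx U A -> smooth_mx U B -> smooth_mx U (fun x => A x - B x).
Proof. by move=> oU sA sB; exact: (smooth_mxD oU sA (smooth_mxN oU sB)). Qed.

Lemma smooth_mxZ U p q f (A : E -> 'M[R]_(p, q)) : open U ->
  smooth U f -> smooth_mx U A -> smooth_mx U (fun x => f x *: A x).
Proof. by move=> oU sf sA; apply/smooth_mxP => i j; under eq_fun do rewrite mxE; exact: (smoothM oU sf (smooth_entry sA i j)). Qed.

Lemma smooth_mxM U p q r (A : E -> 'M[R]_(p, q)) (B : E -> 'M[R]_(q, r)) : open U ->
  smooth_mx U A -> smooth_mx U B -> smooth_mx U (fun x => A x *m B x).
Proof.
move=> oU sA sB; apply/smooth_mxP => i j; under eq_fun do rewrite mxE.
by apply: smooth_sum => // k _; exact: (smoothM oU (smooth_entry sA i k) (smooth_entry sB k j)).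
Qed.

Lemma smooth_mxT U p q (A : E -> 'M[R]_(p, q)) : smooth_mx U A -> smooth_mx U (fun x => (A x)^T).
Proof. by move=> sA; apply/smooth_mxP => i j; under eq_fun do rewrite mxE; exact: smooth_entry. Qed.

Lemma smooth_mx_sum U p q (I : Type) (r : seq I) (F : I -> E -> 'M[R]_(p, q)) : open U ->
  (forall i, smooth_mx U (F i)) -> smooth_mx U (fun x => \sum_(i <- r) F i x).
Proof.
move=> oU sF; apply/smooth_mxP => i j; under eq_fun do rewrite summxE.
by apply: smooth_sum => // k _; exact: smooth_entry.
Qed.

(** Cramer's rule: the entries of the inverse are cofactors divided by a determinant without
    zeros. *)
Lemma smooth_mxV U p (A : E -> 'M[R]_p) : open U -> (forall x, U x -> A x \in unitmx) ->
  smooth_mx U A -> smooth_mx U (fun x => invmx (A x)).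
Proof.
move=> oU uA sA.
have E0 x : U x -> (\det (A x))^-1 *: \adj (A x) = invmx (A x) by move=> Ux; rewrite /invmx uA.
have d0 x : U x -> \det (A x) != 0 by move=> /uA; rewrite unitmxE unitfE.
apply: (smooth_mx_eq oU E0); apply: (smooth_mxZ oU (smoothV oU d0 (smooth_det oU sA))).
apply/smooth_mxP => i j; under eq_fun do rewrite mxE.
apply: (smoothM oU (smooth_cst _ oU)).
apply: (smooth_det oU); apply/smooth_mxP => a b; under eq_fun do rewrite !mxE.
exact: smooth_entry.
Qed.

Lemma smooth_mx_comp m U (V : set 'rV[R]_m.+1) p q (F : E -> 'rV[R]_m.+1) (A : 'rV[R]_m.+1 -> 'M[R]_(p, q)) :
  open U -> open V -> smooth_mx V A -> (forall x, U x -> V (F x)) -> smooth_mx U F ->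
  smooth_mx U (fun x => A (F x)).
Proof. by move=> oU oV sA UV sF; apply/smooth_mxP => i j; exact: smooth_comp oU oV (smooth_entry sA i j) UV sF. Qed.

Definition pdmx p q (i : 'I_n.+1) (A : E -> 'M[R]_(p, q)) (x : E) : 'M[R]_(p, q) :=
  \matrix_(a, b) pd i (fun y => A y a b) x.

Lemma pdmxE p q i (A : E -> 'M[R]_(p, q)) x a b : pdmx i A x a b = pd i (fun y => A y a b) x.
Proof. by rewrite mxE. Qed.

Lemma smooth_pdmx U p q i (A : E -> 'M[R]_(p, q)) : smooth_mx U A -> smooth_mx U (pdmx i A).
Proof. by move=> sA; apply: smooth_mx_matrix => a b; exact: (smooth_pd i (smooth_entry sA a b)). Qed.

Lemma pdmx_eq U p q i (A B : E -> 'M[R]_(p, q)) x : open U -> U x ->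
  (forall y, U y -> A y = B y) -> pdmx i A x = pdmx i B x.
Proof.
move=> oU Ux AB; apply/matrixP => a b; rewrite !mxE; apply: pd_eq oU Ux _ => y /AB -> //.
Qed.

Lemma pdmx_cst p q i (A : 'M[R]_(p, q)) x : pdmx i (fun=> A) x = 0.
Proof. by apply/matrixP => a b; rewrite !mxE pd_cst. Qed.

Lemma pdmxD U p q i (A B : E -> 'M[R]_(p, q)) x : U x -> smooth_mx U A -> smooth_mx U B ->
  pdmx i (fun y => A y + B y) x = pdmx i A x + pdmx i B x.
Proof.
move=> Ux sA sB; apply/matrixP => a b; rewrite !mxE.
under [in LHS]eq_fun do rewrite mxE.
by rewrite (pdD (smooth_derivable (i:=i) (smooth_entry sA a b) Ux) (smooth_derivable (i:=i) (smooth_entry sB a b) Ux)).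
Qed.

Lemma pdmxN U p q i (A : E -> 'M[R]_(p, q)) x : U x -> smooth_mx U A ->
  pdmx i (fun y => - A y) x = - pdmx i A x.
Proof.
move=> Ux sA; apply/matrixP => a b; rewrite !mxE.
under [in LHS]eq_fun do rewrite mxE.
by rewrite (pdN (smooth_derivable (i:=i) (smooth_entry sA a b) Ux)).
Qed.

Lemma pdmxM U p q r i (A : E -> 'M[R]_(p, q)) (B : E -> 'M[R]_(q, r)) x : U x ->
  smooth_mx U A -> smooth_mx U B ->
  pdmx i (fun y => A y *m B y) x = pdmx i A x *m B x + A x *m pdmx i B x.
Proof.
move=> Ux sA sB; apply/matrixP => a b; rewrite !mxE.
under [in LHS]eq_fun do rewrite mxE.
have dA c d := smooth_derivable (i:=i) (smooth_entry sA c d) Ux; have dB c d := smooth_derivable (i:=i) (smooth_entry sB c d) Ux.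
rewrite (pd_sum _ _).2; last by move=> k; exact: (drvM (dA _ _) (dB _ _)).
rewrite -big_split /=; apply: eq_bigr => k _.
by rewrite (pdM (dA _ _) (dB _ _)) !mxE.
Qed.

Lemma pdmxZ U p q i f (A : E -> 'M[R]_(p, q)) x : U x -> smooth U f -> smooth_mx U A ->
  pdmx i (fun y => f y *: A y) x = pd i f x *: A x + f x *: pdmx i A x.
Proof.
move=> Ux sf sA; apply/matrixP => a b; rewrite !mxE.
under [in LHS]eq_fun do rewrite mxE.
by rewrite (pdM (smooth_derivable (i:=i) sf Ux) (smooth_derivable (i:=i) (smooth_entry sA a b) Ux)).
Qed.

Lemma pdmx_sum U p q i (I : Type) (r : seq I) (F : I -> E -> 'M[R]_(p, q)) x : U x ->
  (forall k, smooth_mx U (F k)) ->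
  pdmx i (fun y => \sum_(k <- r) F k y) x = \sum_(k <- r) pdmx i (F k) x.
Proof.
move=> Ux sF; apply/matrixP => a b; rewrite !mxE summxE.
under [in LHS]eq_fun do rewrite summxE.
rewrite (pd_sum _ _).2; last by move=> k; exact: (smooth_derivable (i:=i) (smooth_entry (sF k) a b) Ux).
by apply: eq_bigr => k _; rewrite mxE.
Qed.

Lemma pdmxT p q i (A : E -> 'M[R]_(p, q)) x : pdmx i (fun y => (A y)^T) x = (pdmx i A x)^T.
Proof.
apply/matrixP => a b; rewrite !mxE.
by under [in LHS]eq_fun do rewrite mxE.
Qed.

Lemma pdmx_schwarz U p q i j (A : E -> 'M[R]_(p, q)) x : open U -> U x -> smooth_mx U A ->
  pdmx i (pdmx j A) x = pdmx j (pdmx i A) x.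
Proof.
move=> oU Ux sA; apply/matrixP => a b.
rewrite [LHS]pdmxE [RHS]pdmxE.
have E0 k : (fun y => pdmx k A y a b) = pd k (fun y => A y a b).
  by apply/funext => y; exact: pdmxE.
rewrite (E0 j).
rewrite (E0 i).
exact: (smooth_schwarz j i oU (smooth_entry sA a b) Ux).
Qed.

Lemma derive_pdmx U p q (A : E -> 'M[R]_(p, q)) x v : open U -> U x -> smooth_mx U A ->
  'D_v A x = \sum_i v 0 i *: pdmx i A x.
Proof.
move=> oU Ux sA.
have dA : derivable A x v.
  by apply/derivable_mxP => a b; apply: diff_derivable; case: (smooth_diff oU (smooth_entry sA a b) Ux).
rewrite derive_mx //; apply/matrixP => a b; rewrite !mxE summxE.
rewrite (smooth_diff oU (smooth_entry sA a b) Ux).2.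
by apply: eq_bigr => i _; rewrite !mxE.
Qed.

Lemma pd_comp m U (V : set 'rV[R]_m.+1) (F : E -> 'rV[R]_m.+1) (f : 'rV[R]_m.+1 -> R) x i : open U -> open V ->
  smooth V f -> (forall x, U x -> V (F x)) -> smooth_mx U F -> U x ->
  pd i (fun x => f (F x)) x = \sum_l pd i (fun y => F y 0 l) x * pd l f (F x).
Proof.
move=> oU oV sf UV sF Ux.
have [df Ef] := smooth_diff oV sf (UV _ Ux).
by have [_] := @is_pd_comp _ _ _ F f x i (fun l => smooth_derivable (i:=i) (smooth_entry sF 0 l) Ux) df Ef.
Qed.

Lemma pdmx_comp m U (V : set 'rV[R]_m.+1) p q (F : E -> 'rV[R]_m.+1) (A : 'rV[R]_m.+1 -> 'M[R]_(p, q)) x i :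
  open U -> open V -> smooth_mx V A -> (forall x, U x -> V (F x)) -> smooth_mx U F -> U x ->
  pdmx i (fun x => A (F x)) x = \sum_l jac F x i l *: \matrix_(a, b) pd l (fun y => A y a b) (F x).
Proof.
move=> oU oV sA UV sF Ux; apply/matrixP => a b; rewrite !mxE summxE.
rewrite (pd_comp i oU oV (smooth_entry sA a b) UV sF Ux).
by apply: eq_bigr => l _; rewrite !mxE.
Qed.

End SmoothMatrices.

(** * The inverse function theorem *)

(** Makes matrices a complete space, as [banach_fixed_point] asks in [inverse_function]. *)
HB.instance Definition _ (R : realType) m n :=
  Uniform_isComplete.Build 'M[R]_(m, n) (@cauchy_cvg 'M[R]_(m, n)).

Section InverseFunction.
Context {R : realType} {n : nat}.
Local Notation E := 'rV[R]_n.+1.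

Lemma cball_convex (p x y : E) r (t : R) : 0 <= t <= 1 ->
  `|x - p| <= r -> `|y - p| <= r -> `|x + t *: (y - x) - p| <= r.
Proof.
move=> /andP[t0 t1] xr yr.
have -> : x + t *: (y - x) - p = (1 - t) *: (x - p) + t *: (y - p).
  rewrite !scalerBr !scalerBl !scale1r opprB.
  by apply/rowP => i; rewrite !mxE; ring.
apply: le_trans (ler_normD _ _) _.
rewrite !normrZ (ger0_norm t0) ger0_norm ?subr_ge0 //.
have -> : r = (1 - t) * r + t * r by rewrite mulrBl mul1r subrK.
by apply: lerD; apply: ler_wpM2l => //; rewrite subr_ge0.
Qed.

Lemma mulmx_norm_le (A : 'M[R]_n.+1) : exists2 c, 0 < c & forall v : E, `|v *m A| <= c * `|v|.
Proof.
exists (1 + \sum_i \sum_j `|A i j|).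
  by rewrite ltr_pwDl // sumr_ge0 // => i _; apply: sumr_ge0.
move=> v; apply: norm_rV_le => [|j].
  by rewrite mulr_ge0 // addr_ge0 // sumr_ge0 // => i _; apply: sumr_ge0.
rewrite mxE; apply: le_trans (ler_norm_sum _ _ _) _.
apply: (@le_trans _ _ (\sum_i (\sum_j `|A i j|) * `|v|)); last first.
  by rewrite -mulr_suml ler_wpM2r // lerDr.
apply: ler_sum => i _; rewrite normrM mulrC; apply: ler_pM => //; last exact: norm_rV_coord.
by rewrite (bigD1 j) //= lerDl sumr_ge0.
Qed.

(** The mean value theorem is used on each component; in the sup norm, [n.+1] partial derivatives of
    size at most [1/2 / n.+1] add up to the constant 1/2. The closed ball is convex, so the segment
    stays inside it. *)
Lemma small_jac_lipschitz (U : set E) (K : E -> E) p r : open U -> smooth_mx U K ->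
  (forall x, `|x - p| <= r -> U x /\ forall i a, `|pd i (fun y => K y 0 a) x| <= 2^-1 / n.+1%:R) ->
  forall x y, `|x - p| <= r -> `|y - p| <= r -> `|K x - K y| <= 2^-1 * `|x - y|.
Proof.
move=> oU sK H x y xr yr; apply: norm_rV_le => [|a].
  by rewrite mulr_ge0.
rewrite !mxE.
have inU (t : R) : 0 <= t <= 1 -> `|y + (t * 1) *: (x - y) - p| <= r.
  by move=> t01; rewrite mulr1; exact: cball_convex.
have dK (t : R) : 0 <= t <= 1 -> derivable (fun z => K z 0 a) (y + (t * 1) *: (x - y)) (x - y).
  move=> t01; have [Ut _] := H _ (inU _ t01).
  exact: diff_derivable (smooth_diff oU (smooth_entry sK 0 a) Ut).1.
have [t t01] := mvt_line dK.
rewrite scale1r [y + _]addrC subrK mul1r => ->.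
have [Ut bt] := H _ (inU _ t01).
rewrite (smooth_diff oU (smooth_entry sK 0 a) Ut).2.
apply: le_trans (ler_norm_sum _ _ _) _.
have -> : 2^-1 * `|x - y| = \sum_(i < n.+1) (`|x - y| * (2^-1 / n.+1%:R)).
  rewrite sumr_const card_ord -mulrnAr -[X in _ = _ * X]mulr_natr divfK ?pnatr_eq0 //.
  by rewrite mulrC.
apply: ler_sum => i _; rewrite normrM; apply: ler_pM => //; exact: norm_rV_coord.
Qed.

Lemma smooth_mx_continuous (U : set E) m p (A : E -> 'M[R]_(m, p)) x :
  smooth_mx U A -> U x -> {for x, continuous A}.
Proof.
move=> sA Ux; apply: continuous_mx => i j; exact: (smooth_continuous (smooth_entry sA i j) Ux).
Qed.

Lemma open_preimage_in (T T' : topologicalType) (U : set T) (F : T -> T') (B : set T') :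
  open U -> (forall x, U x -> {for x, continuous F}) -> open B -> open (U `&` F @^-1` B).
Proof.
move=> oU cF oB; rewrite openE => x [Ux Bx]; apply: filterI; first exact: open_nbhs_nbhs.
by apply: (cF _ Ux); exact: open_nbhs_nbhs.
Qed.

(** [K] is the simplified Newton map: its Jacobian [1 - jac F x *m A] vanishes at [p], so it is
    small near [p]. The same smallness keeps [jac F x] invertible. *)
Lemma local_contraction (U : set E) (F : E -> E) p : open U -> smooth_mx U F -> U p ->
  jac F p \in unitmx ->
  let A : 'M[R]_n.+1 := invmx (jac F p) in let K := fun x : E => x - F x *m A : E in
  exists2 r, 0 < r & (forall x, `|x - p| <= r -> U x) /\
    (forall x y, `|x - p| <= r -> `|y - p| <= r -> `|K x - K y| <= 2^-1 * `|x - y|) /\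
    (forall x, `|x - p| <= r -> jac F x \in unitmx).
Proof.
move=> oU sF Up uJ A K.
have sK : smooth_mx U K.
  apply: (smooth_mxB oU); last exact: (smooth_mxM oU sF (smooth_mx_cst A oU)).
  by apply/smooth_mxP => i j; rewrite (ord1 i); exact: smooth_coord.
have pK i a x : U x -> pd i (fun y => K y 0 a) x = (1%:M - jac F x *m A) i a.
  move=> Ux; rewrite [X in pd i X](_ : _ = fun y : E => y 0 a - (F y *m A) 0 a); last first.
    by apply/funext => y; rewrite !mxE.
  rewrite pdB; [|by have [] := is_derive_coord x (delta_mx 0 i) a|]; last first.
    exact: (smooth_derivable (smooth_entry (smooth_mxM oU sF (smooth_mx_cst A oU)) 0 a) Ux).
  rewrite pd_coord -(pdmxE i (fun y => F y *m A)) (pdmxM i Ux sF (smooth_mx_cst A oU)).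
  rewrite pdmx_cst mulmx0 addr0 !mxE; congr (_ - _).
  by apply: eq_bigr => k _; rewrite !mxE.
have e0 : 0 < 2^-1 / n.+1%:R :> R by rewrite divr_gt0.
have sm i a : \forall x \near p, `|pd i (fun y => K y 0 a) x| <= 2^-1 / n.+1%:R.
  have cp := smooth_continuous (smooth_pd i (smooth_entry sK 0 a)) Up.
  move/cvgrPdist_le : cp => /(_ _ e0).
  rewrite (pK _ _ _ Up) mulmxV // subrr mxE.
  by apply: filterS => x; rewrite sub0r normrN.
have /nbhs_ballP[r /= r0 H] : nbhs p [set x | U x /\ forall i a,
     `|pd i (fun y => K y 0 a) x| <= 2^-1 / n.+1%:R].
  apply: filterI; first exact: open_nbhs_nbhs.
  exact: (filter_forall _ (fun i => filter_forall _ (fun a => sm i a))).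
have inb x : `|x - p| <= r / 2 -> ball p r x.
  move=> xp; rewrite -ball_normE /ball_ /= distrC.
  by apply: le_lt_trans xp _; rewrite ltr_pdivrMr // ltr_pMr // ltr1n.
exists (r / 2); first by rewrite divr_gt0.
split; first by move=> x /inb/H[].
split; first by apply: (small_jac_lipschitz oU sK) => x /inb/H.
move=> x /inb/H [Ux b].
have : row_free (jac F x *m A).
  apply/row_freeP; suff : row_free (jac F x *m A) by move/row_freeP.
  rewrite -kermx_eq0; apply/eqP/row_matrixP => i; rewrite row0.
  set v := row i _.
  have : v *m (jac F x *m A) = 0 by rewrite /v -row_mul mulmx_ker row0.
  move=> v0.
  (* A vector [v] of the kernel is reproduced by a matrix that at least halves norms, hence
     [v = 0]. *)
  have vE : v = v *m (1%:M - jac F x *m A) by rewrite mulmxBr mulmx1 v0 subr0.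
  apply/eqP; rewrite -normr_le0.
  have : `|v| <= 2^-1 * `|v|.
    rewrite {1}vE; apply: norm_rV_le => [|a]; first by rewrite mulr_ge0.
    rewrite mxE; apply: le_trans (ler_norm_sum _ _ _) _.
    have -> : 2^-1 * `|v| = \sum_(i < n.+1) (`|v| * (2^-1 / n.+1%:R)).
      rewrite sumr_const card_ord -mulrnAr -[X in _ = _ * X]mulr_natr divfK ?pnatr_eq0 //.
      by rewrite mulrC.
    apply: ler_sum => k _; rewrite normrM; apply: ler_pM => //; first exact: norm_rV_coord.
    by rewrite -(pK k a _ Ux).
  lra.
rewrite -row_free_unit => rf.
by move: rf; rewrite !row_free_unit unitmx_mul => /andP[].
Qed.

(** Preimages of [y] are the fixed points of [x |-> K x + y *m A], a contraction of a closed ball.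
    The inverse [h] is then Lipschitz, next derivable with the inverse Jacobian as derivative, and
    finally smooth by coinduction. *)
Theorem inverse_function (U : set E) (F : E -> E) p : open U -> smooth_mx U F -> U p ->
  jac F p \in unitmx ->
  exists (r : R) (D : set E) (h : E -> E),
    [/\ 0 < r, open D, D p & D `<=` U] /\
    [/\ (forall x, D x -> ball (F p) r (F x) /\ h (F x) = x),
        (forall y, ball (F p) r y -> D (h y) /\ F (h y) = y) &
        smooth_mx (ball (F p) r) h].
Proof.
move=> oU sF Up uJ.
have [r0 r00 [CU [lip uC]]] := local_contraction oU sF Up uJ.
set A := invmx (jac F p) in lip; set K := fun x : E => x - F x *m A : E.
have [c c0 cA] := mulmx_norm_le A.
(* Then [(y - F p) *m A] has norm at most [r0 / 4]; with [r0 / 2] from the contraction this maps the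
   closed ball of radius [r0] strictly into itself. *)
pose r := r0 / (4 * c).
have rp : 0 < r by rewrite divr_gt0 // mulr_gt0.
have Kp x y : K x + y *m A - p = K x - K p + (y - F p) *m A.
  rewrite /K mulmxBl opprB !addrA; apply/rowP => i; rewrite !mxE; ring.
have inball y : ball (F p) r y -> `|(y - F p) *m A| <= r0 / 4.
  rewrite -ball_normE /ball_ /= distrC => yr; apply: le_trans (cA _) _.
  rewrite -ler_pdivlMl //; apply: le_trans (ltW yr) _.
  by rewrite /r invfM mulrA mulrC.
have bnd y x : ball (F p) r y -> `|x - p| <= r0 -> `|K x + y *m A - p| < r0.
  move=> yr xr; rewrite Kp; apply: le_lt_trans (ler_normD _ _) _.
  have := lip x p xr; rewrite subrr normr0 => /(_ (ltW r00)) l1.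
  have l2 := inball _ yr.
  have : `|x - p| <= r0 by [].
  move: l1 l2; rewrite -/(K x) -/(K p) => l1 l2 l3; lra.
have fixE y x : x = K x + y *m A <-> F x = y.
  rewrite /K; split=> [H|->]; last by rewrite subrK.
  have : (F x - y) *m A = 0.
    rewrite mulmxBl; apply/eqP; rewrite subr_eq0; apply/eqP.
    move: H; rewrite addrAC -addrA -{1}[x]addr0 => /addrI /esym/eqP.
    by rewrite subr_eq0 => /eqP ->.
  move/(congr1 (mulmx^~ (jac F p))); rewrite mulmxKV // mul0mx => /eqP.
  by rewrite subr_eq0 => /eqP.
have ex y : ball (F p) r y -> exists x, `|x - p| < r0 /\ F x = y.
  move=> yr; pose C := [set x : E | `|x - p| <= r0].
  have fC : set_fun C C (fun x => K x + y *m A).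
    by move=> x /= xr; apply: ltW; exact: bnd.
  pose f : {fun C >-> C} := mkfun_fun fC.
  have ctr : is_contraction f.
    have q0 : 0 <= 2^-1 :> R by [].
    exists (NngNum q0); split => /=; first lra.
    move=> [x1 x2] [/= Cx1 Cx2]; rewrite opprD addrACA subrr addr0; exact: lip.
  have clC : closed C.
    have -> : C = closed_ball_ Num.Def.normr p r0.
      by apply/seteqP; split=> x; rewrite /C /closed_ball_ /= distrC.
    exact: closed_closed_ball_.
  have [|x Cx] := banach_fixed_point ctr clC.
    by exists p; rewrite /C /= subrr normr0 ltW.
  move=> /= fx; exists x; split; last exact/fixE.
  by rewrite {1}fx; exact: bnd.
have uniq x x' : `|x - p| <= r0 -> `|x' - p| <= r0 ->
    `|x - x'| <= (2 * c) * `|F x - F x'|.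
  move=> xr x'r.
  have -> : x - x' = K x - K x' + (F x - F x') *m A.
    by rewrite /K mulmxBl; apply/rowP => i; rewrite !mxE; ring.
  apply: le_trans (ler_normD _ _) _.
  have l1 := lip _ _ xr x'r; have l2 := cA (F x - F x').
  have l3 : `|x - x'| <= `|K x - K x'| + `|(F x - F x') *m A|.
    have -> : x - x' = K x - K x' + (F x - F x') *m A.
      by rewrite /K mulmxBl; apply/rowP => i; rewrite !mxE; ring.
    exact: ler_normD.
  move: l1; rewrite -/(K x) -/(K x') => l1; lra.
pose h y := xget p [set x | `|x - p| < r0 /\ F x = y].
have hP y : ball (F p) r y -> `|h y - p| < r0 /\ F (h y) = y.
  by move=> /ex [x Hx]; rewrite /h; case: xgetP => [z -> //|/(_ x)].
have Fc x : U x -> {for x, continuous F} by move=> Ux; exact: (smooth_mx_continuous sF Ux).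
pose D := ball p r0 `&` F @^-1` ball (F p) r.
have bE x : ball p r0 x <-> `|x - p| < r0.
  by rewrite -ball_normE /ball_ /= distrC.
have BU x : ball p r0 x -> U x by move=> /bE/ltW/CU.
exists r, D, h; split; split.
- exact: rp.
- apply: open_preimage_in; [exact: ball_open| |exact: ball_open].
  by move=> x /BU/Fc.
- by split; exact: ballxx.
- by move=> x [/BU].
- move=> x [/bE xr Bx]; split => //.
  have [hr Fh] := hP _ Bx.
  have := uniq _ _ (ltW hr) (ltW xr); rewrite Fh subrr normr0 mulr0.
  by rewrite normr_le0 subr_eq0 => /eqP.
- move=> y yr; have [hr Fh] := hP _ yr; split => //; split; first exact/bE.
  by rewrite /= Fh.
set B := ball (F p) r.
have oB : open B by exact: ball_open.
have hB y : B y -> ball p r0 (h y) by move=> /hP[? _]; exact/bE.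
have hLip y y' : B y -> B y' -> `|h y - h y'| <= (2 * c) * `|y - y'|.
  move=> By By'; have [h1 F1] := hP _ By; have [h2 F2] := hP _ By'.
  by have := uniq _ _ (ltW h1) (ltW h2); rewrite F1 F2.
have c20 : 0 < 2 * c by rewrite mulr_gt0.
have hc y : B y -> {for y, continuous h}.
  move=> By; apply/(@cvgrPdist_le _ _ _ (nbhs y) _) => e e0.
  have : \forall z \near y, B z /\ `|y - z| <= e / (2 * c).
    have n2 : \forall z \near y, `|y - z| <= e / (2 * c).
      apply/nbhs_ballP; exists (e / (2 * c)); first by rewrite /= divr_gt0.
      by move=> z; rewrite -ball_normE /ball_ /= => /ltW.
    have n1 : nbhs y B by exact: open_nbhs_nbhs.
    exact: filterI n1 n2.
  apply: (@filterS _ (nbhs y) _) => z [Bz yz]; apply: le_trans (hLip _ _ By Bz) _.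
  by rewrite -ler_pdivlMl // mulrC.
have hd y i a : B y -> is_derive y (delta_mx 0 i : E) (fun z => h z 0 a)
    (invmx (jac F (h y)) i a).
  move=> By; set x := h y.
  have [xr Fx] := hP _ By; have Ux : U x by apply: CU; exact: ltW.
  set J := jac F x; have uJx : J \in unitmx by apply: uC; exact: ltW.
  have key : (fun t : R => t^-1 *: (((fun z => h z 0 a) \o shift y) (t *: delta_mx 0 i) - h y 0 a))
      @ 0^' --> invmx J i a.
    apply/cvgrPdist_le => e e0.
    pose s := 1 + \sum_b `|invmx J b a|.
    have s0 : 0 < s by rewrite ltr_pwDl // sumr_ge0.
    (* [s] dominates column [a] of the inverse Jacobian and [2 * c] is the Lipschitz constant of
       [h]; their product is the factor lost between the linearisation error and the final bound
       [e]. *)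
    pose e' := e / (s * (2 * c)).
    have e'0 : 0 < e' by rewrite divr_gt0 // mulr_gt0.
    have evb b : \forall v \near (0 : E), `|F (x + v) 0 b - F x 0 b - (v *m J) 0 b| <= e' * `|v|.
      have dF k : \forall z \near x, derivable (fun z => F z 0 b) z (delta_mx 0 k).
        apply: (near_open oU Ux) => z Uz.
        exact: (smooth_derivable (smooth_entry sF 0 b) Uz).
      have cF k := smooth_continuous (smooth_pd k (smooth_entry sF 0 b)) Ux.
      have := C1_expand e'0 dF cF.
      have LE v : linpart (fun i => pd i (fun z => F z 0 b) x) v = (v *m J) 0 b.
        by rewrite mxE; apply: eq_bigr => k _; rewrite mxE.
      by apply: (@filterS _ (nbhs (0 : E)) _) => v; rewrite LE.
    have ev : \forall v \near (0 : E), forall b,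
        `|F (x + v) 0 b - F x 0 b - (v *m J) 0 b| <= e' * `|v|.
      exact: (filter_forall _ evb).
    have cont : (fun t : R => h (t *: (delta_mx 0 i : E) + y) - x) @ 0^' --> (0 : E).
      have -> : (0 : E) = h (0 *: delta_mx 0 i + y) - x by rewrite scale0r add0r subrr.
      apply: cvg_within_filter; apply: cvgB; last exact: cvg_cst.
      apply: (@continuous_comp _ _ _ (fun t : R => t *: delta_mx 0 i + y) h).
        apply: cvgD; last exact: cvg_cst.
        exact: scalel_continuous.
      by rewrite scale0r add0r; exact: hc.
    have nB : \forall t \near 0^', B (t *: (delta_mx 0 i : E) + y).
      have C1 : (fun t : R => t *: (delta_mx 0 i : E) + y) @ 0^' --> 0 *: (delta_mx 0 i : E) + y.
        have C0 : {for (0 : R), continuous (fun t : R => t *: (delta_mx 0 i : E))}.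
          exact: scalel_continuous.
        have C2 : {for (0 : R), continuous (fun t : R => t *: (delta_mx 0 i : E) + y)}.
          by apply: continuousD => //; exact: cst_continuous.
        exact: cvg_within_filter C2.
      rewrite scale0r add0r in C1.
      have nyB : nbhs y B by exact: open_nbhs_nbhs.
      exact: (C1 _ nyB).
    pose Q (v : E) := forall b, `|F (x + v) 0 b - F x 0 b - (v *m J) 0 b| <= e' * `|v|.
    have nQ : \forall t \near 0^', Q (h (t *: (delta_mx 0 i : E) + y) - x).
      exact: (cont Q ev).
    near=> t.
    have t0 : t != 0 by near: t; exact: nbhs_dnbhs_neq.
    have Bt : B (t *: (delta_mx 0 i : E) + y) by near: t.
    set k := h (t *: delta_mx 0 i + y) - x.
    have kE : Q k by rewrite /k; near: t; exact: nQ.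
    have kn : `|k| <= 2 * c * `|t|.
      have := hLip _ _ Bt By; rewrite addrK normrZ => l.
      apply: le_trans l _; rewrite ler_wpM2l // ?(ltW c20) // ler_piMr //; exact: norm_delta.
    have xk : F (x + k) = t *: delta_mx 0 i + y.
      by rewrite /k [x + _]addrC subrK; have [] := hP _ Bt.
    (* Since [F (x + k) - F x] is exactly [t e_i], this is the linearisation error of [F] at [x]. *)
    pose rem := t *: delta_mx 0 i - k *m J.
    have rb b : `|rem 0 b| <= e' * `|k|.
      by have := kE b; rewrite xk Fx !mxE; rewrite addrK.
    have E1 : invmx J i a - t^-1 * k 0 a = t^-1 * (rem *m invmx J) 0 a.
      have -> : (rem *m invmx J) 0 a = t * invmx J i a - k 0 a.
        rewrite mulmxBl mulmxK // -scalemxAl -rowE.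
        by rewrite [LHS]mxE [X in X + _]mxE [X in _ + X]mxE [X in _ * X]mxE.
      by rewrite mulrBr mulKf.
    rewrite [X in `|_ - X|](_ : _ = t^-1 * k 0 a); last by rewrite /k !mxE.
    rewrite E1 normrM normfV -ler_pdivlMl ?invr_gt0 ?normr_gt0 // invrK.
    rewrite mxE; apply: le_trans (ler_norm_sum _ _ _) _.
    apply: (@le_trans _ _ (\sum_b (e' * `|k|) * `|invmx J b a|)).
      by apply: ler_sum => b _; rewrite normrM ler_wpM2r.
    rewrite -mulr_sumr.
    apply: (@le_trans _ _ (e' * (2 * c * `|t|) * s)).
      apply: ler_pM => //.
      - by rewrite mulr_ge0 // ltW.
      - by rewrite sumr_ge0.
      - by rewrite ler_wpM2l // ltW.
      - by rewrite /s lerDr.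
    rewrite /e' le_eqVlt; apply/orP; left; apply/eqP; field.
    by rewrite (gt_eqF s0) (gt_eqF c0).
  split; first by apply/cvg_ex; exists (invmx J i a).
  exact: cvg_lim key.
have oB0 : open (ball p r0) by exact: ball_open.
have sFB : smooth_mx (ball p r0) F by apply: (smooth_mxS _ sF); exact: BU.
have sJ : smooth_mx (ball p r0) (fun x => invmx (jac F x)).
  apply: (smooth_mxV oB0); first by move=> x /bE/ltW/uC.
  by apply: smooth_mx_matrix => i j; exact: (smooth_pd i (smooth_entry sFB 0 j)).
apply/smooth_mxP => i0 a; rewrite (ord1 i0).
(* Composites [f \o h] form a stable class: the derivative is again a composite, of
   [sum_l (J^-1)_il d_l f] with [h]. The components of [h] belong to it, with a coordinate as
   [f]. *)
apply: (@smooth_coind _ _ B (fun g => exists2 f, smooth (ball p r0) f & g = f \o h) oB).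
- move=> _ [f sf ->] y By.
  have [df Ef] := smooth_diff oB0 sf (hB _ By).
  split.
    exact: (continuous_comp (hc _ By) (smooth_continuous sf (hB _ By))).
  move=> i.
  have dh l : derivable (fun z => h z 0 l) y (delta_mx 0 i) by have [] := hd y i l By.
  by have [] := is_pd_comp dh df Ef.
- move=> _ i [f sf ->].
  exists ((fun x => \sum_l invmx (jac F x) i l * pd l f x) \o h).
    exists (fun x => \sum_l invmx (jac F x) i l * pd l f x); last by [].
    apply: (@smooth_sum _ _ _ _ _ xpredT (fun l x => invmx (jac F x) i l * pd l f x) oB0) => l _.
    exact: (smoothM oB0 (smooth_entry sJ i l) (smooth_pd l sf)).
  move=> y By; have [df Ef] := smooth_diff oB0 sf (hB _ By).
  have dh l : derivable (fun z => h z 0 l) y (delta_mx 0 i) by have [] := hd y i l By.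
  have [_ H] := is_pd_comp dh df Ef.
  apply: etrans H _; apply: eq_bigr => l _; congr (_ * _).
  by have [_ H] := hd y i l By.
- by exists (fun x => x 0 a) => //; exact: smooth_coord.
Unshelve. all: by end_near. Qed.

End InverseFunction.

(** * Primitives on a cube and the Poincare lemma *)

Section Antiderivative.
Context {R : realType}.
Notation mu := (@lebesgue_measure R).

Lemma derive1_is_derive (F : R -> R) s d : derivable F s 1 -> derive1 F s = d -> is_derive s 1 F d.
Proof. by rewrite derive1E => dF <-; exact: DeriveDef. Qed.

(** The difference of the integrals over []c, s]] and []s, c]] covers both sides of [c] with one
    formula. For each [s] a base point [a] to the left of both [c] and [s] rewrites it as an
    integral from [a], up to a constant, to which the fundamental theorem applies. *)
Lemma antiderivative_ex (g : R -> R) (c r : R) :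
  (forall s, `|s - c| < r -> {for s, continuous g}) ->
  exists G : R -> R, G c = 0 /\ (forall s, `|s - c| < r -> is_derive s 1 G (g s)).
Proof.
move=> cg.
pose G s := (\int[mu]_(t in `]c, s]) g t - \int[mu]_(t in `]s, c]) g t)%R.
have int a b : c - r < a -> b < c + r -> mu.-integrable `[a, b] (EFin \o g).
  move=> ca cb; apply: continuous_compact_integrable; first exact: segment_compact.
  apply: continuous_in_subspaceT => t /[!inE]/= /[!in_itv]/= /andP[at' tb].
  by apply: cg; rewrite ltr_norml; apply/andP; split; lra.
have GE a s : c - r < a -> a < c -> a < s -> s < c + r ->
    G s = (\int[mu]_(t in `[a, s]) g t - \int[mu]_(t in `[a, c]) g t)%R.
  move=> ra ac as_ sr; rewrite /G; case: (leP c s) => [cs|sc].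
    rewrite [X in _ - X](_ : _ = 0) ?subr0; last first.
      by rewrite set_itv_ge ?Rintegral_set0 // bnd_simp -leNgt.
    rewrite Rintegral_itvB ?bnd_simp //; last exact: ltW.
    exact: int.
  rewrite [X in X - _](_ : _ = 0) ?sub0r; last first.
    by rewrite set_itv_ge ?Rintegral_set0 // bnd_simp -leNgt ltW.
  rewrite -[RHS]opprB Rintegral_itvB ?bnd_simp //; [|exact: ltW|exact: ltW].
  apply: int => //; lra.
exists G; split; first by rewrite /G subrr.
move=> s sr; have := sr; rewrite ltr_norml => /andP[s1 s2].
pose a := ((c - r) + Num.min c s) / 2.
pose u := ((c + r) + s) / 2.
have r0 : 0 < r by apply: le_lt_trans sr.
have [a1 a2 a3] : [/\ c - r < a, a < c & a < s].
  rewrite /a; case: (leP c s) => cs; split; lra.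
have [u1 u2] : s < u /\ u < c + r by rewrite /u; split; lra.
pose F (x : R) := (\int[mu]_(t in `[a, x]) g t)%R.
have [d1 d2] : derivable F s 1 /\ derive1 F s = g s.
  exact: (@continuous_FTC1_closed R g a s u u1 (int _ _ a1 u2) a3 (cg _ sr)).
have dF : is_derive s 1 (fun x => F x - F c) (g s).
  have D := derive1_is_derive d1 d2.
  rewrite -[g s]subr0.
  have C : is_derive s 1 (fun _ : R => F c) 0 by exact: is_derive_cst.
  exact: (is_deriveB D C).
apply: near_eq_is_derive dF.
have sau : s \in `]a, u[%R by rewrite in_itv /= a3.
apply: filterS (near_in_itvoo sau) => x; rewrite in_itv /= => /andP[ax xu].
by rewrite (GE a) //; lra.
Qed.

(** A chosen primitive that vanishes at [c]; the zero function is only the default when there is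
    none. *)
Definition antider (c r : R) (g : R -> R) : R -> R :=
  xget (fun=> 0) [set G : R -> R | G c = 0 /\ forall s, `|s - c| < r -> is_derive s 1 G (g s)].

Lemma antiderP (c r : R) (g : R -> R) :
  (forall s, `|s - c| < r -> {for s, continuous g}) ->
  antider c r g c = 0 /\ (forall s, `|s - c| < r -> is_derive s 1 (antider c r g) (g s)).
Proof.
by move=> /antiderivative_ex [G HG]; rewrite /antider; case: xgetP => [G' _ //|/(_ G)].
Qed.

(** Parametrised so that [a] and [b] may come in either order. *)
Definition between (a b s : R) := exists2 t : R, 0 <= t <= 1 & s = a + t * (b - a).

Lemma between_norm a b s : between a b s -> `|s - a| <= `|b - a|.
Proof.
move=> [t /andP[t0 t1] ->]; rewrite addrC addKr normrM ger0_norm //.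
by rewrite ler_piMl.
Qed.

Lemma mean_value (P dP : R -> R) a b :
  (forall s, between a b s -> is_derive s 1 P (dP s)) ->
  exists2 s, between a b s & P b - P a = (b - a) * dP s.
Proof.
move=> dP'.
have D (t : R) : 0 <= t <= 1 -> is_derive (a + (t * (b - a)) *: 1) 1 P (dP (a + (t * (b - a)) *: 1)).
  by move=> t01; apply: dP'; exists t; rewrite // [_ *: _]mulr1.
have D' (t : R) : 0 <= t <= 1 -> derivable P (a + (t * (b - a)) *: 1) 1.
  by move=> /D [].
have [t t01] := mvt_line D'.
rewrite [(b - a) *: _]mulr1 [a + _]addrC subrK => ->.
exists (a + t * (b - a)); first by exists t.
by have [_ ->] := D _ t01; rewrite [_ *: _]mulr1.
Qed.

End Antiderivative.

Section ParameterIntegral.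
Context {R : realType} {n : nat}.
Local Notation E := 'rV[R]_n.+1.
Variables (c : E) (r : R).
Local Notation Q := (ball c r).
Implicit Types (f g : E -> R) (x y : E) (i j k : 'I_n.+1).

Definition upd k x (s : R) : E := x + (s - x 0 k) *: delta_mx 0 k.

Lemma updE k x s j : upd k x s 0 j = if j == k then s else x 0 j.
Proof.
rewrite !mxE eqxx /=; case: eqP => [->|_]; last by rewrite mulr0 addr0.
by rewrite mulr1 addrC subrK.
Qed.

Lemma upd_id k x : upd k x (x 0 k) = x.
Proof. by rewrite /upd subrr scale0r addr0. Qed.

Lemma upd_add k j x s h : j != k -> upd k (x + h *: delta_mx 0 j) s = upd k x s + h *: delta_mx 0 j.
Proof.
move=> jk; apply/rowP => l; rewrite updE [RHS]mxE updE !mxE eqxx /=.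
case: eqP => [->|//]; by rewrite eq_sym (negPf jk) mulr0 addr0.
Qed.

(** The norm is the sup norm, so balls are cubes and stay stable when one coordinate is moved within
    its range. This is what lets primitives be taken one axis at a time. *)
Lemma QP x : Q x <-> 0 < r /\ forall j, `|x 0 j - c 0 j| < r.
Proof.
rewrite -ball_normE /ball_ /=; split => [xr|[r0 H]].
  split; first exact: le_lt_trans xr.
  move=> j; apply: le_lt_trans xr; rewrite distrC.
  by have := norm_rV_coord (c - x) j; rewrite !mxE.
apply: norm_rV_lt => // j; rewrite !mxE distrC; exact: H.
Qed.

Lemma Q_upd k x s : Q x -> `|s - c 0 k| < r -> Q (upd k x s).
Proof.
move=> /QP[r0 H] sr; apply/QP; split => // j; rewrite updE; case: eqP => [->|] //.
Qed.

Lemma Q_coord x k : Q x -> `|x 0 k - c 0 k| < r.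
Proof. by move=> /QP[]. Qed.

Lemma between_Q x k s : Q x -> between (c 0 k) (x 0 k) s -> `|s - c 0 k| < r.
Proof. by move=> Qx /between_norm H; apply: le_lt_trans H (Q_coord k Qx). Qed.

Lemma oQ : open (Q : set E).
Proof. exact: ball_open. Qed.

Lemma near_norm (x : E) (P : E -> Prop) : nbhs x P -> exists2 d : R, 0 < d & forall y, `|y - x| < d -> P y.
Proof.
move=> /nbhs_ballP [d /= d0 H]; exists d => // y yx; apply: H.
by rewrite -ball_normE /ball_ /= distrC.
Qed.

Lemma norm_near (x : E) (d : R) : 0 < d -> \forall y \near x, `|y - x| < d.
Proof.
move=> d0; apply/nbhs_ballP; exists d => // y.
by rewrite -ball_normE /ball_ /= distrC.
Qed.

Lemma upd_close k x y s t d : 0 < d -> `|y - x| < d -> `|s - t| < d -> `|upd k y s - upd k x t| < d.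
Proof.
move=> d0 yx st; apply: norm_rV_lt => // j.
have -> : (upd k y s - upd k x t) 0 j = upd k y s 0 j - upd k x t 0 j by rewrite mxE [X in _ + X]mxE.
rewrite !updE; case: eqP => // _.
by apply: le_lt_trans yx; have := norm_rV_coord (y - x) j; rewrite !mxE.
Qed.

(** Compactness of the segment from [c 0 k] to [x 0 k] makes the continuity estimate uniform in
    [s]. *)
Lemma tube f k x (e : R) : (forall y, Q y -> {for y, continuous f}) -> Q x -> 0 < e ->
  \forall y \near x, forall s, between (c 0 k) (x 0 k) s -> `|f (upd k y s) - f (upd k x s)| <= e.
Proof.
move=> cf Qx e0.
pose K := [set s | between (c 0 k) (x 0 k) s].
have cK : compact K.
  have -> : K = (fun t : R => c 0 k + t * (x 0 k - c 0 k)) @` `[0, 1].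
    apply/seteqP; split => s /=.
      by move=> [t t01 ->]; exists t => //; rewrite in_itv.
    by move=> [t]; rewrite in_itv /= => t01 <-; exists t.
  apply: continuous_compact; last exact: segment_compact.
  apply: continuous_subspaceT => t.
  apply: cvgD; first exact: cvg_cst.
  by apply: cvgMl; exact: cvg_id.
have e20 : 0 < e / 2 by rewrite divr_gt0.
suff H s : K s -> \forall t \near s & y \near x, `|f (upd k y t) - f (upd k x t)| <= e.
  exact: ((compact_near_coveringP K).1 cK E (nbhs x)
    (fun y s => `|f (upd k y s) - f (upd k x s)| <= e) _ H).
move=> Ks.
have Qu : Q (upd k x s) by apply: Q_upd => //; exact: between_Q Ks.
have /near_norm [d d0 H] : nbhs (upd k x s) (fun z => `|f (upd k x s) - f z| <= e / 2).
  by move/cvgrPdist_le : (cf _ Qu) => /(_ _ e20).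
exists ([set t | `|t - s| < d], [set y | `|y - x| < d]).
  split; last exact: norm_near.
  by apply/nbhs_ballP; exists d => // t; rewrite /ball /= distrC.
move=> [t y] [/= ts yx].
have H1 := H _ (upd_close k d0 yx ts).
have xx : `|x - x| < d by rewrite subrr normr0.
have H2 := H _ (upd_close k d0 xx ts).
rewrite -[_ - _](subrKA (f (upd k x s))).
apply: le_trans (ler_normD _ _) _.
by rewrite [leRHS]splitr; apply: lerD => //; rewrite distrC.
Qed.

(** The integral of [f] along axis [k], from the hyperplane through the centre [c] up to [x], the
    other coordinates being parameters. *)
Definition intk k f x : R := antider (c 0 k) r (fun s => f (upd k x s)) (x 0 k).

Lemma upd_continuous f k x s : (forall y, Q y -> {for y, continuous f}) -> Q x ->
  `|s - c 0 k| < r -> {for s, continuous (fun s => f (upd k x s))}.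
Proof.
move=> cf Qx sr; apply: (@continuous_comp _ _ _ (upd k x) f); last exact/cf/Q_upd.
move=> P /near_norm [d d0 H].
apply/nbhs_ballP; exists d => // t; rewrite /ball /= distrC => ts.
by apply: H; apply: upd_close => //; rewrite subrr normr0.
Qed.

Lemma antider_upd f k x : (forall y, Q y -> {for y, continuous f}) -> Q x ->
  let G := antider (c 0 k) r (fun s => f (upd k x s)) in
  G (c 0 k) = 0 /\ (forall s, `|s - c 0 k| < r -> is_derive s 1 G (f (upd k x s))).
Proof. by move=> cf Qx G; apply: antiderP => s sr; exact: upd_continuous. Qed.

(** The change from [x] to [y] is split in two, each half costing [e / 2]: first the integrand
    changes with the upper limit kept, controlled by [tube]; then the upper limit moves, with [f]
    bounded by [m] along the way. *)
Lemma intk_continuous f k x : (forall y, Q y -> {for y, continuous f}) -> Q x ->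
  {for x, continuous (intk k f)}.
Proof.
move=> cf Qx; apply/(@cvgrPdist_le _ _ _ (nbhs x) _) => e e0.
have Qx' := Qx; move/QP : Qx' => [r0 _].
pose l := `|x 0 k - c 0 k|; pose m := `|f x| + 1.
have m0 : 0 < m by rewrite ltr_wpDl.
have rr : 0 < r + r by rewrite addr_gt0.
have e10 : 0 < e / (r + r) by rewrite divr_gt0.
have /near_norm [d1 d10 H1] := tube k cf Qx e10.
have /near_norm [d2 d20 H2] : nbhs x (fun y => `|f x - f y| <= 1).
  by move/cvgrPdist_le : (cf _ Qx) => /(_ _ ltr01).
have /near_norm [d3 d30 H3] : nbhs x (Q : set E) by exact: open_nbhs_nbhs (conj oQ Qx).
pose d := Num.min d1 (Num.min d2 (Num.min d3 (e / (m + m)))).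
have d0 : 0 < d by rewrite !lt_min d10 d20 d30 divr_gt0 // addr_gt0.
apply: (@filterS _ (nbhs x) _) (norm_near x d0) => y.
rewrite !lt_min => /and4P[y1 y2 y3 y4].
have Qy := H3 _ y3.
have [Gx0 dGx] := antider_upd k cf Qx; have [Gy0 dGy] := antider_upd k cf Qy.
rewrite /intk; set Gx := antider _ _ _ in Gx0 dGx *.
set Gy := antider _ _ _ in Gy0 dGy *.
have yk : `|y 0 k - x 0 k| <= `|y - x| by have := norm_rV_coord (y - x) k; rewrite !mxE.
have A1 : `|Gy (x 0 k) - Gx (x 0 k)| <= e / 2.
  have [s bs|s bs] := @mean_value _ (fun s => Gy s - Gx s)
      (fun s => f (upd k y s) - f (upd k x s)) (c 0 k) (x 0 k).
    have sr := between_Q Qx bs.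
    exact: is_deriveB (dGy _ sr) (dGx _ sr).
  rewrite Gx0 Gy0 subrr subr0 => ->; rewrite normrM.
  apply: (@le_trans _ _ (r * (e / (r + r)))).
    apply: ler_pM => //; first exact: ltW (Q_coord k Qx).
    exact: H1.
  rewrite le_eqVlt; apply/orP; left; apply/eqP; field.
  by rewrite gt_eqF //; lra.
have A2 : `|Gy (y 0 k) - Gy (x 0 k)| <= e / 2.
  have [s bs|s bs ->] := @mean_value _ Gy (fun s => f (upd k y s)) (x 0 k) (y 0 k).
    apply: dGy; have [t /andP[t0 t1] ->] := bs.
    have -> : x 0 k + t * (y 0 k - x 0 k) - c 0 k = (1 - t) * (x 0 k - c 0 k) + t * (y 0 k - c 0 k).
      by ring.
    have hx := Q_coord k Qx; have hy := Q_coord k Qy.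
    apply: le_lt_trans (ler_normD _ _) _; rewrite !normrM (ger0_norm t0) ger0_norm ?subr_ge0 //.
    have t1' : 0 <= 1 - t by rewrite subr_ge0.
    move: hx hy; move: `|x 0 k - c 0 k| `|y 0 k - c 0 k| => p q hp hq.
    have [t0'|t0'] := eqVneq t 0; first by rewrite t0' mul0r addr0 subr0 mul1r.
    have tp : 0 < t by rewrite lt_def t0'.
    nra.
  have us : `|upd k y s - x| < d2.
    rewrite -{1}(upd_id k x); apply: upd_close => //.
    exact: le_lt_trans (between_norm bs) (le_lt_trans yk y2).
  have fs : `|f (upd k y s)| <= m.
    have := H2 _ us; rewrite distrC => h.
    rewrite -[f (upd k y s)](subrK (f x)) addrC; apply: le_trans (ler_normD _ _) _.
    by rewrite lerD2l.
  rewrite normrM; apply: (@le_trans _ _ (e / (m + m) * m)).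
    apply: ler_pM => //; exact: ltW (le_lt_trans yk y4).
  rewrite le_eqVlt; apply/orP; left; apply/eqP; field.
  by rewrite gt_eqF //; lra.
rewrite distrC -(subrKA (Gy (x 0 k))).
apply: le_trans (ler_normD _ _) _.
by rewrite [leRHS]splitr; apply: lerD.
Qed.

Lemma upd_line k x h : upd k (x + h *: delta_mx 0 k) = upd k x.
Proof.
apply/funext => s; apply/rowP => j; rewrite !updE; case: eqP => // /eqP jk.
by rewrite !mxE eqxx /= (negPf jk) mulr0 addr0.
Qed.

Lemma intk_pd_same f k x : (forall y, Q y -> {for y, continuous f}) -> Q x ->
  is_derive x (delta_mx 0 k : E) (intk k f) (f x).
Proof.
move=> cf Qx; have [_ dG] := antider_upd k cf Qx.
have := dG _ (Q_coord k Qx); rewrite upd_id.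
set G := antider _ _ _ => D.
suff E0 : (fun h : R => h^-1 *: ((intk k f \o shift x) (h *: delta_mx 0 k) - intk k f x)) =
   (fun h : R => h^-1 *: ((G \o shift (x 0 k)) (h *: 1) - G (x 0 k))).
  by case: D; rewrite /derivable /derive -E0; split.
apply/funext => h /=; congr (_ *: (_ - _)).
rewrite /intk [h *: delta_mx 0 k + x]addrC upd_line -/G; congr (G _).
by rewrite !mxE !eqxx /= addrC.
Qed.

(** Differentiation under the integral sign by mean values only. The function [h^-1 * (Gy - Gx) - P]
    vanishes at [c 0 k], because the three primitives do; its derivative is a difference quotient of
    [f] minus [pd j f], which a second mean value and [tube] make small. *)
Lemma intk_pd_other f k j x : smooth Q f -> Q x -> j != k ->
  is_derive x (delta_mx 0 j : E) (intk k f) (intk k (pd j f) x).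
Proof.
move=> sf Qx jk.
have cf y : Q y -> {for y, continuous f} by move=> Qy; exact: (smooth_continuous sf Qy).
have cdf y : Q y -> {for y, continuous (pd j f)}.
  by move=> Qy; exact: (smooth_continuous (smooth_pd j sf) Qy).
have [Gx0 dGx] := antider_upd k cf Qx; have [P0 dP] := antider_upd k cdf Qx.
set Gx := antider _ _ _ in Gx0 dGx; set P := antider _ _ _ in P0 dP.
have Qx' := Qx; move/QP : Qx' => [r0 _].
have key : (fun h : R => h^-1 *: ((intk k f \o shift x) (h *: delta_mx 0 j) - intk k f x))
    @ 0^' --> intk k (pd j f) x.
  apply/cvgrPdist_le => e e0.
  have e10 : 0 < e / r by rewrite divr_gt0.
  have /near_norm [d1 d10 H1] := tube k cdf Qx e10.
  have /near_norm [d3 d30 H3] : nbhs x (Q : set E) by exact: open_nbhs_nbhs (conj oQ Qx).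
  near=> h.
  have h0 : h != 0 by near: h; exact: nbhs_dnbhs_neq.
  have hd : `|h| < Num.min d1 d3 by near: h; apply: dnbhs0_lt; rewrite lt_min d10.
  have close (t : R) : 0 <= t <= 1 -> `|(x + (t * h) *: delta_mx 0 j) - x| < Num.min d1 d3.
    move=> /andP[t0 t1]; rewrite [x + _]addrC addrK normrZ.
    apply: le_lt_trans hd; rewrite -[leRHS]mulr1; apply: ler_pM => //; last exact: norm_delta.
    by rewrite normrM ger0_norm // ler_piMl.
  have Qy (t : R) : 0 <= t <= 1 -> Q (x + (t * h) *: delta_mx 0 j).
    by move=> /close; rewrite lt_min => /andP[_ /H3].
  have Qxh : Q (x + h *: delta_mx 0 j) by have := Qy 1; rewrite mul1r; apply; rewrite lexx ler01.
  have [Gy0 dGy] := antider_upd k cf Qxh.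
  set Gy := antider _ _ _ in Gy0 dGy.
  have E1 : (intk k f \o shift x) (h *: delta_mx 0 j) = Gy (x 0 k).
    rewrite /= [_ + x]addrC /intk -/Gy; congr (Gy _).
    by rewrite !mxE eqxx /= eq_sym (negPf jk) mulr0 addr0.
  rewrite E1 -[intk k f x]/(Gx (x 0 k)) -[intk k (pd j f) x]/(P (x 0 k)) distrC.
  have [s bs|s bs] := @mean_value _ (fun s => h^-1 * (Gy s - Gx s) - P s)
      (fun s => h^-1 * (f (upd k (x + h *: delta_mx 0 j) s) - f (upd k x s)) - pd j f (upd k x s))
      (c 0 k) (x 0 k).
    have sr := between_Q Qx bs.
    have D1 := is_deriveB (dGy _ sr) (dGx _ sr).
    have D2 := is_deriveZ h^-1 D1.
    exact: (is_deriveB D2 (dP _ sr)).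
  rewrite Gx0 Gy0 P0 !subrr mulr0 subr0 subr0 => ->.
  have sr := between_Q Qx bs.
  have [t t01|t t01] := @mvt_line _ E f (upd k x s) (delta_mx 0 j) h.
    rewrite -upd_add //; apply: (smooth_derivable sf); apply: Q_upd => //; exact: Qy.
  rewrite -upd_add // => ->; rewrite mulKf // normrM.
  have -> : e = r * (e / r) by rewrite mulrC divfK // gt_eqF.
  apply: ler_pM => //; first exact: ltW (Q_coord k Qx).
  rewrite -upd_add //; apply: H1 => //.
  by have := close _ t01; rewrite lt_min => /andP[].
by split; [apply/cvg_ex; exists (intk k (pd j f) x) | exact: cvg_lim key].
Unshelve. all: by end_near. Qed.

(** Coinduction on the class of smooth functions and of all [intk k g] with [g] smooth:
    differentiating along [k] gives back [g], along another axis it passes under the integral. *)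
Lemma intk_smooth f k : smooth Q f -> smooth Q (intk k f).
Proof.
move=> sf; apply: (@smooth_coind _ _ Q (fun h => smooth Q h \/ exists2 g, smooth Q g & h = intk k g) oQ).
- move=> h [sh x Qx|[g sg ->] x Qx].
    by split; [exact: (smooth_continuous sh Qx)|move=> i; exact: (smooth_derivable sh Qx)].
  have cg y : Q y -> {for y, continuous g} by move=> Qy; exact: (smooth_continuous sg Qy).
  split; first exact: intk_continuous.
  move=> i; have [->|ik] := eqVneq i k; first by have [] := intk_pd_same k cg Qx.
  by have [] := intk_pd_other sg Qx ik.
- move=> h i [sh|[g sg ->]].
    by exists (pd i h) => //; left; exact: smooth_pd.
  have cg y : Q y -> {for y, continuous g} by move=> Qy; exact: (smooth_continuous sg Qy).
  have [->|ik] := eqVneq i k.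
    exists g; first by left.
    by move=> x Qx; have [] := intk_pd_same k cg Qx.
  exists (intk k (pd i g)); first by right; exists (pd i g); [exact: (smooth_pd i sg)|].
  by move=> x Qx; have [] := intk_pd_other sg Qx ik.
- by right; exists f.
Qed.

Lemma intk0 f k x : (forall y, Q y -> f y = 0) -> Q x -> intk k f x = 0.
Proof.
move=> f0 Qx.
have cf y : Q y -> {for y, continuous f}.
  move=> Qy; have nf : \forall z \near y, cst 0 z = f z.
    by apply: (near_open oQ Qy) => z /f0 ->.
  change (f @ y --> f y); rewrite f0 //.
  exact: cvg_trans (near_eq_cvg nf) (@cst_continuous _ _ (0 : R) y).
have [G0 dG] := antider_upd k cf Qx.
have [s bs] := @mean_value _ _ _ (c 0 k) (x 0 k) (fun s bs => dG s (between_Q Qx bs)).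
have Qu : Q (upd k x s) := Q_upd Qx (between_Q Qx bs).
by rewrite G0 subr0 f0 ?mulr0.
Qed.

Lemma pd_intk_same f k x : smooth Q f -> Q x -> pd k (intk k f) x = f x.
Proof.
move=> sf Qx; have cf y : Q y -> {for y, continuous f} by move=> Qy; exact: (smooth_continuous sf Qy).
by have [] := intk_pd_same k cf Qx.
Qed.

Lemma pd_intk_other f k j x : smooth Q f -> Q x -> j != k -> pd j (intk k f) x = intk k (pd j f) x.
Proof. by move=> sf Qx jk; have [] := intk_pd_other sf Qx jk. Qed.

(** Induction on the number [m] of correct partial derivatives. The defect [b] of the next one has
    vanishing derivatives along the axes already treated, by closedness, so adding its primitive
    along axis [k] leaves those partial derivatives unchanged. *)
Lemma poincare (a : E -> E) : smooth_mx Q a ->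
  (forall x, Q x -> forall i j, ext_d a x i j = 0) ->
  exists2 f, smooth Q f & forall x, Q x -> forall i, pd i f x = a x 0 i.
Proof.
move=> sa da.
suff H m : (m <= n.+1)%N -> exists2 f, smooth Q f &
    forall x, Q x -> forall i : 'I_n.+1, (i < m)%N -> pd i f x = a x 0 i.
  by have [f sf Hf] := H _ (leqnn _); exists f => // x Qx i; exact: Hf.
elim: m => [_|m IH mn].
  by exists (fun=> 0) => //; exact: (smooth_cst _ oQ).
have [f sf Hf] := IH (ltnW mn).
pose k := Ordinal mn.
pose b x := a x 0 k - pd k f x.
have sb : smooth Q b := smoothB oQ (smooth_entry sa 0 k) (smooth_pd k sf).
exists (fun x => f x + intk k b x); first exact: (smoothD oQ sf (intk_smooth k sb)).
move=> x Qx i im.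
rewrite (pdD (smooth_derivable sf Qx) (smooth_derivable (intk_smooth k sb) Qx)).
have [->|ik] := eqVneq i k.
  by rewrite pd_intk_same // /b addrC subrK.
have im' : (i < m)%N.
  rewrite ltnS leq_eqVlt in im; case/orP: im => // /eqP e.
  by case/eqP: ik; apply: val_inj.
rewrite (Hf _ Qx _ im') pd_intk_other // intk0 ?addr0 // => y Qy.
rewrite /b (pdB (smooth_derivable (smooth_entry sa 0 k) Qy) (smooth_derivable (smooth_pd k sf) Qy)).
rewrite (smooth_schwarz k i oQ sf Qy) (pd_eq k oQ Qy (fun y Qy => Hf y Qy i im')).
exact: da.
Qed.

Lemma indep_depends (s : seq 'I_n.+1) f : smooth Q f ->
  (forall i, i \notin s -> forall x, Q x -> pd i f x = 0) ->
  forall x y, Q x -> Q y -> (forall i, i \in s -> x 0 i = y 0 i) -> f x = f y.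
Proof.
move=> sf f0 x y Qx Qy xy.
have Qt (t : R) : 0 <= t <= 1 -> Q (x + (t * 1) *: (y - x)).
  move=> /andP[t0 t1]; have [r0 _] := (QP x).1 Qx; apply/QP; split => // j.
  have hx := Q_coord j Qx; have hy := Q_coord j Qy.
  have -> : (x + (t * 1) *: (y - x)) 0 j - c 0 j = (1 - t) * (x 0 j - c 0 j) + t * (y 0 j - c 0 j).
    by rewrite !mxE; ring.
  apply: le_lt_trans (ler_normD _ _) _; rewrite !normrM (ger0_norm t0) ger0_norm ?subr_ge0 //.
  move: hx hy; move: `|x 0 j - c 0 j| `|y 0 j - c 0 j| => p q hp hq.
  have [t0'|t0'] := eqVneq t 0; first by rewrite t0' mul0r addr0 subr0 mul1r.
  have tp : 0 < t by rewrite lt_def t0'.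
  nra.
have df (t : R) : 0 <= t <= 1 -> derivable f (x + (t * 1) *: (y - x)) (y - x).
  by move=> /Qt Q'; exact: diff_derivable (smooth_diff oQ sf Q').1.
have [t t01] := mvt_line df.
rewrite scale1r [x + _]addrC subrK mul1r (smooth_diff oQ sf (Qt _ t01)).2.
rewrite big1; first by move/eqP; rewrite subr_eq0 => /eqP ->.
move=> i _.
have [/xy e|/f0 H] := boolP (i \in s); first by rewrite !mxE e subrr mul0r.
by rewrite H ?mulr0 //; exact: Qt.
Qed.

End ParameterIntegral.

(** * The Levi-Civita connection in a frame *)

Section LeviCivita.
Context {R : realType} {n : nat}.
Local Notation E := 'rV[R]_n.+1.
Local Notation M := 'M[R]_n.+1.
Implicit Types (g : E -> M) (x : E) (U : set E).

(** Row [j] lists the components of the covariant derivative of the j-th coordinate field along the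
    i-th; in row-vector form the derivative of [Y] is [pdmx i Y x + Y x *m chr g x i]. *)
Definition chr g x (i : 'I_n.+1) : M := \matrix_(j, k) christoffel g x i j k.

(** Koszul's argument: with [L i = C i *m g x], compatibility reads [d_a g_bc = L_abc + L_acb], and
    by the symmetry of [C] the combination that defines [christoffel] collapses to [2 L]. *)
Lemma christoffel_unique g x (C : 'I_n.+1 -> M) :
  (g x)^T = g x -> g x \in unitmx ->
  (forall i j k, C i j k = C j i k) ->
  (forall i, C i *m g x + (C i *m g x)^T = pdmx i g x) ->
  forall i, chr g x i = C i.
Proof.
move=> gT gu Cs Cg i; apply/matrixP => j k; rewrite mxE /christoffel.
pose L i := C i *m g x.
have Ls a b c : L a b c = L b a c.
  by rewrite /L !mxE; apply: eq_bigr => l _; rewrite Cs.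
have pL a b c : pd a (fun y => g y b c) x = L a b c + L a c b.
  by rewrite -pdmxE -Cg !mxE.
have giT : (invmx (g x))^T = invmx (g x) by rewrite trmx_inv gT.
have -> : C i j k = \sum_l invmx (g x) k l * L i j l.
  rewrite -[C i](mulmxK gu) mxE; apply: eq_bigr => l _.
  by rewrite -/(L i) mulrC -{1}giT mxE.
rewrite mulr_sumr; apply: eq_bigr => l _.
rewrite !pL (Ls j i l) (Ls l i j) (Ls l j i).
by field.
Qed.

Lemma chr_sym g x i j k : (forall a b c, pd a (fun y => g y b c) x = pd a (fun y => g y c b) x) ->
  chr g x i j k = chr g x j i k.
Proof.
move=> gs; rewrite !mxE; congr (_ * _); apply: eq_bigr => l _; congr (_ * _).
by rewrite (gs l i j) [X in X - _]addrC.
Qed.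

Lemma chr_lower g x i j l : (g x)^T = g x -> g x \in unitmx ->
  (chr g x i *m g x) j l =
  2^-1 * (pd i (fun y => g y j l) x + pd j (fun y => g y i l) x - pd l (fun y => g y i j) x).
Proof.
move=> gT gu.
have giS a b : invmx (g x) a b = invmx (g x) b a.
  have /matrixP/(_ b a) : (invmx (g x))^T = invmx (g x) by rewrite trmx_inv gT.
  by rewrite mxE.
pose p : E := \row_b (pd i (fun y => g y j b) x + pd j (fun y => g y i b) x
   - pd b (fun y => g y i j) x).
have -> : (chr g x i *m g x) j l = (row j (chr g x i) *m g x) 0 l by rewrite -row_mul [RHS]mxE.
have -> : row j (chr g x i) = 2^-1 *: (p *m invmx (g x)).
  apply/rowP => k; rewrite 2!mxE [RHS]mxE; congr (_ * _); rewrite mxE.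
  by apply: eq_bigr => m _; rewrite mxE mulrC giS.
by rewrite -scalemxAl mulmxKV // !mxE.
Qed.

Lemma chr_compat g x i : (g x)^T = g x -> g x \in unitmx ->
  (forall a b c, pd a (fun y => g y b c) x = pd a (fun y => g y c b) x) ->
  chr g x i *m g x + (chr g x i *m g x)^T = pdmx i g x.
Proof.
move=> gT gu gs; apply/matrixP => j l; rewrite mxE [X in _ + X]mxE !chr_lower // pdmxE.
rewrite (gs i l j) (gs l i j) (gs j i l); by field.
Qed.

Lemma nabla_chr g U X Y x : open U -> U x -> smooth_mx U Y ->
  nabla g X Y x = \sum_i X x 0 i *: (pdmx i Y x + Y x *m chr g x i).
Proof.
move=> oU Ux sY; rewrite /nabla (derive_pdmx (X x) oU Ux sY).
under [RHS]eq_bigr do rewrite scalerDr.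
rewrite big_split /=; congr (_ + _); apply/rowP => k; rewrite mxE summxE.
apply: eq_bigr => i _; rewrite !mxE mulr_sumr; apply: eq_bigr => j _.
by rewrite mxE; ring.
Qed.

(** The last two premises are metric compatibility and absence of torsion expressed in the frame,
    that is Cartan's first structure equation. They make [(pdmx i B x + B x *m Om i) *m invmx (B x)]
    satisfy [christoffel_unique]. The Gram matrix [G] may vary, as needed for coordinate changes. *)
Lemma frame_chr g U (B G : E -> M) (Om : 'I_n.+1 -> M) x : open U -> U x ->
  smooth_mx U B -> smooth_mx U G ->
  (forall y, U y -> g y = B y *m G y *m (B y)^T) ->
  B x \in unitmx -> (G x)^T = G x -> g x \in unitmx ->
  (forall i, pdmx i G x = Om i *m G x + (Om i *m G x)^T) ->
  (forall i j k, (pdmx i B x + B x *m Om i) j k = (pdmx j B x + B x *m Om j) i k) ->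
  forall i, chr g x i *m B x = pdmx i B x + B x *m Om i.
Proof.
move=> oU Ux sB sG gE uB GT gu mc tor i.
have gT : (g x)^T = g x by rewrite gE // !trmx_mul trmxK GT mulmxA.
suff -> : chr g x i = (pdmx i B x + B x *m Om i) *m invmx (B x) by rewrite mulmxKV.
apply: (christoffel_unique (C := fun i => (pdmx i B x + B x *m Om i) *m invmx (B x)) gT gu).
  move=> a b c; rewrite !mxE; apply: eq_bigr => l _; congr (_ * _); exact: tor.
move=> a; rewrite (gE x Ux) !mulmxA mulmxKV //.
rewrite (pdmx_eq a oU Ux gE).
have sBG := smooth_mxM oU sB sG.
rewrite (pdmxM a Ux sBG (smooth_mxT sB)) (pdmxM a Ux sB sG) pdmxT mc.
have trD (P Q : M) : (P + Q)^T = P^T + Q^T by rewrite linearD.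
move: (pdmx a B x) (Om a) => Ba Oa.
rewrite !(mulmxDl, mulmxDr, trD, trmx_mul, trmxK, GT) !mulmxA -!addrA.
by congr (_ + (_ + _)); rewrite addrC.
Qed.

End LeviCivita.

Section FrameCalculus.
Context {R : realType} {n : nat}.
Local Notation E := 'rV[R]_n.+1.
Local Notation M := 'M[R]_n.+1.
Variables (U : set E) (g B : E -> M) (Om : 'I_n.+1 -> E -> M).
Hypothesis oU : open U.
Hypothesis sB : smooth_mx U B.
Hypothesis sOm : forall i, smooth_mx U (Om i).
Hypothesis uB : forall x, U x -> B x \in unitmx.
Hypothesis chrB : forall x i, U x -> chr g x i *m B x = pdmx i B x + B x *m Om i x.

Definition covd i (z : E -> E) x : E := pdmx i z x + z x *m Om i x.

(** The curvature form of the connection matrices; since vectors are rows, the products come in the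
    order opposite to the usual one. *)
Definition curvf i j x : M :=
  pdmx i (Om j) x - pdmx j (Om i) x + Om j x *m Om i x - Om i x *m Om j x.

Lemma nabla_frame X Y x : U x -> smooth_mx U Y ->
  nabla g X Y x *m B x = \sum_i X x 0 i *: covd i (fun y => Y y *m B y) x.
Proof.
move=> Ux sY; rewrite (nabla_chr g X oU Ux sY) mulmx_suml; apply: eq_bigr => i _.
rewrite -scalemxAl; congr (_ *: _).
rewrite /covd (pdmxM i Ux sY sB) mulmxDl -addrA; congr (_ + _).
by rewrite -!mulmxA chrB // mulmxDr mulmxA.
Qed.

Lemma smooth_covd i z : smooth_mx U z -> smooth_mx U (covd i z).
Proof.
move=> sz; exact: (smooth_mxD oU (smooth_pdmx i sz) (smooth_mxM oU sz (sOm i))).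
Qed.

Lemma covd_sum i (f : 'I_n.+1 -> E -> R) (z : 'I_n.+1 -> E -> E) x : U x ->
  (forall j, smooth U (f j)) -> (forall j, smooth_mx U (z j)) ->
  covd i (fun y => \sum_j f j y *: z j y) x =
  \sum_j (pd i (f j) x *: z j x + f j x *: covd i (z j) x).
Proof.
move=> Ux sf sz; rewrite /covd.
have sfz k : smooth_mx U (fun y => f k y *: z k y) := smooth_mxZ oU (sf k) (sz k).
rewrite (pdmx_sum i (index_enum _) Ux sfz) mulmx_suml -big_split /=; apply: eq_bigr => j _.
by rewrite (pdmxZ i Ux (sf j) (sz j)) -scalemxAl -addrA -scalerDr.
Qed.

Lemma covd_comm i j z x : U x -> smooth_mx U z ->
  covd i (covd j z) x - covd j (covd i z) x = z x *m curvf i j x.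
Proof.
move=> Ux sz.
have H a b : covd a (covd b z) x = pdmx a (pdmx b z) x + (pdmx a z x *m Om b x + z x *m pdmx a (Om b) x)
    + (pdmx b z x *m Om a x + z x *m Om b x *m Om a x).
  rewrite /covd (pdmxD a Ux (smooth_pdmx b sz) (smooth_mxM oU sz (sOm b))).
  by rewrite (pdmxM a Ux sz (sOm b)) mulmxDl.
rewrite !H (pdmx_schwarz i j oU Ux sz) /curvf !mulmxDr !mulmxN !mulmxA.
by apply/rowP => k; rewrite !mxE; ring.
Qed.

Lemma smooth_nabla X Y : smooth_mx U X -> smooth_mx U Y -> smooth_mx U (nabla g X Y).
Proof.
move=> sX sY.
pose W x : E := (\sum_i X x 0 i *: covd i (fun y => Y y *m B y) x) *m invmx (B x).
have WE x : U x -> W x = nabla g X Y x by move=> Ux; rewrite /W -nabla_frame // mulmxK // uB.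
apply: (smooth_mx_eq oU WE); apply: (smooth_mxM oU); last exact: (smooth_mxV oU uB sB).
apply: (smooth_mx_sum _ oU) => i; apply: (smooth_mxZ oU (smooth_entry sX 0 i)).
exact: (smooth_covd i (smooth_mxM oU sY sB)).
Qed.

(** In the second covariant derivatives, the terms that differentiate the components of [X] and [Y]
    assemble to the derivative along [[X, Y]] and cancel; the commutator [covd_comm] remains. *)
Lemma curv_frame X Y Z x : U x -> smooth_mx U X -> smooth_mx U Y -> smooth_mx U Z ->
  curv g X Y Z x *m B x =
  \sum_i \sum_j (X x 0 i * Y x 0 j) *: (Z x *m B x *m curvf i j x).
Proof.
move=> Ux sX sY sZ; rewrite /curv !mulmxBl.
set z := fun y => Z y *m B y.
have sz : smooth_mx U z := smooth_mxM oU sZ sB.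
have sc j := smooth_covd j sz.
have nn X' Y' : smooth_mx U X' -> smooth_mx U Y' ->
    nabla g X' (nabla g Y' Z) x *m B x =
    \sum_i X' x 0 i *: \sum_j (pd i (fun y => Y' y 0 j) x *: covd j z x
         + Y' x 0 j *: covd i (covd j z) x).
  move=> sX' sY'; rewrite (nabla_frame X' Ux (smooth_nabla sY' sZ)).
  apply: eq_bigr => i _; congr (_ *: _).
  rewrite -(covd_sum i Ux (fun j => smooth_entry sY' 0 j) sc).
  rewrite /covd; congr (_ + _); last by rewrite nabla_frame.
  by apply: (pdmx_eq i oU Ux) => y Uy; rewrite nabla_frame.
rewrite (nn X Y sX sY) (nn Y X sY sX) (nabla_frame _ Ux sZ) -/z.
have lE j : lie X Y x 0 j = \sum_i (X x 0 i * pd i (fun y => Y y 0 j) x)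
      - \sum_i (Y x 0 i * pd i (fun y => X y 0 j) x).
  rewrite /lie (derive_pdmx _ oU Ux sY) (derive_pdmx _ oU Ux sX) mxE [X in _ + X]mxE !summxE.
  by congr (_ - _); apply: eq_bigr => i _; rewrite mxE pdmxE.
have split3 (X' Y' : E -> E) :
  \sum_i X' x 0 i *: (\sum_j (pd i (fun y => Y' y 0 j) x *: covd j z x
         + Y' x 0 j *: covd i (covd j z) x)) =
  \sum_j (\sum_i X' x 0 i * pd i (fun y => Y' y 0 j) x) *: covd j z x
  + \sum_i \sum_j (X' x 0 i * Y' x 0 j) *: covd i (covd j z) x.
  under eq_bigr do rewrite big_split scalerDr /=.
  rewrite big_split /=; congr (_ + _).
    under eq_bigr do rewrite scaler_sumr.
    rewrite exchange_big /=; apply: eq_bigr => j _; rewrite scaler_suml.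
    by apply: eq_bigr => i _; rewrite scalerA.
  apply: eq_bigr => i _; rewrite scaler_sumr; apply: eq_bigr => j _.
  by rewrite scalerA.
rewrite (split3 X Y) (split3 Y X).
under [X in _ - X]eq_bigr do rewrite lE scalerBl.
rewrite sumrB.
have -> : \sum_i \sum_j (Y x 0 i * X x 0 j) *: covd i (covd j z) x =
          \sum_i \sum_j (X x 0 i * Y x 0 j) *: covd j (covd i z) x.
  rewrite exchange_big /=; apply: eq_bigr => i _; apply: eq_bigr => j _.
  by rewrite mulrC.
have -> : \sum_i \sum_j (X x 0 i * Y x 0 j) *: (z x *m curvf i j x) =
   \sum_i \sum_j (X x 0 i * Y x 0 j) *: covd i (covd j z) x
   - \sum_i \sum_j (X x 0 i * Y x 0 j) *: covd j (covd i z) x.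
  rewrite -sumrB; apply: eq_bigr => i _; rewrite -sumrB; apply: eq_bigr => j _.
  by rewrite -scalerBr covd_comm.
move: (\sum_j _ *: covd j z x) (\sum_j _ *: covd j z x) => a b.
move: (\sum_i _) (\sum_i _) => p q.
by apply/rowP => k; rewrite !mxE; ring.
Qed.

End FrameCalculus.

(** * The model structures *)

Lemma ord5_ind (P : 'I_5 -> Prop) : P ct -> P cx1 -> P cx2 -> P cy1 -> P cy2 -> forall i, P i.
Proof.
move=> P0 P1 P2 P3 P4 [[|[|[|[|[|m]]]]] im] //.
- by rewrite (_ : Ordinal im = ct) //; apply: val_inj.
- by rewrite (_ : Ordinal im = cx1) //; apply: val_inj.
- by rewrite (_ : Ordinal im = cx2) //; apply: val_inj.
- by rewrite (_ : Ordinal im = cy1) //; apply: val_inj.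
- by rewrite (_ : Ordinal im = cy2) //; apply: val_inj.
Qed.

Lemma sum5 (V : nmodType) (F : 'I_5 -> V) :
  \sum_i F i = F ct + F cx1 + F cx2 + F cy1 + F cy2.
Proof.
rewrite !big_ord_recl big_ord0 addr0 !addrA.
by do !congr (_ + _); congr (F _); apply: val_inj.
Qed.

Section Matrices5.
Context {R : realType}.
Local Notation E := 'rV[R]_5.
Local Notation M := 'M[R]_5.

Definition mxs (F : seq (seq R)) : M := \matrix_(i < 5, j < 5) nth 0 (nth [::] F i) j.

Definition frame_gram : M := mxs
  [:: [:: 1; 0; 0; 0; 0]; [:: 0; 0; 0; 1; 0]; [:: 0; 0; 0; 0; 1]; [:: 0; 1; 0; 0; 0]; [:: 0; 0; 1; 0; 0]].

Definition frame_phi : M := mxs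
  [:: [:: 0; 0; 0; 0; 0]; [:: 0; 1; 0; 0; 0]; [:: 0; 0; -1; 0; 0]; [:: 0; 0; 0; -1; 0]; [:: 0; 0; 0; 0; 1]].

(** Columns are the forms of the coframe, rows the coordinate fields, in the order [t], [x1], [x2],
    [y1], [y2]. Right multiplication therefore turns coordinate components of a vector into frame
    components. *)
Definition coframe (a b p q r s : R) : M := mxs
  [:: [:: 1; 0; 0; 0; 0]; [:: 0; 1; 0; p; s]; [:: 0; 0; 1; r; q]; [:: 0; 0; 0; a; 0]; [:: 0; 0; 0; 0; b]].

Definition frame (a b p q r s : R) : M := mxs
  [:: [:: 1; 0; 0; 0; 0]; [:: 0; 1; 0; - p / a; - s / b]; [:: 0; 0; 1; - r / a; - q / b];
      [:: 0; 0; 0; a^-1; 0]; [:: 0; 0; 0; 0; b^-1]].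

Lemma frame_coframe a b p q r s : a != 0 -> b != 0 ->
  frame a b p q r s *m coframe a b p q r s = 1%:M.
Proof.
move=> a0 b0; apply/matrixP.
by elim/ord5_ind; elim/ord5_ind; rewrite mxE sum5 !mxE /=; field; rewrite ?a0 ?b0.
Qed.

Lemma frame_gramT : frame_gram^T = frame_gram.
Proof. by apply/matrixP; elim/ord5_ind; elim/ord5_ind; rewrite !mxE. Qed.

Lemma frame_gramK : frame_gram *m frame_gram = 1%:M.
Proof.
apply/matrixP; elim/ord5_ind; elim/ord5_ind; rewrite mxE sum5 !mxE /=; ring.
Qed.

(** Row [k] is the derivative along [d/dx1] of the k-th frame vector: row [ct] encodes
    [nabla xi = - A], row [cy1] encodes [tau1 = - y1 dx1]. Skewness for [frame_gram] supplies the
    other rows, up to the coefficient [w] that torsion will fix. [conn2] is its counterpart along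
    [d/dx2]. *)
Definition conn1 (y w : R) : M := mxs
  [:: [:: 0; 0; 0; -1; 0]; [:: 1; y; 0; 0; w]; [:: 0; 0; 0; - w; 0]; [:: 0; 0; 0; - y; 0]; [:: 0; 0; 0; 0; 0]].

Definition conn2 (sigma y w : R) : M := mxs
  [:: [:: 0; 0; 0; 0; - sigma]; [:: 0; 0; 0; 0; w]; [:: sigma; 0; - y; - w; 0]; [:: 0; 0; 0; 0; 0]; [:: 0; 0; 0; 0; y]].

Lemma conn1_skew y w : conn1 y w *m frame_gram + (conn1 y w *m frame_gram)^T = 0.
Proof.
apply/matrixP; elim/ord5_ind; elim/ord5_ind; rewrite !(mxE, sum5) /=; ring.
Qed.

Lemma conn2_skew sg y w : conn2 sg y w *m frame_gram + (conn2 sg y w *m frame_gram)^T = 0.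
Proof.
apply/matrixP; elim/ord5_ind; elim/ord5_ind; rewrite !(mxE, sum5) /=; ring.
Qed.

End Matrices5.

Section ConnectionProducts.
Context {R : realType}.

Lemma mxs_add (a00 a01 a02 a03 a04 a10 a11 a12 a13 a14 a20 a21 a22 a23 a24 a30 a31 a32 a33 a34
    a40 a41 a42 a43 a44 b00 b01 b02 b03 b04 b10 b11 b12 b13 b14 b20 b21 b22 b23 b24 b30 b31 b32 b33 b34
    b40 b41 b42 b43 b44 : R) :
  mxs [:: [:: a00; a01; a02; a03; a04]; [:: a10; a11; a12; a13; a14]; [:: a20; a21; a22; a23; a24];
       [:: a30; a31; a32; a33; a34]; [:: a40; a41; a42; a43; a44]] +
  mxs [:: [:: b00; b01; b02; b03; b04]; [:: b10; b11; b12; b13; b14]; [:: b20; b21; b22; b23; b24];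
       [:: b30; b31; b32; b33; b34]; [:: b40; b41; b42; b43; b44]] =
  mxs [:: [:: a00 + b00; a01 + b01; a02 + b02; a03 + b03; a04 + b04];
       [:: a10 + b10; a11 + b11; a12 + b12; a13 + b13; a14 + b14];
       [:: a20 + b20; a21 + b21; a22 + b22; a23 + b23; a24 + b24];
       [:: a30 + b30; a31 + b31; a32 + b32; a33 + b33; a34 + b34];
       [:: a40 + b40; a41 + b41; a42 + b42; a43 + b43; a44 + b44]].
Proof. by apply/matrixP => i j; rewrite !mxE; elim/ord5_ind: i; elim/ord5_ind: j. Qed.

Lemma cof_conn1 (a b p q r s y w : R) : coframe a b p q r s *m conn1 y w = mxs
  [:: [:: 0; 0; 0; -1; 0]; [:: 1; y; 0; - p * y; w]; [:: 0; 0; 0; - w - r * y; 0];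
      [:: 0; 0; 0; - a * y; 0]; [:: 0; 0; 0; 0; 0]].
Proof.
apply/matrixP => i j; rewrite mxE sum5 !mxE; elim/ord5_ind: i; elim/ord5_ind: j => /=; ring.
Qed.

Lemma cof_conn2 (a b p q r s sg y w : R) : coframe a b p q r s *m conn2 sg y w = mxs
  [:: [:: 0; 0; 0; 0; - sg]; [:: 0; 0; 0; 0; w + s * y]; [:: sg; 0; - y; - w; q * y];
      [:: 0; 0; 0; 0; 0]; [:: 0; 0; 0; 0; b * y]].
Proof.
apply/matrixP => i j; rewrite mxE sum5 !mxE; elim/ord5_ind: i; elim/ord5_ind: j => /=; ring.
Qed.

(** The common shape of the model curvature: it kills [xi] and only joins frame vectors with equal
    [phi]-eigenvalue, whence [curvm_phi]. *)
Definition curvm (k1 k2 w : R) : 'M[R]_5 := mxs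
  [:: [:: 0; 0; 0; 0; 0]; [:: 0; k1; 0; 0; w]; [:: 0; 0; - k2; - w; 0]; [:: 0; 0; 0; - k1; 0];
      [:: 0; 0; 0; 0; k2]].

Lemma conn_comm (sg y y' w w' : R) :
  conn2 sg y' w' *m conn1 y w - conn1 y w *m conn2 sg y' w' = curvm 0 0 (sg - y * w' - y' * w).
Proof.
have -> : conn2 sg y' w' *m conn1 y w = mxs [:: [:: 0; 0; 0; 0; 0]; [:: 0; 0; 0; 0; 0];
    [:: 0; 0; 0; y' * w - sg + w' * y; 0]; [:: 0; 0; 0; 0; 0]; [:: 0; 0; 0; 0; 0]].
  apply/matrixP => i j; rewrite mxE sum5 !mxE; elim/ord5_ind: i; elim/ord5_ind: j => /=; ring.
have -> : conn1 y w *m conn2 sg y' w' = mxs [:: [:: 0; 0; 0; 0; 0];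
    [:: 0; 0; 0; 0; y * w' - sg + w * y'];
    [:: 0; 0; 0; 0; 0]; [:: 0; 0; 0; 0; 0]; [:: 0; 0; 0; 0; 0]].
  apply/matrixP => i j; rewrite mxE sum5 !mxE; elim/ord5_ind: i; elim/ord5_ind: j => /=; ring.
apply/matrixP => i j; rewrite !mxE; elim/ord5_ind: i; elim/ord5_ind: j => /=; ring.
Qed.

Lemma curvmD k1 k2 w k1' k2' w' :
  curvm k1 k2 w + curvm k1' k2' w' = curvm (k1 + k1') (k2 + k2') (w + w').
Proof.
rewrite /curvm mxs_add; congr mxs; do ![congr (_ :: _)]; rewrite ?addr0 //; ring.
Qed.

Lemma curvmN k1 k2 w : - curvm k1 k2 w = curvm (- k1) (- k2) (- w).
Proof.
apply/matrixP => i j; rewrite !mxE; elim/ord5_ind: i; elim/ord5_ind: j => /=; ring.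
Qed.

Lemma curvm_phi k1 k2 w : curvm k1 k2 w *m frame_phi = frame_phi *m curvm k1 k2 w.
Proof.
apply/matrixP => i j; rewrite [LHS]mxE [RHS]mxE !sum5 !mxE.
elim/ord5_ind: i; elim/ord5_ind: j => /=; ring.
Qed.

End ConnectionProducts.

Section ModelDefinitions.
Context {R : realType}.
Local Notation E := 'rV[R]_5.
Local Notation M := 'M[R]_5.
Variables (sigma : R) (a b p q r s : E -> R).

Definition cof (x : E) : M := coframe (a x) (b x) (p x) (q x) (r x) (s x).
Definition fra (x : E) : M := frame (a x) (b x) (p x) (q x) (r x) (s x).

(** [w1] and [w2] are the solutions of the two torsion equations in the pair [x1], [x2], for
    [theta3] and [theta4]. *)
Definition w1 (x : E) : R := pd cx1 r x - pd cx2 p x - r x * x 0 cy1.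
Definition w2 (x : E) : R := pd cx1 q x - pd cx2 s x - s x * x 0 cy2.

Definition Om (i : 'I_5) (x : E) : M :=
  match val i with
  | 1%N => conn1 (x 0 cy1) (w1 x)
  | 2%N => conn2 sigma (x 0 cy2) (w2 x)
  | _ => 0
  end.

(* [a], [b], [p], [q], [r], [s] stand for [d f1/d y1], [d f2/d y2],
   [u - t + d f1/d x1], [v - sigma t + d f2/d x2], [d f1/d x2], [d f2/d x1].  There is
   no [f3]: replacing [theta3] by [theta3 + f3 theta2] and [theta4] by
   [theta4 - f3 theta1] changes neither [phi] nor [g]. *)
Record framed (U : set E) (S : pcstruct R 4) : Prop := Framed {
  fr_open : open U;
  fr_a : smooth U a; fr_b : smooth U b; fr_p : smooth U p; fr_q : smooth U q;
  fr_r : smooth U r; fr_s : smooth U s;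
  fr_a0 : forall x, U x -> a x != 0; fr_b0 : forall x, U x -> b x != 0;
  fr_dt : forall x, U x -> [/\ pd ct a x = 0, pd ct b x = 0, pd ct p x = -1, pd ct q x = - sigma &
    pd ct r x = 0 /\ pd ct s x = 0];
  fr_dy1 : forall x, U x -> [/\ pd cy1 b x = 0, pd cy1 p x = pd cx1 a x - a x * x 0 cy1,
    pd cy1 q x = 0, pd cy1 r x = pd cx2 a x & pd cy1 s x = 0];
  fr_dy2 : forall x, U x -> [/\ pd cy2 a x = 0, pd cy2 p x = 0,
    pd cy2 q x = pd cx2 b x + b x * x 0 cy2, pd cy2 r x = 0 & pd cy2 s x = pd cx1 b x];
  fr_S : forall x, U x -> [/\ xi S x = delta_mx 0 ct, Defs.eta S x = delta_mx 0 ct,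
    phi S x *m cof x = cof x *m frame_phi &
    met S x = cof x *m frame_gram *m (cof x)^T] }.

End ModelDefinitions.

Section Model.
Context {R : realType}.
Local Notation E := 'rV[R]_5.
Local Notation M := 'M[R]_5.
Variables (sigma : R) (a b p q r s : E -> R) (U : set E) (S : pcstruct R 4).
Hypothesis H : framed sigma a b p q r s U S.
Let oU := fr_open H. Let sa := fr_a H. Let sb := fr_b H. Let sp := fr_p H. Let sq := fr_q H. Let sr := fr_r H.
Let ss := fr_s H. Let a0 := fr_a0 H. Let b0 := fr_b0 H. Let dt := fr_dt H.
Let dy1 := fr_dy1 H. Let dy2 := fr_dy2 H. Let HS := fr_S H.
Local Notation cof := (cof a b p q r s).
Local Notation fra := (fra a b p q r s).
Local Notation w1 := (w1 p r).
Local Notation w2 := (w2 q s).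
Local Notation Om := (Om sigma p q r s).

Definition cof_fun : seq (seq (E -> R)) :=
  [:: [:: fun=> 1; fun=> 0; fun=> 0; fun=> 0; fun=> 0]; [:: fun=> 0; fun=> 1; fun=> 0; p; s];
      [:: fun=> 0; fun=> 0; fun=> 1; r; q]; [:: fun=> 0; fun=> 0; fun=> 0; a; fun=> 0];
      [:: fun=> 0; fun=> 0; fun=> 0; fun=> 0; b]].

Lemma cof_entry (j k : 'I_5) : (fun y => cof y j k) = nth (fun=> 0) (nth [::] cof_fun j) k.
Proof.
by apply/funext => y; rewrite mxE; elim/ord5_ind: j; elim/ord5_ind: k.
Qed.

Lemma pdmx_cof i x : pdmx i cof x = mxs
  [:: [:: 0; 0; 0; 0; 0]; [:: 0; 0; 0; pd i p x; pd i s x]; [:: 0; 0; 0; pd i r x; pd i q x];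
      [:: 0; 0; 0; pd i a x; 0]; [:: 0; 0; 0; 0; pd i b x]].
Proof.
apply/matrixP => j k; rewrite pdmxE [RHS]mxE cof_entry.
by elim/ord5_ind: j; elim/ord5_ind: k; rewrite /cof_fun /nth /= ?pd_cst.
Qed.

Lemma smooth_cof : smooth_mx U cof.
Proof.
have c0 := smooth_cst (0 : R) oU; have c1 := smooth_cst (1 : R) oU.
apply/smooth_mxP => j k; rewrite cof_entry.
elim/ord5_ind: j; elim/ord5_ind: k; rewrite /cof_fun /nth /=;
  lazymatch goal with
  | |- smooth _ (fun=> 0) => exact: c0
  | |- smooth _ (fun=> 1) => exact: c1
  | _ => assumption
  end.
Qed.

Lemma fra_cof x : U x -> fra x *m cof x = 1%:M.
Proof. by move=> Ux; exact: (frame_coframe _ _ _ _ (a0 Ux) (b0 Ux)). Qed.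

Lemma cof_unit x : U x -> cof x \in unitmx.
Proof. by move=> Ux; have [] := mulmx1_unit (fra_cof Ux). Qed.

Lemma cof_fra x : U x -> cof x *m fra x = 1%:M.
Proof. by move=> Ux; exact: mulmx1C (fra_cof Ux). Qed.

Lemma invmx_cof x : U x -> invmx (cof x) = fra x.
Proof.
by move=> Ux; rewrite -[LHS]mul1mx -(fra_cof Ux) mulmxK // cof_unit.
Qed.

Lemma smooth_fra : smooth_mx U fra.
Proof. exact: (smooth_mx_eq oU invmx_cof (smooth_mxV oU cof_unit smooth_cof)). Qed.

Lemma smooth_w1 : smooth U w1.
Proof.
apply: (smoothB oU); last exact: (smoothM oU sr (smooth_coord cy1 oU)).
exact: (smoothB oU (smooth_pd cx1 sr) (smooth_pd cx2 sp)).
Qed.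

Lemma smooth_w2 : smooth U w2.
Proof.
apply: (smoothB oU); last exact: (smoothM oU ss (smooth_coord cy2 oU)).
exact: (smoothB oU (smooth_pd cx1 sq) (smooth_pd cx2 ss)).
Qed.

Lemma conn1_entry (j k : 'I_5) :
  (fun x : E => conn1 (x 0 cy1) (w1 x) j k) = nth (fun=> 0) (nth [::]
     [:: [:: fun=> 0; fun=> 0; fun=> 0; fun=> -1; fun=> 0];
         [:: fun=> 1; fun x : E => x 0 cy1; fun=> 0; fun=> 0; w1];
         [:: fun=> 0; fun=> 0; fun=> 0; fun x => - w1 x; fun=> 0];
         [:: fun=> 0; fun=> 0; fun=> 0; fun x : E => - x 0 cy1; fun=> 0];
         [:: fun=> 0; fun=> 0; fun=> 0; fun=> 0; fun=> 0]] j) k.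
Proof. by apply/funext => x; rewrite mxE; elim/ord5_ind: j; elim/ord5_ind: k. Qed.

Lemma conn2_entry (j k : 'I_5) :
  (fun x : E => conn2 sigma (x 0 cy2) (w2 x) j k) = nth (fun=> 0) (nth [::]
     [:: [:: fun=> 0; fun=> 0; fun=> 0; fun=> 0; fun=> - sigma];
         [:: fun=> 0; fun=> 0; fun=> 0; fun=> 0; w2];
         [:: fun=> sigma; fun=> 0; fun x : E => - x 0 cy2; fun x => - w2 x; fun=> 0];
         [:: fun=> 0; fun=> 0; fun=> 0; fun=> 0; fun=> 0];
         [:: fun=> 0; fun=> 0; fun=> 0; fun=> 0; fun x : E => x 0 cy2]] j) k.
Proof. by apply/funext => x; rewrite mxE; elim/ord5_ind: j; elim/ord5_ind: k. Qed.

Lemma smooth_Om i : smooth_mx U (Om i).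
Proof.
have y1 := smooth_coord cy1 oU; have y2 := smooth_coord cy2 oU.
have c0 := smooth_cst (0 : R) oU.
have z : smooth_mx U (fun=> 0 : M) := smooth_mx_cst 0 oU.
elim/ord5_ind: i; rewrite /Om /=; [exact: z| | |exact: z|exact: z].
- apply/smooth_mxP => j k.
  rewrite conn1_entry.
  elim/ord5_ind: j; elim/ord5_ind: k; rewrite /nth /=;
  lazymatch goal with
  | |- smooth _ (fun=> 0) => exact: c0
  | |- smooth _ (fun=> 1) => exact: (smooth_cst _ oU)
  | |- smooth _ (fun=> -1) => exact: (smooth_cst _ oU)
  | |- smooth _ w1 => exact: smooth_w1
  | |- smooth _ (fun x => - w1 x) => exact: (smoothN oU smooth_w1)
  | |- smooth _ (fun x => - _) => exact: (smoothN oU y1)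
  | _ => exact: y1
  end.
- apply/smooth_mxP => j k.
  rewrite conn2_entry.
  elim/ord5_ind: j; elim/ord5_ind: k; rewrite /nth /=;
  lazymatch goal with
  | |- smooth _ (fun=> 0) => exact: c0
  | |- smooth _ (fun=> sigma) => exact: (smooth_cst _ oU)
  | |- smooth _ (fun=> - sigma) => exact: (smooth_cst _ oU)
  | |- smooth _ w2 => exact: smooth_w2
  | |- smooth _ (fun x => - w2 x) => exact: (smoothN oU smooth_w2)
  | |- smooth _ (fun x => - _) => exact: (smoothN oU y2)
  | _ => exact: y2
  end.
Qed.

Lemma Om_skew i x : Om i x *m frame_gram + (Om i x *m frame_gram)^T = 0.
Proof.
rewrite /Om; elim/ord5_ind: i => /=; rewrite ?mul0mx ?trmx0 ?addr0 //.
- exact: conn1_skew.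
- exact: conn2_skew.
Qed.

Lemma cof_torsion x : U x -> forall i j k,
  (pdmx i cof x + cof x *m Om i x) j k = (pdmx j cof x + cof x *m Om j x) i k.
Proof.
move=> Ux.
have [t1 t2 t3 t4 [t5 t6]] := dt Ux; have [y1 y2 y3 y4 y5] := dy1 Ux.
have [z1 z2 z3 z4 z5] := dy2 Ux.
(* Torsion vanishes because row [j] of the i-th matrix of this table is row [i] of the j-th one. *)
suff KE i : pdmx i cof x + cof x *m Om i x = mxs (nth [::]
  [:: [:: [:: 0; 0; 0; 0; 0]; [:: 0; 0; 0; -1; 0]; [:: 0; 0; 0; 0; - sigma];
          [:: 0; 0; 0; 0; 0]; [:: 0; 0; 0; 0; 0]];
      [:: [:: 0; 0; 0; -1; 0];
          [:: 1; x 0 cy1; 0; pd cx1 p x - p x * x 0 cy1; pd cx1 s x + w1 x];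
          [:: 0; 0; 0; pd cx2 p x; pd cx1 q x];
          [:: 0; 0; 0; pd cx1 a x - a x * x 0 cy1; 0]; [:: 0; 0; 0; 0; pd cx1 b x]];
      [:: [:: 0; 0; 0; 0; - sigma];
          [:: 0; 0; 0; pd cx2 p x; pd cx1 q x];
          [:: sigma; 0; - x 0 cy2; pd cx2 r x - w2 x; pd cx2 q x + q x * x 0 cy2];
          [:: 0; 0; 0; pd cx2 a x; 0]; [:: 0; 0; 0; 0; pd cx2 b x + b x * x 0 cy2]];
      [:: [:: 0; 0; 0; 0; 0];
          [:: 0; 0; 0; pd cx1 a x - a x * x 0 cy1; 0]; [:: 0; 0; 0; pd cx2 a x; 0];
          [:: 0; 0; 0; pd cy1 a x; 0]; [:: 0; 0; 0; 0; 0]];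
      [:: [:: 0; 0; 0; 0; 0];
          [:: 0; 0; 0; 0; pd cx1 b x]; [:: 0; 0; 0; 0; pd cx2 b x + b x * x 0 cy2];
          [:: 0; 0; 0; 0; 0]; [:: 0; 0; 0; 0; pd cy2 b x]]] i).
  move=> i j k; rewrite (KE i) (KE j) [LHS]mxE [RHS]mxE.
  by elim/ord5_ind: i; elim/ord5_ind: j; elim/ord5_ind: k.
rewrite pdmx_cof; elim/ord5_ind: i; rewrite /Om /=.
- by rewrite mulmx0 addr0 t1 t2 t3 t4 t5 t6.
- rewrite cof_conn1 mxs_add /w1.
  by congr mxs; do ![congr (_ :: _)]; rewrite ?add0r ?addr0 //; ring.
- rewrite cof_conn2 mxs_add /w2.
  by congr mxs; do ![congr (_ :: _)]; rewrite ?add0r ?addr0 //; ring.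
- by rewrite mulmx0 addr0 y1 y2 y3 y4 y5.
- by rewrite mulmx0 addr0 z1 z2 z3 z4 z5.
Qed.

Lemma met_sym x : U x -> (met S x)^T = met S x.
Proof. by move=> Ux; have [_ _ _ ->] := HS Ux; rewrite !trmx_mul trmxK frame_gramT mulmxA. Qed.

Lemma frame_gram_unit : (frame_gram : M) \in unitmx.
Proof. by have [] := mulmx1_unit (@frame_gramK R). Qed.

Lemma met_unit x : U x -> met S x \in unitmx.
Proof.
move=> Ux; have [_ _ _ ->] := HS Ux.
by rewrite !unitmx_mul unitmx_tr cof_unit // frame_gram_unit.
Qed.

Lemma model_chr x i : U x -> chr (met S) x i *m cof x = pdmx i cof x + cof x *m Om i x.
Proof.
move=> Ux.
have gE y : U y -> met S y = cof y *m frame_gram *m (cof y)^T by move=> /HS[].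
have mc j : pdmx j (fun=> frame_gram) x = Om j x *m frame_gram + (Om j x *m frame_gram)^T.
  by rewrite pdmx_cst Om_skew.
exact: (frame_chr oU Ux smooth_cof (smooth_mx_cst frame_gram oU) gE (cof_unit Ux)
  (frame_gramT (R := R)) (met_unit Ux) mc (cof_torsion Ux) i).
Qed.

Definition model_curv_frame := curv_frame oU smooth_cof smooth_Om cof_unit (fun x i Ux => model_chr i Ux).
Definition model_nabla_frame := nabla_frame oU smooth_cof (fun x i Ux => model_chr i Ux).

End Model.

(** * Curvature of the model *)

Section ModelCurvature.
Context {R : realType}.
Local Notation E := 'rV[R]_5.
Local Notation M := 'M[R]_5.
Variables (sigma : R) (a b p q r s : E -> R) (U : set E) (S : pcstruct R 4).
Hypothesis H : framed sigma a b p q r s U S.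
Let oU := fr_open H. Let HS := fr_S H.
Local Notation cof := (cof a b p q r s).
Local Notation fra := (fra a b p q r s).
Local Notation w1 := (w1 p r).
Local Notation w2 := (w2 q s).
Local Notation Om := (Om sigma p q r s).

Lemma pdmx_Om i j x : U x -> pdmx i (Om j) x =
  curvm ((j == cx1)%:R * (i == cy1)%:R) ((j == cx2)%:R * (i == cy2)%:R)
    ((j == cx1)%:R * pd i w1 x + (j == cx2)%:R * pd i w2 x).
Proof.
move=> Ux.
have sw1 := smooth_w1 H; have sw2 := smooth_w2 H.
have z0 : pdmx i (fun=> 0 : M) x = curvm (0 * 0) (0 * 0) (0 * 0 + 0 * 0).
  rewrite pdmx_cst; apply/matrixP => k l; rewrite !mxE.
  by elim/ord5_ind: k; elim/ord5_ind: l; rewrite /= ?mulr0 ?addr0 ?oppr0.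
elim/ord5_ind: j => /=; rewrite ?mul0r; [by rewrite pdmx_cst; apply/matrixP => k l; rewrite !mxE;
    elim/ord5_ind: k; elim/ord5_ind: l; rewrite /= ?addr0 ?oppr0| | |
  by rewrite pdmx_cst; apply/matrixP => k l; rewrite !mxE;
    elim/ord5_ind: k; elim/ord5_ind: l; rewrite /= ?addr0 ?oppr0|
  by rewrite pdmx_cst; apply/matrixP => k l; rewrite !mxE;
    elim/ord5_ind: k; elim/ord5_ind: l; rewrite /= ?addr0 ?oppr0].
- rewrite !mul1r addr0; apply/matrixP => k l; rewrite pdmxE [RHS]mxE conn1_entry.
  elim/ord5_ind: k; elim/ord5_ind: l; rewrite /nth /= ?pd_cst ?oppr0 //.
  + exact: pd_coord.
  + by rewrite (pdN (smooth_derivable sw1 Ux)).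
  + by rewrite (pdN (smooth_derivable (smooth_coord cy1 oU) Ux)) pd_coord.
- rewrite !mul1r add0r; apply/matrixP => k l; rewrite pdmxE [RHS]mxE conn2_entry.
  elim/ord5_ind: k; elim/ord5_ind: l; rewrite /nth /= ?pd_cst ?oppr0 //.
  + by rewrite (pdN (smooth_derivable (smooth_coord cy2 oU) Ux)) pd_coord.
  + by rewrite (pdN (smooth_derivable sw2 Ux)).
  + exact: pd_coord.
Qed.

(** The value on the coordinate fields [i], [j] of [dw1 /\ dx1 + dw2 /\ dx2 + (sigma - y1 w2 - y2
    w1) dx1 /\ dx2]; the last term comes from the commutator [conn_comm]. *)
Definition kap (i j : 'I_5) (x : E) : R :=
  ((j == cx1)%:R * pd i w1 x + (j == cx2)%:R * pd i w2 x)
  - ((i == cx1)%:R * pd j w1 x + (i == cx2)%:R * pd j w2 x)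
  + ((i == cx1)%:R * (j == cx2)%:R - (i == cx2)%:R * (j == cx1)%:R)
     * (sigma - x 0 cy1 * w2 x - x 0 cy2 * w1 x).

Definition dx_wedge (k l i j : 'I_5) : R := (i == k)%:R * (j == l)%:R - (j == k)%:R * (i == l)%:R.

Lemma Om_comm i j x : Om j x *m Om i x - Om i x *m Om j x = curvm 0 0
  (((i == cx1)%:R * (j == cx2)%:R - (i == cx2)%:R * (j == cx1)%:R)
     * (sigma - x 0 cy1 * w2 x - x 0 cy2 * w1 x)).
Proof.
have c00 : curvm 0 0 0 = 0 :> M.
  by apply/matrixP => k l; rewrite !mxE; elim/ord5_ind: k; elim/ord5_ind: l; rewrite /= ?oppr0.
have sw c : - curvm 0 0 c = curvm 0 0 (- c) :> M by rewrite curvmN oppr0.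
elim/ord5_ind: i; elim/ord5_ind: j; rewrite /Om /= ?(mul0mx, mulmx0, mul0r, mulr0, subr0, subrr, c00) //.
- by rewrite conn_comm mul1r mul1r.
- by rewrite -opprB conn_comm sw sub0r mul1r mulN1r.
Qed.

Lemma curvfE i j x : U x -> curvf Om i j x = curvm (dx_wedge cy1 cx1 i j) (dx_wedge cy2 cx2 i j) (kap i j x).
Proof.
move=> Ux; rewrite /curvf -addrA Om_comm !pdmx_Om // curvmN !curvmD /dx_wedge /kap.
by congr curvm; rewrite ?addr0 //; congr (_ - _); rewrite mulrC.
Qed.

Lemma smooth_phi : smooth_mx U (phi S).
Proof.
have scof := smooth_cof H; have sfra := smooth_fra H.
have E0 x : U x -> cof x *m frame_phi *m fra x = phi S x.
  by move=> Ux; have [_ _ <- _] := HS Ux; rewrite -mulmxA (cof_fra H Ux) mulmx1.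
exact: (smooth_mx_eq oU E0 (smooth_mxM oU (smooth_mxM oU scof (smooth_mx_cst _ oU)) sfra)).
Qed.

Lemma smooth_endo Z : smooth_mx U Z -> smooth_mx U (endo (phi S) Z).
Proof. by move=> sZ; exact: (smooth_mxM oU sZ smooth_phi). Qed.

Lemma cof_inj x (v w : E) : U x -> v *m cof x = w *m cof x -> v = w.
Proof.
by move=> Ux /(congr1 (mulmx^~ (fra x))); rewrite -!mulmxA (cof_fra H Ux) !mulmx1.
Qed.

Lemma model_curv_phi X Y Z x : smooth_mx U X -> smooth_mx U Y -> smooth_mx U Z -> U x ->
  curv (met S) X Y (endo (phi S) Z) x = endo (phi S) (curv (met S) X Y Z) x.
Proof.
move=> sX sY sZ Ux; apply: (cof_inj Ux).
have [_ _ phiE _] := HS Ux.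
have endoE (W : E -> E) : endo (phi S) W x *m cof x = W x *m cof x *m frame_phi.
  by rewrite /endo -!mulmxA phiE.
rewrite (model_curv_frame H Ux sX sY (smooth_endo sZ)) endoE.
rewrite endoE (model_curv_frame H Ux sX sY sZ) mulmx_suml; apply: eq_bigr => i _.
rewrite mulmx_suml; apply: eq_bigr => j _; rewrite -scalemxAl; congr (_ *: _).
by rewrite curvfE // -!mulmxA curvm_phi.
Qed.

End ModelCurvature.

Lemma ev_delta {R : realType} {n} (i : 'I_n) (v : 'rV[R]_n) : ev (delta_mx 0 i) v = v 0 i.
Proof. by rewrite /ev trmx_delta -colE mxE. Qed.

Lemma bil_gram {R : realType} (z z' : 'rV[R]_5) : bil frame_gram z z' =
  z 0 ct * z' 0 ct + z 0 cx1 * z' 0 cy1 + z 0 cy1 * z' 0 cx1 + z 0 cx2 * z' 0 cy2 + z 0 cy2 * z' 0 cx2.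
Proof.
rewrite /bil; have -> : z *m frame_gram = \row_j nth 0 [:: z 0 ct; z 0 cy1; z 0 cy2; z 0 cx1; z 0 cx2] j.
  by apply/rowP => j; rewrite !mxE sum5 !mxE; elim/ord5_ind: j => /=; ring.
by rewrite mxE sum5 !mxE /=; ring.
Qed.

(** * The almost para-cosymplectic axioms for the model *)

Section ModelParacontact.
Context {R : realType}.
Local Notation E := 'rV[R]_5.
Local Notation M := 'M[R]_5.
Variables (sigma : R) (a b p q r s : E -> R) (U : set E) (S : pcstruct R 4).
Hypothesis H : framed sigma a b p q r s U S.
Let oU := fr_open H. Let sa := fr_a H. Let sb := fr_b H. Let sr := fr_r H.
Let ss := fr_s H. Let dt := fr_dt H. Let dy1 := fr_dy1 H. Let dy2 := fr_dy2 H.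
Let HS := fr_S H.
Local Notation cof := (cof a b p q r s).

Lemma cof_col0 x v : (v *m cof x : E) 0 ct = v 0 ct.
Proof. by rewrite mxE sum5 !mxE /=; ring. Qed.

Lemma cof_col1 x v : (v *m cof x : E) 0 cx1 = v 0 cx1.
Proof. by rewrite mxE sum5 !mxE /=; ring. Qed.

Lemma cof_col2 x v : (v *m cof x : E) 0 cx2 = v 0 cx2.
Proof. by rewrite mxE sum5 !mxE /=; ring. Qed.

Lemma cof_row0 x : (delta_mx 0 ct : E) *m cof x = delta_mx 0 ct.
Proof. by rewrite -rowE; apply/rowP; elim/ord5_ind; rewrite !mxE. Qed.

Lemma bil_cof x v w : U x -> bil (met S x) v w = bil frame_gram (v *m cof x) (w *m cof x).
Proof. by move=> Ux; have [_ _ _ ->] := HS Ux; rewrite /bil trmx_mul !mulmxA. Qed.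

Lemma smooth_met : smooth_mx U (met S).
Proof.
have E0 x : U x -> cof x *m frame_gram *m (cof x)^T = met S x by move=> /HS[].
have scof := smooth_cof H.
exact: (smooth_mx_eq oU E0 (smooth_mxM oU (smooth_mxM oU scof (smooth_mx_cst _ oU)) (smooth_mxT scof))).
Qed.

Lemma model_paracontact : almost_paracontact_metric U S.
Proof.
have d0 := smooth_mx_cst (delta_mx 0 ct : E) oU.
split.
- exact: (smooth_phi H).
- by apply: (smooth_mx_eq oU _ d0) => x /HS[].
- by apply: (smooth_mx_eq oU _ d0) => x /HS[].
- split; first exact: smooth_met.
  by move=> x Ux; split; [exact: (met_sym H Ux)|exact: (met_unit H Ux)].
move=> x Ux v w; have [xiE etaE phiE metE] := HS Ux.
have pc (y : E) : y *m phi S x *m cof x = y *m cof x *m frame_phi.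
  by rewrite -!mulmxA phiE.
rewrite xiE etaE !ev_delta !(bil_cof _ _ Ux) !pc cof_row0; split.
- apply: (cof_inj H Ux); rewrite !pc mulmxBl -scalemxAl cof_row0 -(cof_col0 x v).
  move: (v *m cof x) => z; apply/rowP => k; rewrite [LHS]mxE sum5 ![in LHS]mxE !sum5 !mxE.
  by elim/ord5_ind: k => /=; ring.
- by rewrite mxE.
- rewrite !bil_gram -(cof_col0 x v) -(cof_col0 x w).
  move: (v *m cof x) (w *m cof x) => z z'; rewrite !mxE !sum5 !mxE /=; ring.
- by rewrite bil_gram -(cof_col0 x v) !mxE /=; ring.
Qed.

(** The entries [p] and [q] cancel, and what remains is [a dx1 /\ dy1 - b dx2 /\ dy2 + (r + s) dx1
    /\ dx2]. Closedness thus rests on [d_y1 r = d_x2 a] and [d_y2 s = d_x1 b]. *)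
Lemma fundE x : U x -> fund_form S x = mxs
  [:: [:: 0; 0; 0; 0; 0]; [:: 0; 0; r x + s x; a x; 0]; [:: 0; - (r x + s x); 0; 0; - b x];
      [:: 0; - a x; 0; 0; 0]; [:: 0; 0; b x; 0; 0]].
Proof.
move=> Ux; have [_ _ phiE metE] := HS Ux.
rewrite /fund_form metE !mulmxA phiE.
have -> : cof x *m frame_phi *m frame_gram = mxs
  [:: [:: 0; 0; 0; 0; 0]; [:: 0; - p x; s x; 1; 0]; [:: 0; - r x; q x; 0; -1];
      [:: 0; - a x; 0; 0; 0]; [:: 0; 0; b x; 0; 0]].
  apply/matrixP => i j; rewrite [LHS]mxE sum5 ![in LHS]mxE !sum5 !mxE.
  by elim/ord5_ind: i; elim/ord5_ind: j => /=; ring.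
apply/matrixP => i j; rewrite [LHS]mxE sum5 !mxE.
by elim/ord5_ind: i; elim/ord5_ind: j => /=; ring.
Qed.

Lemma pd_fund i j k x : U x -> pd i (fun y => fund_form S y j k) x = nth 0 (nth [::]
  [:: [:: 0; 0; 0; 0; 0]; [:: 0; 0; pd i r x + pd i s x; pd i a x; 0];
      [:: 0; - (pd i r x + pd i s x); 0; 0; - pd i b x];
      [:: 0; - pd i a x; 0; 0; 0]; [:: 0; 0; pd i b x; 0; 0]] j) k.
Proof.
move=> Ux.
have -> : pd i (fun y => fund_form S y j k) x = pd i (nth (fun=> 0) (nth [::]
  [:: [:: fun=> 0; fun=> 0; fun=> 0; fun=> 0; fun=> 0]; [:: fun=> 0; fun=> 0; fun x => r x + s x; a; fun=> 0];
      [:: fun=> 0; fun x => - (r x + s x); fun=> 0; fun=> 0; fun x => - b x];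
      [:: fun=> 0; fun x => - a x; fun=> 0; fun=> 0; fun=> 0]; [:: fun=> 0; fun=> 0; b; fun=> 0; fun=> 0]] j) k) x.
  apply: (pd_eq i oU Ux) => y Uy; rewrite fundE // mxE.
  by elim/ord5_ind: j; elim/ord5_ind: k.
have dr := smooth_derivable (i := i) sr Ux; have ds := smooth_derivable (i := i) ss Ux.
have da := smooth_derivable (i := i) sa Ux; have db := smooth_derivable (i := i) sb Ux.
elim/ord5_ind: j; elim/ord5_ind: k; rewrite /nth /= ?pd_cst //.
- exact: (pdD dr ds).
- by rewrite (pdN (drvD dr ds)) (pdD dr ds).
- exact: (pdN db).
- exact: (pdN da).
Qed.

Lemma model_closed x i j k : U x ->
  pd i (fun y => fund_form S y j k) x + pd j (fun y => fund_form S y k i) x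
  + pd k (fun y => fund_form S y i j) x = 0.
Proof.
move=> Ux; rewrite !pd_fund //.
have [t1 t2 t3 t4 [t5 t6]] := dt Ux; have [y1 y2 y3 y4 y5] := dy1 Ux.
have [z1 z2 z3 z4 z5] := dy2 Ux.
by elim/ord5_ind: i; elim/ord5_ind: j; elim/ord5_ind: k;
  rewrite /= ?t1 ?t2 ?t5 ?t6 ?y1 ?y4 ?y5 ?z1 ?z4 ?z5; ring.
Qed.

Lemma model_weakly : weakly_para_cosymplectic U S.
Proof.
split; last by move=> X Y Z sX sY sZ x Ux; exact: (model_curv_phi H sX sY sZ Ux).
split; first exact: model_paracontact.
  move=> x Ux i j; rewrite /ext_d.
  have e i' j' : pd i' (fun y => Defs.eta S y 0 j') x = 0.
    rewrite -(pd_cst ((delta_mx 0 ct : E) 0 j') x i').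
    by apply: (pd_eq i' oU Ux) => y /HS[_ ->].
  by rewrite !e subrr.
by move=> x Ux i j k; exact: model_closed.
Qed.

End ModelParacontact.

(** * The contact condition as a determinant *)

Section ContactSum.
Context {R : realType}.

Definition rows5 (f0 f1 f2 f3 f4 : 'I_5 -> R) : 'M[R]_5 :=
  \matrix_(i < 5, j < 5) nth (fun=> 0) [:: f0; f1; f2; f3; f4] i j.

Lemma det_rows5 f0 f1 f2 f3 f4 : \det (rows5 f0 f1 f2 f3 f4) =
  \sum_(s : 'S_5) (-1) ^+ s * (f0 (s ct) * f1 (s cx1) * f2 (s cx2) * f3 (s cy1) * f4 (s cy2)).
Proof.
apply: eq_bigr => s _; congr (_ * _); rewrite !big_ord_recl big_ord0 mulr1 !mxE /= !mulrA.
by do !congr (_ * _); congr (_ (s _)); apply: val_inj.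
Qed.

Lemma rows5_rep f0 f1 f2 : \det (rows5 f0 f1 f2 f1 f2) = 0.
Proof. by apply: (@determinant_alternate _ _ _ cx1 cy1) => // j; rewrite !mxE. Qed.

Lemma rows5_tperm (i j : 'I_5) (A : 'M[R]_5) : i != j ->
  \det (row_perm (tperm i j) A) = - \det A.
Proof. by move=> ij; rewrite row_permE det_mulmx det_perm odd_tperm ij mulN1r. Qed.

Lemma rows5_swap12 f0 f1 f2 f3 f4 :
  \det (rows5 f0 f2 f1 f3 f4) = - \det (rows5 f0 f1 f2 f3 f4).
Proof.
rewrite -(@rows5_tperm cx1 cx2) //; congr (\det _); apply/matrixP => i j; rewrite !mxE permE /=.
by elim/ord5_ind: i.
Qed.

Lemma rows5_swap34 f0 f1 f2 f3 f4 :
  \det (rows5 f0 f1 f2 f4 f3) = - \det (rows5 f0 f1 f2 f3 f4).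
Proof.
rewrite -(@rows5_tperm cy1 cy2) //; congr (\det _); apply/matrixP => i j; rewrite !mxE permE /=.
by elim/ord5_ind: i.
Qed.

Lemma rows5_swap23 f0 f1 f2 f3 f4 :
  \det (rows5 f0 f1 f3 f2 f4) = - \det (rows5 f0 f1 f2 f3 f4).
Proof.
rewrite -(@rows5_tperm cx2 cy1) //; congr (\det _); apply/matrixP => i j; rewrite !mxE permE /=.
by elim/ord5_ind: i.
Qed.

(** The two factors [D], of four terms each, expand the sum into sixteen determinants. The eight
    that use one pair twice have repeated rows and vanish; the other eight agree up to sign with the
    one displayed. *)
Lemma contact_sum (al p1 x1 p2 x2 : 'I_5 -> R) (D : 'I_5 -> 'I_5 -> R) :
  (forall i j, D i j = p1 i * x1 j - p1 j * x1 i + (p2 i * x2 j - p2 j * x2 i)) ->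
  \sum_(s : 'S_5) (-1) ^+ s * al (s ct) * D (s cx1) (s cx2) * D (s cy1) (s cy2)
  = 8 * \det (rows5 al p1 x1 p2 x2).
Proof.
move=> DE.
pose T f1 f2 f3 f4 := \det (rows5 al f1 f2 f3 f4).
have s12 f1 f2 f3 f4 : T f2 f1 f3 f4 = - T f1 f2 f3 f4 by exact: rows5_swap12.
have s34 f1 f2 f3 f4 : T f1 f2 f4 f3 = - T f1 f2 f3 f4 by exact: rows5_swap34.
have s23 f1 f2 f3 f4 : T f1 f3 f2 f4 = - T f1 f2 f3 f4 by exact: rows5_swap23.
have rep f1 f2 : T f1 f2 f1 f2 = 0 by exact: rows5_rep.
have -> : \sum_(s : 'S_5) (-1) ^+ s * al (s ct) * D (s cx1) (s cx2) * D (s cy1) (s cy2) =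
  T p1 x1 p1 x1 - T p1 x1 x1 p1 + (T p1 x1 p2 x2 - T p1 x1 x2 p2)
  - (T x1 p1 p1 x1 - T x1 p1 x1 p1 + (T x1 p1 p2 x2 - T x1 p1 x2 p2))
  + (T p2 x2 p1 x1 - T p2 x2 x1 p1 + (T p2 x2 p2 x2 - T p2 x2 x2 p2)
  - (T x2 p2 p1 x1 - T x2 p2 x1 p1 + (T x2 p2 p2 x2 - T x2 p2 x2 p2))).
  rewrite /T !det_rows5; do 8 rewrite -?sumrB -?big_split /=.
  apply: eq_bigr => s _; rewrite !DE.
  move: ((-1) ^+ s) (al (s ct)) (p1 (s cx1)) (p1 (s cx2)) (p1 (s cy1)) (p1 (s cy2))
    (p2 (s cx1)) (p2 (s cx2)) (p2 (s cy1)) (p2 (s cy2)) (x1 (s cx1)) (x1 (s cx2)) (x1 (s cy1))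
    (x1 (s cy2)) (x2 (s cx1)) (x2 (s cx2)) (x2 (s cy1)) (x2 (s cy2)) =>
    e a00 a1 a2 a3 a4 b1 b2 b3 b4 c1 c2 c3 c4 d1 d2 d3 d4.
  by ring.
have e1 : T p2 x2 p1 x1 = T p1 x1 p2 x2.
  by rewrite (s23 p2 p1 x2 x1) (s12 p1 p2 x2 x1) (s34 p1 p2 x1 x2) (s23 p1 p2 x1 x2) !opprK.
rewrite !(s34 _ _ p1 x1) !(s34 _ _ p2 x2) !(s12 p1 x1) !(s12 p2 x2) !rep e1 /T; ring.
Qed.

End ContactSum.

Lemma nabla_near {R : realType} {n} (g : 'rV[R]_n.+1 -> 'M[R]_n.+1) X Y Y' x :
  (\forall y \near x, Y y = Y' y) -> nabla g X Y x = nabla g X Y' x.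
Proof.
move=> YY; rewrite /nabla (near_eq_derive _ YY); congr (_ + _).
by rewrite (nbhs_singleton YY).
Qed.

(** * Adapted pairs and Ricci potential of the model *)

Section ModelPotential.
Context {R : realType}.
Local Notation E := 'rV[R]_5.
Local Notation M := 'M[R]_5.
Variables (sigma : R) (a b p q r s : E -> R) (U : set E) (S : pcstruct R 4).
Hypothesis H : framed sigma a b p q r s U S.
Let oU := fr_open H. Let HS := fr_S H.
Local Notation cof := (cof a b p q r s).
Local Notation fra := (fra a b p q r s).
Local Notation w1 := (w1 p r).
Local Notation w2 := (w2 q s).
Local Notation Om := (Om sigma p q r s).

(** With [e4], the frame vectors dual to the last two forms of the coframe: null eigenvectors of
    [phi] for -1 and 1, which will be [V1] and [V2]. *)
Definition e3 (x : E) : E := delta_mx 0 cy1 *m fra x.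
Definition e4 (x : E) : E := delta_mx 0 cy2 *m fra x.

Lemma smooth_e3 : smooth_mx U e3.
Proof. exact: (smooth_mxM oU (smooth_mx_cst _ oU) (smooth_fra H)). Qed.

Lemma smooth_e4 : smooth_mx U e4.
Proof. exact: (smooth_mxM oU (smooth_mx_cst _ oU) (smooth_fra H)). Qed.

Lemma e3_cof x : U x -> e3 x *m cof x = delta_mx 0 cy1.
Proof. by move=> Ux; rewrite /e3 -mulmxA (fra_cof H Ux) mulmx1. Qed.

Lemma e4_cof x : U x -> e4 x *m cof x = delta_mx 0 cy2.
Proof. by move=> Ux; rewrite /e4 -mulmxA (fra_cof H Ux) mulmx1. Qed.

Lemma nabla_const X V (z : E) x : U x -> smooth_mx U V -> (forall y, U y -> V y *m cof y = z) ->
  nabla (met S) X V x *m cof x =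
  X x 0 cx1 *: (z *m conn1 (x 0 cy1) (w1 x)) + X x 0 cx2 *: (z *m conn2 sigma (x 0 cy2) (w2 x)).
Proof.
move=> Ux sV VE; rewrite (model_nabla_frame H X Ux sV) sum5 /covd.
have e i : pdmx i (fun y => V y *m cof y) x = 0.
  by rewrite (pdmx_eq i oU Ux VE) pdmx_cst.
by rewrite !e !add0r (VE _ Ux) /Om /= !mulmx0 !scaler0 !addr0 add0r.
Qed.

Lemma model_shape x v : U x -> Defs.shape S x v = v 0 cx1 *: e3 x + (sigma * v 0 cx2) *: e4 x.
Proof.
move=> Ux; apply: (cof_inj H Ux); rewrite mulmxDl -!scalemxAl e3_cof // e4_cof //.
have sxi : smooth_mx U (xi S) by have [_ ? _ _ _] := model_paracontact H.
have xic y : U y -> xi S y *m cof y = delta_mx 0 ct.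
  by move=> Uy; have [-> _ _ _] := HS Uy; exact: cof_row0.
rewrite /Defs.shape mulNmx (nabla_const _ Ux sxi xic) -!rowE.
by apply/rowP; elim/ord5_ind; rewrite !mxE /=; ring.
Qed.

Lemma bil_e3 x v : U x -> bil (met S x) v (e3 x) = v 0 cx1.
Proof.
move=> Ux; rewrite (bil_cof H _ _ Ux) e3_cof // bil_gram -(cof_col1 a b p q r s x v) !mxE /=; ring.
Qed.

Lemma bil_e4 x v : U x -> bil (met S x) v (e4 x) = v 0 cx2.
Proof.
move=> Ux; rewrite (bil_cof H _ _ Ux) e4_cof // bil_gram -(cof_col2 a b p q r s x v) !mxE /=; ring.
Qed.

Lemma model_adapted : adapted_pair S sigma U e3 e4.
Proof.
split; [exact: oU|exact: smooth_e3|exact: smooth_e4|].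
move=> x Ux; have [_ _ phiE _] := HS Ux; split.
- have d (i : 'I_5) : (delta_mx 0 i : E) != 0.
    by apply/eqP => /rowP /(_ i) /eqP; rewrite !mxE !eqxx oner_eq0.
  split; apply/eqP => e0.
    by have := e3_cof Ux; rewrite e0 mul0mx => /esym/eqP; rewrite (negPf (d _)).
  by have := e4_cof Ux; rewrite e0 mul0mx => /esym/eqP; rewrite (negPf (d _)).
- apply: (cof_inj H Ux); rewrite -mulmxA phiE mulmxA mulNmx e3_cof // -rowE.
  by apply/rowP; elim/ord5_ind; rewrite !mxE /= ?oppr0.
- apply: (cof_inj H Ux); rewrite -mulmxA phiE mulmxA e4_cof // -rowE.
  by apply/rowP; elim/ord5_ind; rewrite !mxE /=.
- by rewrite bil_e4 // -(cof_col2 a b p q r s x) e3_cof // mxE.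
- by move=> v; rewrite bil_e3 // bil_e4 // model_shape.
Qed.

(** Any adapted pair represents the same operator [A] as [e3], [e4]. The eigenvalue conditions leave
    to [V1] the components [cx2], [cy1] and to [V2] the components [cx1], [cy2]; evaluating [A] on
    the frame vectors [cx1] and [cx2] makes the squares of [cy1] and [cy2] equal to 1 and the other
    components zero. *)
Lemma adapted_unique W V1 V2 x : W `<=` U -> adapted_pair S sigma W V1 V2 -> W x ->
  sigma != 0 ->
  exists s1 s2 : R, [/\ s1 = 1 \/ s1 = -1, s2 = 1 \/ s2 = -1,
    V1 x *m cof x = s1 *: delta_mx 0 cy1 & V2 x *m cof x = s2 *: delta_mx 0 cy2].
Proof.
move=> WU [_ _ _ /(_ x) Hx] Wx sg0; have Ux := WU _ Wx.
have [_ V1p V2p _ sh] := Hx Wx; have [_ _ phiE _] := HS Ux.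
have zD : V1 x *m cof x *m frame_phi = - (V1 x *m cof x) by rewrite -mulmxA -phiE mulmxA V1p mulNmx.
have zD' : V2 x *m cof x *m frame_phi = V2 x *m cof x by rewrite -mulmxA -phiE mulmxA V2p.
have key (w : E) : w 0 cx1 *: delta_mx 0 cy1 + (sigma * w 0 cx2) *: delta_mx 0 cy2 =
   bil frame_gram w (V1 x *m cof x) *: (V1 x *m cof x)
   + (sigma * bil frame_gram w (V2 x *m cof x)) *: (V2 x *m cof x).
  have := sh (w *m fra x); rewrite model_shape // => /(congr1 (mulmx^~ (cof x))).
  rewrite !mulmxDl -!scalemxAl e3_cof // e4_cof // !(bil_cof H _ _ Ux).
  rewrite -!mulmxA (fra_cof H Ux) !mulmx1.
  by rewrite -(cof_col1 a b p q r s x) -(cof_col2 a b p q r s x) -!mulmxA (fra_cof H Ux) !mulmx1.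
move: zD zD' key; move: (V1 x *m cof x) (V2 x *m cof x) => z z' zD zD' key.
have gE (y : E) : y *m frame_phi = \row_j nth 0 [:: 0; y 0 cx1; - y 0 cx2; - y 0 cy1; y 0 cy2] j.
  by apply/rowP => j; rewrite !mxE sum5 !mxE; elim/ord5_ind: j => /=; ring.
rewrite !gE in zD zD'.
have z0 : z 0 ct = 0 by move/rowP/(_ ct): zD; rewrite !mxE /=; lra.
have z1 : z 0 cx1 = 0 by move/rowP/(_ cx1): zD; rewrite !mxE /=; lra.
have z4 : z 0 cy2 = 0 by move/rowP/(_ cy2): zD; rewrite !mxE /=; lra.
have z0' : z' 0 ct = 0 by move/rowP/(_ ct): zD'; rewrite !mxE /=; lra.
have z2' : z' 0 cx2 = 0 by move/rowP/(_ cx2): zD'; rewrite !mxE /=; lra.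
have z3' : z' 0 cy1 = 0 by move/rowP/(_ cy1): zD'; rewrite !mxE /=; lra.
have k1 j := congr1 (fun w : E => w 0 j) (key (delta_mx 0 cx1)).
have k2 j := congr1 (fun w : E => w 0 j) (key (delta_mx 0 cx2)).
have a3 : z 0 cy1 * z 0 cy1 = 1.
  by have := k1 cy1; rewrite /= !bil_gram !mxE /= z1 z4 z0 z0' z2' z3'; lra.
have a2 : z 0 cy1 * z 0 cx2 = 0.
  by have := k1 cx2; rewrite /= !bil_gram !mxE /= z1 z4 z0 z0' z2' z3'; lra.
have a4 : sigma * z' 0 cy2 * z' 0 cy2 = sigma.
  by have := k2 cy2; rewrite /= !bil_gram !mxE /= z1 z4 z0 z0' z2' z3'; lra.
have a1 : sigma * z' 0 cy2 * z' 0 cx1 = 0.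
  by have := k2 cx1; rewrite /= !bil_gram !mxE /= z1 z4 z0 z0' z2' z3'; lra.
have pm (c : R) : c * c = 1 -> c = 1 \/ c = -1.
  move=> c1; have /eqP : (c - 1) * (c + 1) = 0 by rewrite -subr_sqr -expr2 in c1 *; rewrite expr1n; lra.
  by rewrite mulf_eq0 => /orP[/eqP|/eqP] h; [left|right]; lra.
have b4 : z' 0 cy2 * z' 0 cy2 = 1.
  by apply: (mulfI sg0); rewrite mulrA a4 mulr1.
have z30 : z 0 cy1 != 0 by apply/eqP => e; move: a3; rewrite e mul0r => /esym/eqP; rewrite oner_eq0.
have z40 : z' 0 cy2 != 0 by apply/eqP => e; move: b4; rewrite e mul0r => /esym/eqP; rewrite oner_eq0.
have z2 : z 0 cx2 = 0 by move/eqP: a2; rewrite mulf_eq0 (negPf z30) => /eqP.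
have z1' : z' 0 cx1 = 0.
  by move/eqP: a1; rewrite !mulf_eq0 (negPf z40) (negPf sg0) => /eqP.
exists (z 0 cy1), (z' 0 cy2); split; [exact: pm|exact: pm| |].
- by apply/rowP; elim/ord5_ind; rewrite !mxE /= ?mulr0 ?mulr1.
- by apply/rowP; elim/ord5_ind; rewrite !mxE /= ?mulr0 ?mulr1.
Qed.

Lemma sign_const (W : set E) (f : E -> R) x : open W -> W x -> {for x, continuous f} ->
  (forall y, W y -> f y = 1 \/ f y = -1) -> \forall y \near x, f y = f x.
Proof.
move=> oW Wx cf fpm.
have h0 : 0 < 1 / 2 :> R by rewrite divr_gt0.
have nW : nbhs x W := open_nbhs_nbhs (conj oW Wx).
move/cvgrPdist_le : cf => /(_ _ h0) nf.
apply: (@filterS _ (nbhs x) _) (filterI nW nf) => y [Wy] /=.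
have [-> | ->] := fpm _ Wx; have [-> // | -> //] := fpm _ Wy; rewrite ?opprK ler_norml => /andP[h1 h2]; lra.
Qed.

Definition tau1m (x : E) : E := - x 0 cy1 *: delta_mx 0 cx1.
Definition tau2m (x : E) : E := x 0 cy2 *: delta_mx 0 cx2.

(** The sign relating [V_i] to the frame vector is continuous with values 1 and -1, hence constant
    near [x] by [sign_const]. So [V_i] has locally constant frame components and its derivative is a
    row of [conn1] or [conn2]. *)
Lemma adapted_nabla W V1 V2 x v : sigma != 0 -> W `<=` U -> adapted_pair S sigma W V1 V2 -> W x ->
  nabla (met S) (fun=> v) V1 x = ev (tau1m x) v *: V1 x /\
  nabla (met S) (fun=> v) V2 x = ev (tau2m x) v *: V2 x.
Proof.
move=> sg0 WU ad Wx; have Ux := WU _ Wx.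
have [oW sV1 sV2 _] := ad.
have scof := smooth_mxS WU (smooth_cof H).
have evE (c : R) (i : 'I_5) : ev (c *: delta_mx 0 i) v = c * v 0 i.
  by rewrite -(ev_delta i v) /ev linearZ /= -scalemxAr mxE.
have main (V : E -> E) (k : 'I_5) : smooth_mx W V ->
    (forall y, W y -> exists2 c : R, c = 1 \/ c = -1 & V y *m cof y = c *: delta_mx 0 k) ->
    exists2 c : R, V x *m cof x = c *: delta_mx 0 k &
      nabla (met S) (fun=> v) V x *m cof x =
      c *: (v 0 cx1 *: (delta_mx 0 k *m conn1 (x 0 cy1) (w1 x)) +
         v 0 cx2 *: (delta_mx 0 k *m conn2 sigma (x 0 cy2) (w2 x)) : E).
  move=> sV VE.
  pose f y := (V y *m cof y) 0 k.
  have fE y : W y -> V y *m cof y = f y *: delta_mx 0 k /\ (f y = 1 \/ f y = -1).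
    by move=> Wy; rewrite /f; have [c c1 ->] := VE _ Wy; rewrite !mxE !eqxx mulr1.
  have sf : smooth W f := smooth_entry (smooth_mxM oW sV scof) 0 k.
  have nf := sign_const oW Wx (smooth_continuous sf Wx) (fun y Wy => (fE y Wy).2).
  pose Y (y : E) : E := (f x *: delta_mx 0 k) *m fra y.
  have sY : smooth_mx U Y := smooth_mxM oU (smooth_mx_cst _ oU) (smooth_fra H).
  have YE y : U y -> Y y *m cof y = f x *: delta_mx 0 k.
    by move=> Uy; rewrite /Y -mulmxA (fra_cof H Uy) mulmx1.
  have nW : nbhs x W := open_nbhs_nbhs (conj oW Wx).
  have VY : \forall y \near x, V y = Y y.
    apply: (@filterS _ (nbhs x) _) (filterI nW nf) => y [Wy fy].
    by apply: (cof_inj H (WU _ Wy)); rewrite YE ?(fE _ Wy).1 ?fy //; exact: WU.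
  exists (f x); first by have [] := fE _ Wx.
  rewrite (nabla_near _ _ VY) (nabla_const _ Ux sY YE) -!scalemxAl scalerDr !scalerA.
  by rewrite ![f x * _]mulrC.
have [|c1 E1 N1] := main V1 cy1 sV1.
  by move=> y Wy; have [c1 [c2 [? _ ? _]]] := adapted_unique WU ad Wy sg0; exists c1.
have [|c2 E2 N2] := main V2 cy2 sV2.
  by move=> y Wy; have [c1' [c2 [_ ? _ ?]]] := adapted_unique WU ad Wy sg0; exists c2.
split; apply: (cof_inj H Ux); rewrite -scalemxAl.
  rewrite N1 E1 /tau1m evE -!rowE; apply/rowP; elim/ord5_ind; rewrite !mxE /=; ring.
rewrite N2 E2 /tau2m evE -!rowE; apply/rowP; elim/ord5_ind; rewrite !mxE /=; ring.
Qed.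

Lemma model_tau : sigma != 0 -> tau_forms sigma U S tau1m tau2m.
Proof.
move=> sg0; split.
- apply: (smooth_mxZ oU (smoothN oU (smooth_coord cy1 oU)) (smooth_mx_cst _ oU)).
- exact: (smooth_mxZ oU (smooth_coord cy2 oU) (smooth_mx_cst _ oU)).
- by move=> W V1 V2 WU ad x Wx v; exact: (adapted_nabla v sg0 WU ad Wx).
Qed.

Lemma model_tau_unique tau1 tau2 x : sigma != 0 -> tau_forms sigma U S tau1 tau2 -> U x ->
  tau1 x = tau1m x /\ tau2 x = tau2m x.
Proof.
move=> sg0 [_ _ ta] Ux.
have UU : U `<=` U by [].
have cmp (al be V : E) : V != 0 -> (forall v, ev al v *: V = ev be v *: V) -> al = be.
  move=> V0 h; apply/rowP => i.
  have := h (delta_mx 0 i); rewrite /ev -!rowE !mxE => /eqP.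
  by rewrite -subr_eq0 -scalerBl scaler_eq0 (negPf V0) orbF subr_eq0 => /eqP.
have [_ _ _ /(_ _ Ux) [[n3 n4] _ _ _ _]] := model_adapted.
split.
- apply: (cmp _ _ _ n3) => v; have [<- _] := ta _ _ _ UU model_adapted _ Ux v.
  by have [] := adapted_nabla v sg0 UU model_adapted Ux.
- apply: (cmp _ _ _ n4) => v; have [_ <-] := ta _ _ _ UU model_adapted _ Ux v.
  by have [] := adapted_nabla v sg0 UU model_adapted Ux.
Qed.

Lemma model_potential tau1 tau2 x : sigma != 0 -> tau_forms sigma U S tau1 tau2 -> U x ->
  ricci_potential S tau1 tau2 x = normal_potential x.
Proof.
move=> sg0 ta Ux; have [e1 e2] := model_tau_unique sg0 ta Ux.
have [_ etaE _ _] := HS Ux.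
by rewrite /ricci_potential e1 e2 etaE /normal_potential /tau1m /tau2m scaleNr opprK.
Qed.

Lemma normal_potential_contact : contact_form U (@normal_potential R).
Proof.
split.
  apply: (smooth_mxD oU); last exact: (smooth_mxZ oU (smooth_coord cy2 oU) (smooth_mx_cst _ oU)).
  apply: (smooth_mxD oU); first exact: (smooth_mx_cst _ oU).
  exact: (smooth_mxZ oU (smooth_coord cy1 oU) (smooth_mx_cst _ oU)).
move=> x Ux.
have pdn i j : pd i (fun y => @normal_potential R y 0 j) x =
   (i == cy1)%:R * (j == cx1)%:R + (i == cy2)%:R * (j == cx2)%:R.
  have c1 := smooth_coord cy1 oU; have c2 := smooth_coord cy2 oU.
  have k k' := smooth_cst (k' : R) oU.
  have -> : (fun y => @normal_potential R y 0 j) =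
    (fun y : E => (j == ct)%:R + y 0 cy1 * (j == cx1)%:R + y 0 cy2 * (j == cx2)%:R).
    by apply/funext => y; rewrite !mxE !eqxx.
  have m1 := smoothM oU c1 (k (j == cx1)%:R); have m2 := smoothM oU c2 (k (j == cx2)%:R).
  rewrite (pdD (smooth_derivable (smoothD oU (k (j == ct)%:R) m1) Ux) (smooth_derivable m2 Ux)).
  rewrite (pdD (smooth_derivable (k (j == ct)%:R) Ux) (smooth_derivable m1 Ux)).
  rewrite (pdM (smooth_derivable c1 Ux) (smooth_derivable (k _) Ux)).
  rewrite (pdM (smooth_derivable c2 Ux) (smooth_derivable (k _) Ux)).
  by rewrite !pd_coord !pd_cst !mulr0 !addr0 add0r.
have DE i j : ext_d (@normal_potential R) x i j =
  (fun i => (i == cy1)%:R) i * (fun i => (i == cx1)%:R) j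
  - (fun i => (i == cy1)%:R) j * (fun i => (i == cx1)%:R) i
  + ((fun i => (i == cy2)%:R) i * (fun i => (i == cx2)%:R) j
  - (fun i => (i == cy2)%:R) j * (fun i => (i == cx2)%:R) i).
  by rewrite /ext_d !pdn; ring.
rewrite (@contact_sum _ (fun j => @normal_potential R x 0 j) _ _ _ _ _ DE).
rewrite mulf_neq0 // ?pnatr_eq0 // -unitfE -unitmxE.
(* The explicit inverse of the matrix with rows [dt + y1 dx1 + y2 dx2], [dy1], [dx1], [dy2],
   [dx2]. *)
pose B : M := mxs [:: [:: 1; 0; - x 0 cy1; 0; - x 0 cy2]; [:: 0; 0; 1; 0; 0]; [:: 0; 0; 0; 0; 1];
   [:: 0; 1; 0; 0; 0]; [:: 0; 0; 0; 1; 0]].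
suff AB : rows5 (fun j => @normal_potential R x 0 j) (fun i => (i == cy1)%:R) (fun i => (i == cx1)%:R)
   (fun i => (i == cy2)%:R) (fun i => (i == cx2)%:R) *m B = 1%:M by have [] := mulmx1_unit AB.
apply/matrixP => i j; rewrite [LHS]mxE sum5 !mxE.
by elim/ord5_ind: i; elim/ord5_ind: j; rewrite /= ?mxE /=; ring.
Qed.

Lemma contact_form_eq (al be : E -> E) : (forall x, U x -> be x = al x) ->
  contact_form U al -> contact_form U be.
Proof.
move=> ab [sal cal]; split.
  by apply: (smooth_mx_eq oU _ sal) => x Ux; rewrite ab.
move=> x Ux; move: (cal _ Ux); congr (_ != 0); apply: eq_bigr => si _; rewrite ab //.
have e i j : ext_d be x i j = ext_d al x i j.
  by rewrite /ext_d; congr (_ - _); apply: (pd_eq _ oU Ux) => y Uy; rewrite ab.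
by rewrite !e.
Qed.

Lemma model_contact tau1 tau2 : sigma != 0 -> tau_forms sigma U S tau1 tau2 ->
  contact_form U (ricci_potential S tau1 tau2).
Proof.
move=> sg0 ta; apply: contact_form_eq normal_potential_contact => x Ux.
exact: model_potential.
Qed.

End ModelPotential.

(** * Ricci operator of the model and its eigenvalues *)

Section ModelRicci.
Context {R : realType}.
Local Notation E := 'rV[R]_5.
Local Notation M := 'M[R]_5.
Variables (sigma : R) (a b p q r s : E -> R) (U : set E) (S : pcstruct R 4).
Hypothesis H : framed sigma a b p q r s U S.
Let oU := fr_open H. Let a0 := fr_a0 H. Let b0 := fr_b0 H. Let HS := fr_S H.
Local Notation cof := (cof a b p q r s).
Local Notation fra := (fra a b p q r s).
Local Notation Om := (Om sigma p q r s).

Local Notation e3 := (e3 a b p q r s).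
Local Notation e4 := (e4 a b p q r s).

Lemma fraE x (i j : 'I_5) : fra x i j = nth 0 (nth [::]
  [:: [:: 1; 0; 0; 0; 0]; [:: 0; 1; 0; - p x / a x; - s x / b x];
      [:: 0; 0; 1; - r x / a x; - q x / b x];
      [:: 0; 0; 0; (a x)^-1; 0]; [:: 0; 0; 0; 0; (b x)^-1]] i) j.
Proof. by rewrite mxE. Qed.

(** The Ricci tensor with mixed indices: [l] refers to the frame and [i] to the coordinates. The
    factor [fra x] returns to coordinate components, over which the trace is taken. *)
Definition rictrace x (l i : 'I_5) : R := \sum_k (curvf Om k i x *m fra x) l k.

Lemma ric_const x i j : U x -> ric (met S) (fun=> delta_mx 0 i) (fun=> delta_mx 0 j) x =
  \sum_l cof x j l * rictrace x l i.
Proof.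
move=> Ux; rewrite /ric.
have sd k : smooth_mx U (fun=> delta_mx 0 k : E) := smooth_mx_cst _ oU.
have ck k : curv (met S) (fun=> delta_mx 0 k) (fun=> delta_mx 0 i) (fun=> delta_mx 0 j) x =
    row j (cof x *m curvf Om k i x *m fra x).
  apply: (cof_inj H Ux); rewrite (model_curv_frame H Ux (sd k) (sd i) (sd j)).
  rewrite -row_mul -[_ *m fra x *m cof x]mulmxA (fra_cof H Ux) mulmx1.
  rewrite (bigD1 k) //= (bigD1 i) //= !mxE !eqxx mulr1 scale1r -rowE row_mul.
  rewrite big1 ?addr0 => [|l lk]; last by rewrite !mxE eqxx (negPf lk) mulr0 scale0r.
  rewrite big1 ?addr0 // => l lk; rewrite big1 // => m _.
  by rewrite !mxE eqxx (negPf lk) mul0r scale0r.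
transitivity (\sum_k \sum_l cof x j l * (curvf Om k i x *m fra x) l k).
  by apply: eq_bigr => k _; rewrite ck mxE -mulmxA mxE.
rewrite exchange_big /=; apply: eq_bigr => l _.
by rewrite /rictrace mulr_sumr.
Qed.

Local Notation kp := (kap sigma p q r s).

Lemma curvm_fra x k1 k2 w : U x -> curvm k1 k2 w *m fra x = mxs
  [:: [:: 0; 0; 0; 0; 0]; [:: 0; k1; 0; - k1 * p x / a x; (w - k1 * s x) / b x];
      [:: 0; 0; - k2; (k2 * r x - w) / a x; k2 * q x / b x];
      [:: 0; 0; 0; - k1 / a x; 0]; [:: 0; 0; 0; 0; k2 / b x]].
Proof.
move=> Ux; have a1 := a0 Ux; have b1 := b0 Ux.
apply/matrixP => i j; rewrite [LHS]mxE sum5 !fraE !mxE.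
by elim/ord5_ind: i; elim/ord5_ind: j => /=; field; rewrite ?a1 ?b1.
Qed.

Lemma rictraceE x l i : U x -> rictrace x l i = nth 0
  [:: 0; (i == cx1)%:R * (- p x / a x) - (i == cy1)%:R + kp cy2 i x / b x;
      (i == cx2)%:R * (q x / b x) + (i == cy2)%:R - kp cy1 i x / a x;
      - (i == cx1)%:R / a x; (i == cx2)%:R / b x] l.
Proof.
move=> Ux; have a1 := a0 Ux; have b1 := b0 Ux.
rewrite /rictrace.
under eq_bigr => k _ do rewrite (curvfE H k i Ux) (curvm_fra _ _ _ Ux) mxE.
rewrite sum5 /dx_wedge.
move: (kp ct i x) (kp cx1 i x) (kp cx2 i x) (kp cy1 i x) (kp cy2 i x) => k1 k2 k3 k4 k5.
elim/ord5_ind: l; elim/ord5_ind: i => /=; by field; rewrite ?a1 ?b1.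
Qed.

Lemma kp0 x i k : i != cx1 -> i != cx2 -> k != cx1 -> k != cx2 -> kp i k x = 0.
Proof.
move=> i1 i2 k1 k2.
by rewrite /kap (negPf i1) (negPf i2) (negPf k1) (negPf k2) !mul0r !addr0 subr0 mul0r addr0.
Qed.

Lemma invmx_met x : U x -> invmx (met S x) = (fra x)^T *m frame_gram *m fra x.
Proof.
move=> Ux; have E1 : (cof x)^T *m (fra x)^T = 1%:M by rewrite -trmx_mul (fra_cof H Ux) trmx1.
have E2 : met S x *m ((fra x)^T *m frame_gram *m fra x) = 1%:M.
  have [_ _ _ ->] := HS Ux.
  rewrite -!mulmxA [(cof x)^T *m (_ *m _)]mulmxA E1 mul1mx [frame_gram *m (_ *m _)]mulmxA.
  by rewrite frame_gramK mul1mx (cof_fra H Ux).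
have := congr1 (mulmx (invmx (met S x))) E2.
by rewrite !mulmxA (mulVmx (met_unit H Ux)) mul1mx mulmx1 => ->.
Qed.

(** The corner [k1], ..., [k4] contains the derivatives of [w1] and [w2] and is left unevaluated:
    the matrix is triangular, so the eigenvalues and the action on [e3], [e4] do not involve it. *)
Lemma ricci_frame x : U x -> exists k1 k2 k3 k4 : R, fra x *m ricci_op (met S) x *m cof x = mxs
  [:: [:: 0; 0; 0; 0; 0]; [:: 0; - (a x)^-1; 0; k1; k2]; [:: 0; 0; (b x)^-1; k3; k4];
      [:: 0; 0; 0; - (a x)^-1; 0]; [:: 0; 0; 0; 0; (b x)^-1]].
Proof.
move=> Ux; have a1 := a0 Ux; have b1 := b0 Ux.
pose rf (i j : 'I_5) := \sum_k fra x i k * rictrace x j k.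
exists (rf cx1 cx1), (rf cx1 cx2), (rf cx2 cx1), (rf cx2 cx2).
have -> : fra x *m ricci_op (met S) x *m cof x = \matrix_(i, j) rf i j *m frame_gram.
  rewrite /ricci_op invmx_met // !mulmxA -[_ *m fra x *m cof x]mulmxA (fra_cof H Ux) mulmx1.
  congr (_ *m _).
  have -> : \matrix_(i, j) ric (met S) (fun=> delta_mx 0 i) (fun=> delta_mx 0 j) x =
     (\matrix_(i, l) rictrace x l i) *m (cof x)^T.
    apply/matrixP => i j; rewrite !mxE ric_const //; apply: eq_bigr => l _.
    by rewrite mulrC !mxE.
  rewrite -!mulmxA -trmx_mul (fra_cof H Ux) trmx1 mulmx1.
  apply/matrixP => i j; rewrite [LHS]mxE [RHS]mxE; apply: eq_bigr => k _.
  by rewrite [X in _ * X]mxE.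
have gc (A : M) : A *m frame_gram = \matrix_(i, j)
    nth 0 [:: A i ct; A i cy1; A i cy2; A i cx1; A i cx2] j.
  by apply/matrixP => i j; rewrite !mxE sum5 !mxE; elim/ord5_ind: j => /=; ring.
rewrite gc; apply/matrixP => i j; rewrite [LHS]mxE [RHS]mxE ![in LHS]mxE.
have k1 : kp cy1 ct x = 0 by exact: kp0.
have k2 : kp cy1 cy1 x = 0 by exact: kp0.
have k3 : kp cy1 cy2 x = 0 by exact: kp0.
have k4 : kp cy2 ct x = 0 by exact: kp0.
have k5 : kp cy2 cy1 x = 0 by exact: kp0.
have k6 : kp cy2 cy2 x = 0 by exact: kp0.
have rfE m l : rf m l = \sum_(k : 'I_5) nth 0 (nth [::]
  [:: [:: 1; 0; 0; 0; 0]; [:: 0; 1; 0; - p x / a x; - s x / b x];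
      [:: 0; 0; 1; - r x / a x; - q x / b x];
      [:: 0; 0; 0; (a x)^-1; 0]; [:: 0; 0; 0; 0; (b x)^-1]] m) k * nth 0
  [:: 0; (k == cx1)%:R * (- p x / a x) - (k == cy1)%:R + kp cy2 k x / b x;
      (k == cx2)%:R * (q x / b x) + (k == cy2)%:R - kp cy1 k x / a x;
      - (k == cx1)%:R / a x; (k == cx2)%:R / b x] l.
  by apply: eq_bigr => k _; rewrite fraE (rictraceE _ _ Ux).
elim/ord5_ind: i; elim/ord5_ind: j; rewrite [LHS]/= [RHS]/= //;
  rewrite rfE sum5 /= ?k1 ?k2 ?k3 ?k4 ?k5 ?k6; by field; rewrite ?a1 ?b1.
Qed.

Lemma ricci_e3 x : U x -> e3 x *m ricci_op (met S) x = - (a x)^-1 *: e3 x.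
Proof.
move=> Ux; apply: (cof_inj H Ux); have [k1 [k2 [k3 [k4 E0]]]] := ricci_frame Ux.
have -> : e3 x *m ricci_op (met S) x *m cof x = delta_mx 0 cy1 *m (fra x *m ricci_op (met S) x *m cof x).
  by rewrite !mulmxA.
rewrite -scalemxAl (e3_cof H Ux) E0 -rowE.
by apply/rowP; elim/ord5_ind; rewrite !mxE /= ?mulr0 ?mulr1.
Qed.

Lemma ricci_e4 x : U x -> e4 x *m ricci_op (met S) x = (b x)^-1 *: e4 x.
Proof.
move=> Ux; apply: (cof_inj H Ux); have [k1 [k2 [k3 [k4 E0]]]] := ricci_frame Ux.
have -> : e4 x *m ricci_op (met S) x *m cof x = delta_mx 0 cy2 *m (fra x *m ricci_op (met S) x *m cof x).
  by rewrite !mulmxA.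
rewrite -scalemxAl (e4_cof H Ux) E0 -rowE.
by apply/rowP; elim/ord5_ind; rewrite !mxE /= ?mulr0 ?mulr1.
Qed.

Lemma ricci_eigen x c : U x ->
  eigenvalue (ricci_op (met S) x) c <-> [\/ c = 0, c = - (a x)^-1 | c = (b x)^-1].
Proof.
move=> Ux; have [k1 [k2 [k3 [k4 E0]]]] := ricci_frame Ux; split.
  move=> /eigenvalueP[v vE v0].
  pose z := v *m cof x.
  have zE : z *m (fra x *m ricci_op (met S) x *m cof x) = c *: z.
    rewrite /z scalemxAl -vE; move: (ricci_op (met S) x) => Q.
    by rewrite !mulmxA -[v *m cof x *m fra x]mulmxA (cof_fra H Ux) mulmx1.
  have z0 : z != 0.
    by apply: contraNneq v0 => z0; rewrite -[v]mulmx1 -(cof_fra H Ux) mulmxA -/z z0 mul0mx.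
  clearbody z; rewrite E0 in zE.
  have ent j := congr1 (fun w : E => w 0 j) zE.
  have [h0|c0] := eqVneq c 0; first by constructor 1.
  have [h0|ca] := eqVneq c (- (a x)^-1); first by constructor 2.
  have [h0|cb] := eqVneq c (b x)^-1; first by constructor 3.
  (* Elimination along the triangular shape: the components [ct], [cx1], [cx2] satisfy one equation
     each, and once they vanish so do [cy1] and [cy2]. *)
  have can d y : c != d -> (c - d) * y = 0 -> y = 0.
    by move=> cd /eqP; rewrite mulf_eq0 subr_eq0 (negPf cd) => /eqP.
  have y0 : z 0 ct = 0.
    by apply: (can 0) => //; have := ent ct; rewrite !mxE sum5 !mxE /=; lra.
  have y1 : z 0 cx1 = 0.
    by apply: (can _ _ ca); have := ent cx1; rewrite !mxE sum5 !mxE /=; lra.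
  have y2 : z 0 cx2 = 0.
    by apply: (can _ _ cb); have := ent cx2; rewrite !mxE sum5 !mxE /=; lra.
  have y3 : z 0 cy1 = 0.
    by apply: (can _ _ ca); have := ent cy1; rewrite !mxE sum5 !mxE /= y1 y2; lra.
  have y4 : z 0 cy2 = 0.
    by apply: (can _ _ cb); have := ent cy2; rewrite !mxE sum5 !mxE /= y1 y2; lra.
  by case/eqP: z0; apply/rowP; elim/ord5_ind; rewrite mxE.
have nz (k : 'I_5) : (delta_mx 0 k : E) *m fra x != 0.
  apply/eqP => e0; have : (delta_mx 0 k : E) *m fra x *m cof x = 0 by rewrite e0 mul0mx.
  rewrite -mulmxA (fra_cof H Ux) mulmx1 => /rowP /(_ k) /eqP.
  by rewrite !mxE !eqxx oner_eq0.
move=> h; apply/eigenvalueP; case: h => ->.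
- exists (delta_mx 0 ct *m fra x); last exact: nz.
  rewrite scale0r; apply: (cof_inj H Ux); rewrite mul0mx.
  have -> : (delta_mx 0 ct : E) *m fra x *m ricci_op (met S) x *m cof x =
      (delta_mx 0 ct : E) *m (fra x *m ricci_op (met S) x *m cof x).
    by move: (ricci_op (met S) x) => Q; rewrite !mulmxA.
  by rewrite E0 -rowE; apply/rowP; elim/ord5_ind; rewrite !mxE.
- exists (e3 x); [exact: ricci_e3 | exact: nz].
- exists (e4 x); [exact: ricci_e4 | exact: nz].
Qed.

Lemma ricci_adapted W V1 V2 x : sigma != 0 -> W `<=` U -> adapted_pair S sigma W V1 V2 -> W x ->
  V1 x *m ricci_op (met S) x = - (a x)^-1 *: V1 x /\
  V2 x *m ricci_op (met S) x = (b x)^-1 *: V2 x.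
Proof.
move=> sg0 WU ad Wx; have Ux := WU _ Wx.
have [c1 [c2 [_ _ E1 E2]]] := adapted_unique H WU ad Wx sg0.
have -> : V1 x = c1 *: e3 x.
  by apply: (cof_inj H Ux); rewrite E1 -scalemxAl (e3_cof H Ux).
have -> : V2 x = c2 *: e4 x.
  by apply: (cof_inj H Ux); rewrite E2 -scalemxAl (e4_cof H Ux).
by rewrite -!scalemxAl ricci_e3 // ricci_e4 // !scalerA ![c1 * _]mulrC ![c2 * _]mulrC.
Qed.

End ModelRicci.

(** * The leaves of the model and their induced structure *)

Section Selection.
Context {R : realType}.
Local Notation M := 'M[R]_5.

(** Right multiplication by [sel] deletes the component [ct]; by [sel_selT], deleting and restoring
    it costs only the [ct] projection. *)
Definition sel : 'M[R]_(5, 4) := \matrix_(i < 5, j < 4) (i == lift ord0 j)%:R.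

Lemma sel_lift (k : 'I_4) j : sel (lift ord0 k) j = (k == j)%:R.
Proof. by rewrite mxE (inj_eq lift_inj). Qed.

Lemma sel_ct j : sel ct j = 0.
Proof. by rewrite mxE; case: eqP => // /(congr1 val). Qed.

Lemma mul_sel p (A : 'M[R]_(p, 5)) : A *m sel = \matrix_(i, j) A i (lift ord0 j).
Proof.
apply/matrixP => i j; rewrite [LHS]mxE [RHS]mxE (bigD1 (lift ord0 j)) //= sel_lift eqxx mulr1.
by rewrite big1 ?addr0 // => k kj; rewrite mxE (negPf kj) mulr0.
Qed.

Lemma selT_mul p (A : 'M[R]_(5, p)) : sel^T *m A = \matrix_(i, j) A (lift ord0 i) j.
Proof. by rewrite -[LHS]trmxK trmx_mul trmxK mul_sel; apply/matrixP => i j; rewrite !mxE. Qed.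

Lemma selK : sel^T *m sel = 1%:M.
Proof. by rewrite selT_mul; apply/matrixP => i j; rewrite [LHS]mxE sel_lift !mxE. Qed.

Lemma sel_selT : sel *m sel^T = 1%:M - delta_mx ct ct.
Proof.
have lift_cases (i : 'I_5) : i = ct \/ exists k, i = lift ord0 k.
  case: (unliftP ord0 i) => [k ->|->]; [by right; exists k|by left; apply: val_inj].
apply/matrixP => i j; rewrite [LHS]mxE [RHS]mxE [X in X + _]mxE [X in _ + X]mxE [X in _ - X]mxE.
have [->|[k ->]] := lift_cases i.
  rewrite big1 => [|l _]; last by rewrite sel_ct mul0r.
  by rewrite eqxx [ct == j]eq_sym andTb subrr.
rewrite (bigD1 k) //= sel_lift eqxx mul1r big1 ?addr0 => [|l lk]; last first.
  by rewrite sel_lift eq_sym (negPf lk) mul0r.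
by rewrite subr0 mxE mxE eq_sym.
Qed.

Definition frame_gram4 : 'M[R]_4 := sel^T *m frame_gram *m sel.
Definition frame_phi4 : 'M[R]_4 := sel^T *m frame_phi *m sel.

Lemma delta_gram_sel : delta_mx ct ct *m frame_gram *m sel = 0.
Proof.
rewrite mul_sel; apply/matrixP => i j; rewrite !mxE sum5 !mxE.
case: j => [[|[|[|[|j]]]] Hj] //=; elim/ord5_ind: i => /=; ring.
Qed.

Lemma frame_gram4T : frame_gram4^T = frame_gram4.
Proof. by rewrite /frame_gram4 !trmx_mul trmxK frame_gramT mulmxA. Qed.

Lemma frame_gram4_unit : frame_gram4 \in unitmx.
Proof.
suff : frame_gram4 *m frame_gram4 = 1%:M by move=> /mulmx1_unit[].
rewrite /frame_gram4 -!mulmxA [sel *m (sel^T *m _)]mulmxA sel_selT mulmxBl mul1mx.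
rewrite [delta_mx ct ct *m (frame_gram *m sel)]mulmxA delta_gram_sel subr0.
by rewrite [frame_gram *m (_ *m _)]mulmxA frame_gramK mul1mx selK.
Qed.

End Selection.

Section ModelLeaves.
Context {R : realType}.
Local Notation E := 'rV[R]_5.
Local Notation M := 'M[R]_5.
Variables (sigma : R) (a b p q r s : E -> R) (U : set E) (S : pcstruct R 4).
Hypothesis H : framed sigma a b p q r s U S.
Let oU := fr_open H. Let HS := fr_S H.
Local Notation cof := (cof a b p q r s).
Local Notation Om := (Om sigma p q r s).

(** All entries of [Om] that join different eigenspaces of [phi] lie in the row or the column [ct].
    This is the algebra behind the parallelism of [P] on the leaves. *)
Lemma phi_Om_sel i x : sel^T *m (frame_phi *m Om i x) *m sel = sel^T *m (Om i x *m frame_phi) *m sel.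
Proof.
have phiD (A : M) k l : (frame_phi *m A) k l = nth 0 [:: 0; 1; -1; -1; 1] k * A k l.
  by rewrite mxE sum5 !mxE; elim/ord5_ind: k => /=; ring.
have Dphi (A : M) k l : (A *m frame_phi) k l = A k l * nth 0 [:: 0; 1; -1; -1; 1] l.
  by rewrite mxE sum5 !mxE; elim/ord5_ind: l => /=; ring.
rewrite !mul_sel !selT_mul; apply/matrixP => k l.
rewrite [LHS]mxE [LHS]mxE [RHS]mxE [RHS]mxE phiD Dphi.
have lift_ne (j : 'I_4) : lift ord0 j != ct by apply/eqP => /(congr1 val).
move: (lift ord0 k) (lift ord0 l) (lift_ne k) (lift_ne l) => {}k {}l.
rewrite /Om; elim/ord5_ind: i => /=; rewrite ?mxE ?(mulr0, mul0r) //;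
  elim/ord5_ind: k => //; elim/ord5_ind: l => //= _ _; ring.
Qed.

Section Leaf.
Variables (W : set 'rV[R]_4) (F : 'rV[R]_4 -> 'rV[R]_5).
Hypothesis leaf : leaf_param U S W F.
Let oW : open W. Proof. by case: leaf. Qed.
Let sF : smooth_mx W F. Proof. by case: leaf. Qed.
Let WU y : W y -> U (F y). Proof. by case: leaf => _ _ h /h[]. Qed.
Local Notation J := (jac F).

Definition leaf_cof y : 'M[R]_4 := J y *m cof (F y) *m sel.
(** The pulled back connection matrices without their [xi] part: as in the Gauss formula, the
    connection of a leaf is the tangential part of the ambient one. *)
Definition leaf_Om (a' : 'I_4) y : 'M[R]_4 := \sum_i J y a' i *: (sel^T *m Om i (F y) *m sel).

Lemma smooth_J : smooth_mx W J.
Proof. by apply: smooth_mx_matrix => i k; exact: (smooth_pd i (smooth_entry sF 0 k)). Qed.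

Lemma smooth_cofF : smooth_mx W (fun y => cof (F y)).
Proof. exact: (smooth_mx_comp oW oU (smooth_cof H) WU sF). Qed.

Lemma smooth_leaf_cof : smooth_mx W leaf_cof.
Proof. exact: (smooth_mxM oW (smooth_mxM oW smooth_J smooth_cofF) (smooth_mx_cst _ oW)). Qed.

(** The leaf is tangent to [ker eta], and column [ct] of the coframe is [eta], so deleting that
    column loses nothing. *)
Lemma J_cof y : W y -> J y *m cof (F y) *m (sel *m sel^T) = J y *m cof (F y).
Proof.
move=> Wy; rewrite sel_selT mulmxBr mulmx1.
suff -> : J y *m cof (F y) *m delta_mx ct ct = 0 by rewrite subr0.
have [_ _ /(_ y Wy) [_ _]] := leaf.
have [_ -> _ _] := HS (WU Wy); rewrite trmx_delta => Jd.
have -> : delta_mx ct ct = delta_mx ct 0 *m (delta_mx 0 ct : E) :> M by rewrite mul_delta_mx.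
have c0 : cof (F y) *m delta_mx ct 0 = delta_mx ct 0 :> 'cV[R]_5.
  by rewrite -colE; apply/matrixP => i j; rewrite !mxE (ord1 j); elim/ord5_ind: i.
by rewrite mulmxA -[J y *m _ *m _]mulmxA c0 Jd mul0mx.
Qed.

Lemma leaf_cofT y : W y -> leaf_cof y *m sel^T = J y *m cof (F y).
Proof. by move=> Wy; rewrite /leaf_cof -mulmxA J_cof. Qed.

Lemma leaf_cof_unit y : W y -> leaf_cof y \in unitmx.
Proof.
move=> Wy; rewrite -row_free_unit -row_leq_rank.
have [_ _ /(_ y Wy) [_ rf _]] := leaf.
apply: leq_trans (mxrankM_maxl (leaf_cof y) sel^T).
by rewrite leaf_cofT // mxrankMfree ?row_leq_rank // row_free_unit (cof_unit H (WU Wy)).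
Qed.

Definition leaf_met y : 'M[R]_4 := J y *m met S (F y) *m (J y)^T.

Lemma leaf_metE y : W y -> leaf_met y = leaf_cof y *m frame_gram4 *m (leaf_cof y)^T.
Proof.
move=> Wy; have [_ _ _ gE] := HS (WU Wy).
rewrite /leaf_met gE /frame_gram4 !mulmxA leaf_cofT //.
rewrite -[_ *m sel *m (leaf_cof y)^T]mulmxA.
have -> : sel *m (leaf_cof y)^T = (J y *m cof (F y))^T.
  by rewrite -(leaf_cofT Wy) [RHS]trmx_mul trmxK.
by rewrite [(J y *m cof (F y))^T]trmx_mul !mulmxA.
Qed.

Lemma leaf_met_unit y : W y -> leaf_met y \in unitmx.
Proof.
move=> Wy; rewrite leaf_metE // !unitmx_mul unitmx_tr leaf_cof_unit //.
by rewrite frame_gram4_unit.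
Qed.

Lemma leaf_skew k y : leaf_Om k y *m frame_gram4 + (leaf_Om k y *m frame_gram4)^T = 0.
Proof.
have e : leaf_Om k y *m frame_gram4 = \sum_i J y k i *: (sel^T *m (Om i (F y) *m frame_gram) *m sel).
  rewrite /leaf_Om mulmx_suml; apply: eq_bigr => i _; rewrite -scalemxAl; congr (_ *: _).
  rewrite /frame_gram4 -!mulmxA [sel *m (sel^T *m _)]mulmxA sel_selT mulmxBl mul1mx.
  by rewrite [delta_mx ct ct *m (frame_gram *m sel)]mulmxA delta_gram_sel subr0.
rewrite e linear_sum /= -big_split /= big1 // => i _.
have selT (A : M) : (sel^T *m A *m sel)^T = sel^T *m A^T *m sel :> 'M[R]_4.
  by rewrite !trmx_mul trmxK mulmxA.
rewrite linearZ /= -scalerDr selT -mulmxDl -mulmxDr.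
by rewrite Om_skew mulmx0 mul0mx scaler0.
Qed.

(** The derivative of the Jacobian is symmetric by [smooth_schwarz], and the rest is the pullback of
    [cof_torsion]; both symmetries survive the multiplication by [sel]. *)
Lemma leaf_torsion y : W y -> forall i j k,
  (pdmx i leaf_cof y + leaf_cof y *m leaf_Om i y) j k =
  (pdmx j leaf_cof y + leaf_cof y *m leaf_Om j y) i k.
Proof.
move=> Wy.
pose K i := pdmx i J y *m cof (F y)
  + \sum_l J y i l *: (J y *m (pdmx l cof (F y) + cof (F y) *m Om l (F y))).
have KE i : pdmx i leaf_cof y + leaf_cof y *m leaf_Om i y = K i *m sel.
  have -> : pdmx i leaf_cof y = (pdmx i J y *m cof (F y) +
      J y *m pdmx i (fun y => cof (F y)) y) *m sel.
    rewrite /leaf_cof (pdmxM i Wy (smooth_mxM oW smooth_J smooth_cofF) (smooth_mx_cst _ oW)).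
    by rewrite pdmx_cst mulmx0 addr0 (pdmxM i Wy smooth_J smooth_cofF).
  rewrite /K (pdmx_comp i oW oU (smooth_cof H) WU sF Wy) /leaf_Om mulmx_sumr.
  rewrite mulmx_sumr !mulmxDl -addrA; congr (_ + _).
  rewrite !mulmx_suml -big_split /=; apply: eq_bigr => l _.
  rewrite -!scalemxAr -!scalemxAl -scalerDr; congr (_ *: _).
  by rewrite mulmxDr mulmxDl; congr (_ + _); rewrite !mulmxA leaf_cofT.
have addE (A B : 'M[R]_(4, 5)) i k : (A + B) i k = A i k + B i k by rewrite mxE.
have mulE m (A : 'M[R]_(4, 5)) (B : 'M[R]_(5, m)) i k : (A *m B) i k = \sum_l A i l * B l k by rewrite mxE.
suff Ks i j k : K i j k = K j i k.
  move: K KE Ks => K KE Ks i j k.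
  have e : (K i *m sel) j k = (K j *m sel) i k.
    by rewrite [LHS]mulE [RHS]mulE; apply: eq_bigr => l _; rewrite Ks.
  have ent (A B : 'M[R]_4) (i' j' : 'I_4) : A = B -> A i' j' = B i' j' by move=> ->.
  exact: (etrans (ent _ _ j k (KE i)) (etrans e (esym (ent _ _ i k (KE j))))).
have JJ l : pdmx i J y j l = pdmx j J y i l.
  have e i' j' : pdmx i' J y j' l = pd i' (pd j' (fun z => F z 0 l)) y.
    rewrite pdmxE; have -> : (fun z => J z j' l) = pd j' (fun z => F z 0 l).
      by apply/funext => z; rewrite mxE.
    by [].
  exact: (etrans (e i j) (etrans (smooth_schwarz j i oW (smooth_entry sF 0 l) Wy) (esym (e j i)))).
rewrite /K [LHS]addE [RHS]addE; apply: (f_equal2 +%R).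
  rewrite [LHS]mulE [RHS]mulE; apply: eq_bigr => l _.
  exact: (congr1 (fun z => z * _) (JJ l)).
have ex i' j' : (\sum_l J y i' l *: (J y *m (pdmx l cof (F y) + cof (F y) *m Om l (F y)))) j' k =
   \sum_l \sum_m J y i' l * (J y j' m * (pdmx l cof (F y) + cof (F y) *m Om l (F y)) m k).
  rewrite summxE; apply: eq_bigr => l _; rewrite [LHS]mxE [X in _ * X]mulE mulr_sumr.
  by [].
rewrite (ex i j) (ex j i) exchange_big /=; apply: eq_bigr => l _; apply: eq_bigr => m _.
by rewrite (cof_torsion H (WU Wy)) mulrCA.
Qed.

Lemma leaf_chr y i : W y -> chr leaf_met y i *m leaf_cof y = pdmx i leaf_cof y + leaf_cof y *m leaf_Om i y.
Proof.
move=> Wy.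
have mc j : pdmx j (fun=> frame_gram4) y = leaf_Om j y *m frame_gram4 + (leaf_Om j y *m frame_gram4)^T.
  by rewrite pdmx_cst leaf_skew.
exact: (frame_chr oW Wy smooth_leaf_cof (smooth_mx_cst frame_gram4 oW) leaf_metE (leaf_cof_unit Wy)
  (frame_gram4T (R := R)) (leaf_met_unit Wy) mc (leaf_torsion Wy) i).
Qed.

Lemma leaf_phi_comm i y : frame_phi4 *m leaf_Om i y = leaf_Om i y *m frame_phi4.
Proof.
rewrite /leaf_Om mulmx_suml mulmx_sumr; apply: eq_bigr => l _.
rewrite -scalemxAl -scalemxAr; congr (_ *: _).
have d1 : frame_phi *m (delta_mx ct ct) = 0 :> M.
  by apply/matrixP => k m; rewrite !mxE sum5 !mxE; elim/ord5_ind: k; elim/ord5_ind: m => /=; ring.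
have d2 : (delta_mx ct ct) *m frame_phi = 0 :> M.
  by apply/matrixP => k m; rewrite !mxE sum5 !mxE; elim/ord5_ind: m; elim/ord5_ind: k => /=; ring.
transitivity (sel^T *m (frame_phi *m Om l (F y)) *m sel).
  rewrite /frame_phi4 !mulmxA -[_ *m sel *m sel^T]mulmxA sel_selT mulmxBr mulmx1.
  by rewrite -[_ *m delta_mx ct ct]mulmxA d1 mulmx0 subr0.
rewrite phi_Om_sel /frame_phi4 !mulmxA -[_ *m sel *m sel^T]mulmxA sel_selT mulmxBr mulmx1.
by rewrite mulmxBl -[_ *m delta_mx ct ct *m frame_phi]mulmxA d2 mulmx0 subr0.
Qed.

Variable P : 'rV[R]_4 -> 'M[R]_4.
Hypothesis sP : smooth_mx W P.
Hypothesis PE : forall y, W y -> P y *m J y = J y *m phi S (F y).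

Lemma leaf_phi y : W y -> P y *m leaf_cof y = leaf_cof y *m frame_phi4.
Proof.
move=> Wy; have [_ _ phiE _] := HS (WU Wy).
rewrite /frame_phi4 !mulmxA leaf_cofT // /leaf_cof ?mulmxA PE //.
by rewrite -[J y *m phi S (F y) *m _]mulmxA phiE !mulmxA.
Qed.

Lemma leaf_parallel X Y y : smooth_mx W X -> smooth_mx W Y -> W y ->
  nabla leaf_met X (endo P Y) y = endo P (nabla leaf_met X Y) y.
Proof.
move=> sX sY Wy.
have cb z i : W z -> chr leaf_met z i *m leaf_cof z = pdmx i leaf_cof z + leaf_cof z *m leaf_Om i z.
  by move=> Wz; exact: leaf_chr.
have sPY : smooth_mx W (endo P Y) := smooth_mxM oW sY sP.
suff e : nabla leaf_met X (endo P Y) y *m leaf_cof y = endo P (nabla leaf_met X Y) y *m leaf_cof y.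
  by have := congr1 (mulmx^~ (invmx (leaf_cof y))) e; rewrite !mulmxK // leaf_cof_unit.
rewrite (nabla_frame oW smooth_leaf_cof cb X Wy sPY).
rewrite /endo -mulmxA leaf_phi // mulmxA (nabla_frame oW smooth_leaf_cof cb X Wy sY).
rewrite mulmx_suml; apply: eq_bigr => i _; rewrite -scalemxAl; congr (_ *: _).
have sz : smooth_mx W (fun z => Y z *m leaf_cof z) := smooth_mxM oW sY smooth_leaf_cof.
have zE z : W z -> Y z *m P z *m leaf_cof z = Y z *m leaf_cof z *m frame_phi4.
  by move=> Wz; rewrite -mulmxA leaf_phi // mulmxA.
rewrite /covd (pdmx_eq i oW Wy zE) zE // (pdmxM i Wy sz (smooth_mx_cst frame_phi4 oW)).
by rewrite pdmx_cst mulmx0 addr0 [RHS]mulmxDl -[_ *m frame_phi4 *m _]mulmxA leaf_phi_comm [_ *m (leaf_Om _ _ *m _)]mulmxA.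
Qed.

End Leaf.

Lemma model_leaves : para_kaehler_leaves U S.
Proof.
move=> W F P leaf sP PE /= X Y sX sY y Wy.
exact: (leaf_parallel leaf sP PE sX sY Wy).
Qed.

End ModelLeaves.

Lemma depends_pd0 {R : realType} {n : nat} (U : set 'rV[R]_n.+1) (s : seq 'I_n.+1) f i x :
  open U -> depends_on U s f -> i \notin s -> U x -> pd i f x = 0.
Proof.
move=> oU df is_ Ux; have [d d0 Hd] := near_norm (open_nbhs_nbhs (conj oU Ux)).
suff e : \forall h \near (0 : R), f (h *: delta_mx 0 i + x) = cst (f x) h.
  by rewrite /pd derive_line0 (@near_eq_derive R R^o R _ _ _ 1 e) derive_cst.
have n0 : \forall h \near (0 : R), `|h| < d.
  apply/nbhs_ballP; exists d => // y; by rewrite -ball_normE /ball_ /= sub0r normrN.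
apply: (@filterS _ (nbhs (0 : R)) _ _ _ _ n0) => h hd.
have Uh : U (h *: delta_mx 0 i + x).
  apply: Hd; rewrite addrK normrZ; apply: le_lt_trans hd.
  by rewrite ler_piMr // norm_delta.
apply: df => // j js; rewrite !mxE eqxx /= addrC.
by rewrite (_ : (j == i) = false) ?mulr0 ?addr0 //; apply/eqP => ji; rewrite -ji js in is_.
Qed.

Lemma pd0_pd {R : realType} {n : nat} (U : set 'rV[R]_n.+1) f i j x :
  open U -> smooth U f -> (forall y, U y -> pd i f y = 0) -> U x -> pd i (pd j f) x = 0.
Proof.
move=> oU sf f0 Ux; rewrite (smooth_schwarz j i oU sf Ux).
by rewrite (pd_eq j oU Ux f0) pd_cst.
Qed.

(** * From the functions [f1], [u], [f2], [v], [f3] to the coframe *)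

Section Link.
Context {R : realType}.
Local Notation E := 'rV[R]_5.
Local Notation M := 'M[R]_5.
Variables (sigma : R) (U : set E) (f1 u f2 v f3 : E -> R).

Definition fn_p (x : E) : R := u x - x 0 ct + pd cx1 f1 x.
Definition fn_q (x : E) : R := v x - sigma * x 0 ct + pd cx2 f2 x.

Local Notation cof := (cof (pd cy1 f1) (pd cy2 f2) fn_p fn_q (pd cx2 f1) (pd cx1 f2)).

Lemma ev_dcoord (i : 'I_5) (w : E) : ev (dcoord i) w = w 0 i.
Proof. exact: ev_delta. Qed.

Lemma mul_coframe (w : E) (a b p q r s : R) :
  [/\ (w *m coframe a b p q r s) 0 ct = w 0 ct, (w *m coframe a b p q r s) 0 cx1 = w 0 cx1,
      (w *m coframe a b p q r s) 0 cx2 = w 0 cx2,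
      (w *m coframe a b p q r s) 0 cy1 = w 0 cx1 * p + w 0 cx2 * r + w 0 cy1 * a &
      (w *m coframe a b p q r s) 0 cy2 = w 0 cx1 * s + w 0 cx2 * q + w 0 cy2 * b].
Proof. by split; rewrite mxE sum5 ![coframe _ _ _ _ _ _ _ _]mxE /=; ring. Qed.

Lemma mul_cof (w : E) x :
  [/\ (w *m cof x) 0 ct = w 0 ct, (w *m cof x) 0 cx1 = w 0 cx1, (w *m cof x) 0 cx2 = w 0 cx2,
      (w *m cof x) 0 cy1 = w 0 cx1 * fn_p x + w 0 cx2 * pd cx2 f1 x + w 0 cy1 * pd cy1 f1 x &
      (w *m cof x) 0 cy2 = w 0 cx1 * pd cx1 f2 x + w 0 cx2 * fn_q x + w 0 cy2 * pd cy2 f2 x].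
Proof. exact: mul_coframe. Qed.

Lemma ev_comb (A B C : R) (i j k : 'I_5) (w : E) :
  ev (A *: dcoord i + B *: dcoord j + C *: dcoord k) w = A * w 0 i + B * w 0 j + C * w 0 k.
Proof.
have evD (y z : E) : ev (y + z) w = ev y w + ev z w by rewrite /ev linearD mulmxDr mxE.
have evZ t (y : E) : ev (t *: y) w = t * ev y w by rewrite /ev linearZ -scalemxAr mxE.
by rewrite !evD !evZ !ev_dcoord.
Qed.

Lemma ev_theta3 (w : E) x : ev (theta3 f1 u f3 x) w = (w *m cof x) 0 cy1 + f3 x * w 0 cx2.
Proof.
have [_ _ _ -> _] := mul_cof w x; rewrite /theta3 ev_comb /fn_p.
by move: (pd cy1 f1 x) (pd cx1 f1 x) (pd cx2 f1 x) (u x) (f3 x) => *; ring.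
Qed.

Lemma ev_theta4 (w : E) x : ev (theta4 sigma f2 v f3 x) w = (w *m cof x) 0 cy2 - f3 x * w 0 cx1.
Proof.
have [_ _ _ _ ->] := mul_cof w x; rewrite /theta4 ev_comb /fn_q.
by move: (pd cy2 f2 x) (pd cx1 f2 x) (pd cx2 f2 x) (v x) (f3 x) => *; ring.
Qed.

Lemma model_phi_frame (P : M) x :
  (forall w : E, [/\ ev (dcoord ct) (w *m P) = 0,
     ev (dcoord cx1) (w *m P) = ev (dcoord cx1) w, ev (dcoord cx2) (w *m P) = - ev (dcoord cx2) w,
     ev (theta3 f1 u f3 x) (w *m P) = - ev (theta3 f1 u f3 x) w &
     ev (theta4 sigma f2 v f3 x) (w *m P) = ev (theta4 sigma f2 v f3 x) w]) <->
  P *m cof x = cof x *m frame_phi.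
Proof.
have Dphi (z : E) : [/\ (z *m frame_phi) 0 ct = 0, (z *m frame_phi) 0 cx1 = z 0 cx1,
    (z *m frame_phi) 0 cx2 = - z 0 cx2, (z *m frame_phi) 0 cy1 = - z 0 cy1 & (z *m frame_phi) 0 cy2 = z 0 cy2].
  by split; rewrite mxE sum5 !mxE /=; ring.
have evE (w : E) : [/\ ev (dcoord ct) w = (w *m cof x) 0 ct, ev (dcoord cx1) w = (w *m cof x) 0 cx1,
    ev (dcoord cx2) w = (w *m cof x) 0 cx2,
    ev (theta3 f1 u f3 x) w = (w *m cof x) 0 cy1 + f3 x * (w *m cof x) 0 cx2 &
    ev (theta4 sigma f2 v f3 x) w = (w *m cof x) 0 cy2 - f3 x * (w *m cof x) 0 cx1].
  have [e0 e1 e2 _ _] := mul_cof w x; rewrite e0 e1 e2.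
  by split; [exact: ev_dcoord|exact: ev_dcoord|exact: ev_dcoord|exact: ev_theta3|exact: ev_theta4].
move: (theta3 f1 u f3 x) (theta4 sigma f2 v f3 x) (f3 x) (dcoord ct : E) (dcoord cx1 : E)
  (dcoord cx2 : E) (cof x : M) evE => th3 th4 c th0 th1 th2 B evE.
split => [h|PE w]; last first.
  have [-> -> -> -> ->] := evE (w *m P); have [_ -> -> -> ->] := evE w.
  rewrite -mulmxA PE mulmxA; have [-> -> -> -> ->] := Dphi (w *m B).
  by split=> //; ring.
apply/row_matrixP => i; set w : E := delta_mx 0 i.
have -> : row i (P *m B) = w *m P *m B by rewrite rowE mulmxA.
have -> : row i (B *m frame_phi) = w *m B *m frame_phi by rewrite rowE mulmxA.
have := h w; have [-> -> -> -> ->] := evE (w *m P); have [_ -> -> -> ->] := evE w.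
have [d0 d1 d2 d3 d4] := Dphi (w *m B).
move: (w *m P *m B) => z [h0 h1 h2 h3 h4]; apply/rowP; elim/ord5_ind.
- by rewrite h0 d0.
- by rewrite h1 d1.
- by rewrite h2 d2.
- by rewrite d3; move: h3; rewrite h2; lra.
- by rewrite d4; move: h4; rewrite h1; lra.
Qed.

(** The two contributions of [f3] are opposite multiples of the symmetric product of [dx1] and
    [dx2]. *)
Lemma model_met_frame x :
  sym_prod (dcoord ct) (dcoord ct) + 2 *: sym_prod (dcoord cx1) (theta3 f1 u f3 x)
  + 2 *: sym_prod (dcoord cx2) (theta4 sigma f2 v f3 x) = cof x *m frame_gram *m (cof x)^T.
Proof.
have cg (z : M) i : [/\ (z *m frame_gram) i ct = z i ct, (z *m frame_gram) i cx1 = z i cy1,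
    (z *m frame_gram) i cx2 = z i cy2, (z *m frame_gram) i cy1 = z i cx1 & (z *m frame_gram) i cy2 = z i cx2].
  by split; rewrite mxE sum5 ![frame_gram _ _]mxE /=; ring.
apply/matrixP => i j; rewrite [RHS]mxE sum5; have [-> -> -> -> ->] := cg (cof x) i.
rewrite /cof /coframe /theta3 /theta4 /fn_p /fn_q.
move: (pd cy1 f1 x) (pd cx1 f1 x) (pd cx2 f1 x) (u x) (f3 x) => A B C D c.
move: (pd cy2 f2 x) (pd cx1 f2 x) (pd cx2 f2 x) (v x) (x 0 ct) => A' B' C' D' t.
rewrite !mxE !big_ord1 !mxE.
elim/ord5_ind: i; elim/ord5_ind: j => /=; by field.
Qed.

Hypothesis oU : open U.
Hypothesis F : model_functions U f1 u f2 v f3.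

(** Commuting mixed partials of [f1] and [f2] give [d_y1 r = d_x2 a] and [d_y2 s = d_x1 b];
    inserting the equations for [u] and [v] turns them into the relations for [d_y1 p] and
    [d_y2 q]. *)
Lemma model_framed S : model_structure sigma U f1 u f2 v f3 S ->
  framed sigma (pd cy1 f1) (pd cy2 f2) fn_p fn_q (pd cx2 f1) (pd cx1 f2) U S.
Proof.
move=> HS; have [[s1 su] [s2 sv] _ [df1 du h1] [df2 dv h2]] := F.
have st : smooth U (fun x : E => x 0 ct) := smooth_coord ct oU.
have sst : smooth U (fun x : E => sigma * x 0 ct) := smoothM oU (smooth_cst sigma oU) st.
have sp : smooth U fn_p := smoothD oU (smoothB oU su st) (smooth_pd cx1 s1).
have sq : smooth U fn_q := smoothD oU (smoothB oU sv sst) (smooth_pd cx2 s2).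
have f10 i x : i \notin [:: cx1; cx2; cy1] -> U x -> pd i f1 x = 0 by exact: depends_pd0.
have u0 i x : i \notin [:: cx1; cx2; cy1] -> U x -> pd i u x = 0 by exact: depends_pd0.
have f20 i x : i \notin [:: cx1; cx2; cy2] -> U x -> pd i f2 x = 0 by exact: depends_pd0.
have v0 i x : i \notin [:: cx1; cx2; cy2] -> U x -> pd i v x = 0 by exact: depends_pd0.
have g10 i j x : i \notin [:: cx1; cx2; cy1] -> U x -> pd i (pd j f1) x = 0.
  by move=> ni; apply: (pd0_pd j oU s1) => y; exact: f10.
have g20 i j x : i \notin [:: cx1; cx2; cy2] -> U x -> pd i (pd j f2) x = 0.
  by move=> ni; apply: (pd0_pd j oU s2) => y; exact: f20.
have pE i x : U x -> pd i fn_p x = pd i u x - (i == ct)%:R + pd i (pd cx1 f1) x.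
  move=> Ux; rewrite /fn_p (pdD (smooth_derivable (smoothB oU su st) Ux) (smooth_derivable (smooth_pd cx1 s1) Ux)).
  by rewrite (pdB (smooth_derivable su Ux) (smooth_derivable st Ux)) pd_coord.
have qE i x : U x -> pd i fn_q x = pd i v x - sigma * (i == ct)%:R + pd i (pd cx2 f2) x.
  move=> Ux; rewrite /fn_q (pdD (smooth_derivable (smoothB oU sv sst) Ux) (smooth_derivable (smooth_pd cx2 s2) Ux)).
  rewrite (pdB (smooth_derivable sv Ux) (smooth_derivable sst Ux)).
  rewrite (pdM (smooth_derivable (smooth_cst sigma oU) Ux) (smooth_derivable st Ux)).
  by rewrite pd_cst mul0r add0r pd_coord.
split.
- exact: oU.
- exact: (smooth_pd cy1 s1).
- exact: (smooth_pd cy2 s2).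
- exact: sp.
- exact: sq.
- exact: (smooth_pd cx2 s1).
- exact: (smooth_pd cx1 s2).
- by move=> x /h1[].
- by move=> x /h2[].
- move=> x Ux; split.
  + exact: (g10 ct cy1 x isT Ux).
  + exact: (g20 ct cy2 x isT Ux).
  + by rewrite (pE ct x Ux) (u0 ct x isT Ux) (g10 ct cx1 x isT Ux) sub0r addr0.
  + by rewrite (qE ct x Ux) (v0 ct x isT Ux) (g20 ct cx2 x isT Ux) mulr1 sub0r addr0.
  + by split; [exact: (g10 ct cx2 x isT Ux)|exact: (g20 ct cx1 x isT Ux)].
- move=> x Ux; have [_ hu] := h1 x Ux; split.
  + exact: (g20 cy1 cy2 x isT Ux).
  + rewrite (pE cy1 x Ux) -(smooth_schwarz cy1 cx1 oU s1 Ux) subr0.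
    by move: (pd cx1 (pd cy1 f1) x) (pd cy1 f1 x) (pd cy1 u x) hu => *; lra.
  + by rewrite (qE cy1 x Ux) (v0 cy1 x isT Ux) (g20 cy1 cx2 x isT Ux) mulr0 subr0 addr0.
  + exact: (smooth_schwarz cx2 cy1 oU s1 Ux).
  + exact: (g20 cy1 cx1 x isT Ux).
- move=> x Ux; have [_ hv] := h2 x Ux; split.
  + exact: (g10 cy2 cy1 x isT Ux).
  + by rewrite (pE cy2 x Ux) (u0 cy2 x isT Ux) (g10 cy2 cx1 x isT Ux) subr0 addr0.
  + rewrite (qE cy2 x Ux) -(smooth_schwarz cy2 cx2 oU s2 Ux) mulr0 subr0.
    by move: (pd cx2 (pd cy2 f2) x) (pd cy2 f2 x) (pd cy2 v x) hv => *; lra.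
  + exact: (g10 cy2 cx2 x isT Ux).
  + exact: (smooth_schwarz cx1 cy2 oU s2 Ux).
- move=> x Ux; have [xiE etaE phiE gE] := HS x Ux; split; [exact: xiE|exact: etaE| |].
    by apply/(model_phi_frame (phi S x) x) => w; exact: phiE.
  by rewrite gE model_met_frame.
Qed.

Lemma model_exists : exists S, model_structure sigma U f1 u f2 v f3 S.
Proof.
have [_ _ _ [_ _ h1] [_ _ h2]] := F.
pose fr := fra (pd cy1 f1) (pd cy2 f2) fn_p fn_q (pd cx2 f1) (pd cx1 f2).
exists (PCStruct (fun x => cof x *m frame_phi *m fr x) (fun=> delta_mx 0 ct) (fun=> delta_mx 0 ct)
  (fun x => cof x *m frame_gram *m (cof x)^T)) => x Ux; split=> //=.
  apply/model_phi_frame; rewrite -mulmxA /fr frame_coframe ?mulmx1 //.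
  by have [] := h1 x Ux.
  by have [] := h2 x Ux.
by rewrite model_met_frame.
Qed.

End Link.

Lemma model_direct {R : realType} (sigma : R) (hsigma : sigma = 1 \/ sigma = -1)
    (U : set 'rV[R]_5) (f1 u f2 v f3 : 'rV[R]_5 -> R) :
  domain U -> model_functions U f1 u f2 v f3 ->
  (exists S : pcstruct R 4, model_structure sigma U f1 u f2 v f3 S) /\
  (forall S : pcstruct R 4, model_structure sigma U f1 u f2 v f3 S ->
    [/\ weakly_para_cosymplectic U S,
        para_kaehler_leaves U S,
        (sigma = -1 -> hyperbolic U S) /\ (sigma = 1 -> elliptic U S),
        (exists tau1 tau2 : 'rV[R]_5 -> 'rV[R]_5, tau_forms sigma U S tau1 tau2) /\
        (forall tau1 tau2 : 'rV[R]_5 -> 'rV[R]_5, tau_forms sigma U S tau1 tau2 ->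
           contact_form U (ricci_potential S tau1 tau2) /\
           (forall x, U x -> ricci_potential S tau1 tau2 x = normal_potential x)) &
        let alpha := fun x => (pd cy1 f1 x)^-1 in
        let beta := fun x => - (pd cy2 f2 x)^-1 in
        (forall x, U x -> forall a : R,
           eigenvalue (ricci_op (met S) x) a <-> [\/ a = 0, a = - alpha x | a = - beta x]) /\
        (forall (W : set 'rV[R]_5) (V1 V2 : 'rV[R]_5 -> 'rV[R]_5),
           W `<=` U -> adapted_pair S sigma W V1 V2 ->
           forall x, W x ->
             V1 x *m ricci_op (met S) x = - alpha x *: V1 x /\
             V2 x *m ricci_op (met S) x = - beta x *: V2 x)]).
Proof.
move=> [oU _] F; split; first exact: (model_exists sigma F).
move=> S HS; have H := model_framed oU F HS.
have sg0 : sigma != 0 by case: hsigma => ->; rewrite ?oppr_eq0 oner_neq0.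
have st : sigma_type sigma U S.
  by move=> x Ux; have ad := model_adapted H; do 3 eexists; split; [exact: Ux|by []|exact: ad].
split.
- exact: (model_weakly H).
- exact: (model_leaves H).
- by split=> e; rewrite e in st; exact: st.
- split; first by exists tau1m, tau2m; exact: (model_tau H sg0).
  move=> tau1 tau2 ta; split; first exact: (model_contact H sg0 ta).
  by move=> x Ux; exact: (model_potential H sg0 ta Ux).
- move=> alpha beta; split.
    by move=> x Ux c; rewrite /alpha /beta opprK; exact: (ricci_eigen H c Ux).
  move=> W V1 V2 WU ad x Wx; rewrite /alpha /beta opprK.
  exact: (ricci_adapted H sg0 WU ad Wx).
Qed.

(** * Coordinate changes *)

Section Charts.
Context {R : realType} {M : topologicalType} {n : nat}.
Local Notation E := 'rV[R]_n.+1.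
Implicit Types c d e : chart R M n.

Lemma chart_image_open c (B : set M) : is_chart c -> open B -> open (ccoord c @` (cdom c `&` B)).
Proof.
move=> [oD oI parK _ cpar_c] oB.
suff -> : ccoord c @` (cdom c `&` B) = cimg c `&` cpar c @^-1` B.
  exact: open_preimage_in oI cpar_c oB.
apply/seteqP; split => x.
  by move=> [q [Dq Bq] <-]; split; [exists q|rewrite /preimage /= parK].
by move=> [[q Dq <-]]; rewrite /preimage /= parK // => Bq; exists q.
Qed.

Variables (A : set (chart R M n)) (c : chart R M n).
Hypotheses (mA : smooth_manifold A) (Ac : A c).

(** The new chart is [F \o ccoord c] on the part of the domain where the inverse function theorem
    inverts [F]. Its image is a ball, which makes the Poincare lemma and the partial integrals
    available in it. *)
Lemma coordinate_change (F : E -> E) (V : set E) q0 : open V -> V `<=` cimg c -> smooth_mx V F ->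
  cdom c q0 -> V (ccoord c q0) -> jac F (ccoord c q0) \in unitmx ->
  exists (d : chart R M n) (D : set E) (r : R) (h : E -> E), [/\ A d, cdom d q0, open D, D `<=` V &
    [/\ cimg d = ball (F (ccoord c q0)) r,
        (forall q, cdom d q -> cdom c q /\ D (ccoord c q)),
        (forall x, D x -> [/\ ball (F (ccoord c q0)) r (F x), h (F x) = x & trans c d x = F x]),
        (forall y, ball (F (ccoord c q0)) r y -> [/\ D (h y), F (h y) = y &
           exists q, [/\ cdom d q, cdom c q, ccoord c q = h y & ccoord d q = y]]) &
        smooth_mx (ball (F (ccoord c q0)) r) h]].
Proof.
move=> oV VU sF q0c Vq0 uJ; have [_ chA _ compA maxA] := mA.
have cc := chA c Ac; have [oDc oIc parK ccoord_c cpar_c] := cc.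
have [r [D [h [[r0 oD Dq0 DV] [FD hB sh]]]]] := inverse_function oV sF Vq0 uJ.
set Q := ball _ r in FD hB sh *.
pose d : chart R M n := Chart (cdom c `&` ccoord c @^-1` D) (F \o ccoord c) (cpar c \o h).
have oQ' : open Q by exact: ball_open.
have lift y : Q y -> exists q, [/\ cdom d q, cdom c q, ccoord c q = h y & ccoord d q = y].
  move=> /hB[Dh Fh]; have [q cq qE] := VU _ (DV _ Dh).
  by exists q; split; rewrite //= ?qE //; split; rewrite /preimage //= qE.
have imgd : cimg d = Q.
  apply/seteqP; split => y; first by move=> [q [_ /FD[]] + _ <-].
  by move=> /lift [q [dq _ _ qy]]; exists q.
have cF x : D x -> {for x, continuous F} by move=> Dx; exact: (smooth_mx_continuous sF (DV _ Dx)).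
have ch y : Q y -> {for y, continuous h} by exact: (smooth_mx_continuous sh).
have odom : open (cdom d) by exact: (open_preimage_in oDc ccoord_c oD).
have cd : is_chart d.
  split.
  - exact: odom.
  - by rewrite imgd.
  - by move=> q [cq /FD[_]] /= ->; rewrite parK.
  - by move=> q [cq Dq]; apply: continuous_comp; [exact: ccoord_c|exact: cF].
  - move=> y; rewrite imgd => Qy; apply: continuous_comp; first exact: ch.
    by apply: cpar_c; apply: VU; apply: DV; have [] := hB y Qy.
exists d, D, r, h; split => //.
  (* Membership comes from maximality of the atlas: transitions with any chart [e] factor through
     [c], with [h] or [F] as the other factor. *)
  apply: (maxA d cd) => e Ae; have ce := chA e Ae.
  have [oDe _ parKe _ _] := ce.
  have oce := chart_image_open cc oDe; have ode := chart_image_open cd oDe.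
  have oec := chart_image_open ce oDc; have oed := chart_image_open ce odom.
  split.
    have E0 y : (ccoord d @` (cdom d `&` cdom e)) y ->
        Q y /\ (ccoord c @` (cdom c `&` cdom e)) (h y).
      move=> [q [[cq Dq] eq] <-]; have [Qq hq] := FD _ Dq; split => //=.
      by rewrite hq; exists q.
    have hO : smooth_mx (ccoord d @` (cdom d `&` cdom e)) h.
      by apply: (smooth_mxS _ sh) => y /E0[].
    exact: (smooth_mx_comp ode oce (compA c e Ac Ae) (fun y H => (E0 y H).2) hO).
  have E0 x : (ccoord e @` (cdom e `&` cdom d)) x ->
      (ccoord e @` (cdom e `&` cdom c)) x /\ V (trans e c x).
    move=> [q [eq [cq Dq]] <-]; split; first by exists q.
    by rewrite /trans parKe //; exact: DV.
  have tO : smooth_mx (ccoord e @` (cdom e `&` cdom d)) (trans e c).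
    by apply: (smooth_mxS _ (compA e c Ae Ac)) => y /E0[].
  exact: (smooth_mx_comp oed oV sF (fun y H => (E0 y H).2) tO).
split => //.
- move=> x Dx; have [Qx hx] := FD x Dx; split => //.
  by have [q cq <-] := VU _ (DV _ Dx); rewrite /trans parK.
- by move=> y Qy; have [Dh Fh] := hB y Qy; split => //; exact: lift.
Qed.

End Charts.

(** * Behaviour of the connection under coordinate changes *)

Section Transport.
Context {R : realType} {n : nat}.
Local Notation E := 'rV[R]_n.+1.
Local Notation M := 'M[R]_n.+1.

Lemma sym_pd (U : set E) (g : E -> M) x : open U -> U x -> (forall y, U y -> (g y)^T = g y) ->
  forall i j k, pd i (fun y => g y j k) x = pd i (fun y => g y k j) x.
Proof.
move=> oU Ux gT i j k; apply: (pd_eq i oU Ux) => y Uy.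
by rewrite -[in LHS](gT y Uy) mxE.
Qed.

Lemma smooth_jac (D : set E) (F : E -> E) : smooth_mx D F -> smooth_mx D (jac F).
Proof. by move=> sF; apply: smooth_mx_matrix => i k; exact: (smooth_pd i (smooth_entry sF 0 k)). Qed.

Lemma nabla_delta (U : set E) (g : E -> M) i (Y : E -> E) x : open U -> U x -> smooth_mx U Y ->
  nabla g (fun=> delta_mx 0 i) Y x = pdmx i Y x + Y x *m chr g x i.
Proof.
move=> oU Ux sY; rewrite (nabla_chr _ _ oU Ux sY) (bigD1 i) //= big1 ?addr0 => [|j ji].
  by rewrite mxE !eqxx scale1r.
by rewrite mxE (negPf ji) andbF scale0r.
Qed.

(** By metric compatibility, lowering the index commutes with [nabla]; the transposed [chr] is the
    Christoffel term of a covector. *)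
Lemma pdmx_lower (U : set E) (g : E -> M) i (Y : E -> E) x : open U -> U x -> smooth_mx U Y ->
  pseudo_riemannian U g ->
  pdmx i (fun y => Y y *m g y) x =
  nabla g (fun=> delta_mx 0 i) Y x *m g x + Y x *m g x *m (chr g x i)^T.
Proof.
move=> oU Ux sY [sg gTu]; have [gT gu] := gTu x Ux.
rewrite (pdmxM i Ux sY sg) (nabla_delta g i oU Ux sY).
rewrite -(chr_compat i gT gu (sym_pd oU Ux (fun y Uy => (gTu y Uy).1))).
rewrite trmx_mul gT mulmxDl mulmxDr addrA -!mulmxA; congr (_ + _).
Qed.

Variables (D D' : set E) (F : E -> E) (g g' : E -> M).
Hypotheses (oD : open D) (oD' : open D') (sF : smooth_mx D F) (FD : forall x, D x -> D' (F x)).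
Hypotheses (pr' : pseudo_riemannian D' g') (gu : forall x, D x -> g x \in unitmx).
Hypothesis gE : forall x, D x -> g x = jac F x *m g' (F x) *m (jac F x)^T.

Let Om i x : M := \sum_l jac F x i l *: chr g' (F x) l.

Lemma jac_unit x : D x -> jac F x \in unitmx.
Proof. by move=> Dx; have := gu Dx; rewrite gE // !unitmx_mul => /andP[/andP[]]. Qed.

(** The transformation law of Christoffel symbols as a case of [frame_chr]: the target coordinate
    fields are a frame on the source, with coframe [jac F] and Gram matrix [g'] along [F]. *)
Lemma jac_chr x i : D x -> chr g x i *m jac F x = pdmx i (jac F) x + jac F x *m Om i x.
Proof.
move=> Dx; have [sg' gTu] := pr'; have [gT gu'] := gTu _ (FD Dx).
have gs := sym_pd oD' (FD Dx) (fun y Dy => (gTu y Dy).1).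
have sG : smooth_mx D (fun y => g' (F y)) := smooth_mx_comp oD oD' sg' FD sF.
refine (frame_chr (Om := Om^~ x) oD Dx (smooth_jac sF) sG gE (jac_unit Dx) gT (gu Dx) _ _ i).
  move=> j; rewrite (pdmx_comp j oD oD' sg' FD sF Dx) /Om mulmx_suml linear_sum -big_split /=.
  apply: eq_bigr => l _; rewrite -scalemxAl linearZ -scalerDr.
  by rewrite (chr_compat l gT gu' gs).
move=> {}i j k.
have addE (A B : M) i' k' : (A + B) i' k' = A i' k' + B i' k' by rewrite mxE.
have e i' j' l : pdmx i' (jac F) x j' l = pd i' (pd j' (fun z => F z 0 l)) x.
  rewrite pdmxE; have -> : (fun z => jac F z j' l) = pd j' (fun z => F z 0 l).
    by apply/funext => z; rewrite mxE.
  by [].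
rewrite [LHS]addE [RHS]addE; apply: (f_equal2 +%R).
  exact: (etrans (e i j k) (etrans (smooth_schwarz j i oD (smooth_entry sF 0 k) Dx) (esym (e j i k)))).
have ex i' j' : (jac F x *m Om i' x) j' k =
    \sum_m \sum_l jac F x j' m * (jac F x i' l * chr g' (F x) l m k).
  rewrite [LHS]mxE; apply: eq_bigr => m _; rewrite /Om summxE mulr_sumr.
  by apply: eq_bigr => l _; rewrite [X in _ * X]mxE.
rewrite (ex i j) (ex j i) exchange_big /=; apply: eq_bigr => l _; apply: eq_bigr => m _.
by rewrite (chr_sym l m k gs) mulrCA.
Qed.

Lemma nabla_transport (Y Y' : E -> E) v x : D x -> smooth_mx D Y -> smooth_mx D' Y' ->
  (forall x, D x -> Y x *m jac F x = Y' (F x)) ->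
  nabla g (fun=> v) Y x *m jac F x = nabla g' (fun=> v *m jac F x) Y' (F x).
Proof.
move=> Dx sY sY' YE.
rewrite (nabla_frame oD (smooth_jac sF) (fun x i Dx => jac_chr i Dx) _ Dx sY).
rewrite (nabla_chr _ _ oD' (FD Dx) sY').
transitivity (\sum_i \sum_l (v 0 i * jac F x i l) *: (pdmx l Y' (F x) + Y' (F x) *m chr g' (F x) l)).
  apply: eq_bigr => i _; rewrite /covd (pdmx_eq i oD Dx YE) YE //.
  rewrite (pdmx_comp i oD oD' sY' FD sF Dx) /Om mulmx_sumr -big_split scaler_sumr /=.
  by apply: eq_bigr => l _; rewrite -scalemxAr -scalerDr scalerA.
rewrite exchange_big; apply: eq_bigr => l _; rewrite -scaler_suml; congr (_ *: _).
by rewrite [RHS]mxE.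
Qed.

End Transport.

(** * Closed forms on a weakly para-cosymplectic manifold *)

Section ParacontactAlgebra.
Context {R : realType} {n : nat}.
Local Notation E := 'rV[R]_n.
Variables (G P : 'M[R]_n) (xi eta : E).

Lemma bilDr (u v w : E) : bil G w (u + v) = bil G w u + bil G w v.
Proof. by rewrite /bil linearD mulmxDr mxE. Qed.

Lemma bilZl c (v w : E) : bil G (c *: v) w = c * bil G v w.
Proof. by rewrite /bil -!scalemxAl mxE. Qed.

Lemma bilZr c (v w : E) : bil G w (c *: v) = c * bil G w v.
Proof. by rewrite /bil linearZ -scalemxAr mxE. Qed.

Lemma bilNl (v w : E) : bil G (- v) w = - bil G v w.
Proof. by rewrite -scaleN1r bilZl mulN1r. Qed.

Lemma bilNr (v w : E) : bil G w (- v) = - bil G w v.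
Proof. by rewrite -scaleN1r bilZr mulN1r. Qed.

Lemma bil_delta (v : E) i : bil G v (delta_mx 0 i) = (v *m G) 0 i.
Proof. by rewrite /bil trmx_delta -colE mxE. Qed.

Hypotheses (Gsym : G^T = G) (Gu : G \in unitmx).

Lemma bilC (v w : E) : bil G v w = bil G w v.
Proof.
rewrite /bil; have -> : v *m G *m w^T = (w *m G *m v^T)^T by rewrite !trmx_mul trmxK Gsym mulmxA.
by rewrite mxE.
Qed.

Lemma bil_inj (v w : E) : (forall z, bil G v z = bil G w z) -> v = w.
Proof.
move=> vw; suff e : v *m G = w *m G by rewrite -(mulmxK Gu v) e mulmxK.
by apply/rowP => i; rewrite -!bil_delta.
Qed.

Hypothesis pc : forall v w : E,
  [/\ v *m P *m P = v - ev eta v *: xi, ev eta xi = 1,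
      bil G (v *m P) (w *m P) = - bil G v w + ev eta v * ev eta w &
      ev eta v = bil G xi v].

Let e1 : ev eta xi = 1. Proof. by have [] := pc 0 0. Qed.
Let e2 v : ev eta v = bil G xi v. Proof. by have [] := pc v 0. Qed.
Let e3 v : v *m P *m P = v - ev eta v *: xi. Proof. by have [] := pc v 0. Qed.
Let e4 v w : bil G (v *m P) (w *m P) = - bil G v w + ev eta v * ev eta w. Proof. by have [] := pc v w. Qed.

Lemma lower_xi : xi *m G = eta.
Proof.
apply/rowP => i; rewrite -bil_delta -e2 /ev mxE (bigD1 i) //= big1 => [|j ji]; last first.
  by rewrite mxE (negPf ji) andbF mul0r.
by rewrite !mxE !eqxx mul1r addr0.
Qed.

(** Pairing [phi xi] with [phi (phi z)] gives [g(phi xi, z) = eta(phi xi) eta(z)], so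
    [phi xi = k xi]; then [phi (phi xi) = 0] yields [k * k = 0]. *)
Lemma phi_xi : xi *m P = 0.
Proof.
have xPz z : bil G (xi *m P) z = ev eta (xi *m P) * ev eta z.
  have := e4 xi (z *m P); rewrite e3 e1 mul1r -e2 addNr bilDr bilNr bilZr => /eqP.
  rewrite subr_eq0 [bil G _ xi]bilC -e2 mulrC => /eqP; exact.
have xPE : xi *m P = ev eta (xi *m P) *: xi.
  by apply: bil_inj => z; rewrite xPz bilZl -e2.
have : xi *m P *m P = 0 by rewrite e3 e1 scale1r subrr.
move: xPE; move: (ev eta (xi *m P)) => k xPE; rewrite xPE -scalemxAl xPE scalerA.
move=> /(congr1 (ev eta)); rewrite !e2 bilZr -e2 e1 mulr1 /bil trmx0 mulmx0 mxE => /eqP.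
by rewrite mulf_eq0 orbb => /eqP ->; rewrite scale0r.
Qed.

Lemma eta_phi v : ev eta (v *m P) = 0.
Proof.
have : ev eta (v *m P) *: xi = 0.
  have := e3 (v *m P); rewrite (e3 v) mulmxBl -scalemxAl phi_xi scaler0 subr0.
  by move=> /esym /eqP; rewrite -subr_eq0 addrAC subrr add0r oppr_eq0 => /eqP.
move: (ev eta (v *m P)) => k /(congr1 (ev eta)); rewrite !e2 bilZr -e2 e1 mulr1 => ->.
by rewrite /bil trmx0 mulmx0 mxE.
Qed.

Lemma phi_skew v w : bil G (v *m P) w = - bil G v (w *m P).
Proof.
have := e4 v (w *m P); rewrite e3 eta_phi mulr0 addr0 bilDr bilNr bilZr.
by rewrite [bil G _ xi]bilC -e2 eta_phi mulr0 subr0.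
Qed.

(** Skewness of [phi] gives [2 c g(v, w) = 0]: eigenspaces for nonzero eigenvalues are isotropic. *)
Lemma eigen_null c v w : c != 0 -> v *m P = c *: v -> w *m P = c *: w ->
  ev eta v = 0 /\ bil G v w = 0.
Proof.
move=> c0 vP wP; split.
  by have := eta_phi v; rewrite vP e2 bilZr -e2 => /eqP; rewrite mulf_eq0 (negPf c0) => /eqP.
have := phi_skew v w; rewrite vP wP bilZl bilZr => h.
have /eqP : 2 * c * bil G v w = 0 by move: h; lra.
by rewrite !mulf_eq0 pnatr_eq0 (negPf c0) => /eqP.
Qed.

End ParacontactAlgebra.

Lemma eigen_free {R : realType} {n : nat} (P : 'M[R]_n) (V1 V2 : 'rV[R]_n) (c1 c2 : R) :
  V1 != 0 -> V2 != 0 -> V1 *m P = - V1 -> V2 *m P = V2 -> c1 *: V1 + c2 *: V2 = 0 ->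
  c1 = 0 /\ c2 = 0.
Proof.
move=> V10 V20 h1 h2 e.
have := congr1 (mulmx^~ P) e; rewrite mulmxDl -!scalemxAl h1 h2 mul0mx scalerN => e'.
have f2 : c2 *: V2 + c2 *: V2 = 0.
  by rewrite -[RHS](addr0 0) -{1}e -e' addrACA subrr add0r.
have c20 : c2 = 0.
  move/eqP: f2; rewrite -scalerDl scaler_eq0 (negPf V20) orbF => /eqP h; lra.
move/eqP: e; rewrite c20 scale0r addr0 scaler_eq0 (negPf V10) orbF => /eqP.
by split.
Qed.

Lemma ev_deltar {R : realType} {n : nat} (a : 'rV[R]_n) i : ev a (delta_mx 0 i) = a 0 i.
Proof. by rewrite /ev -rowE !mxE. Qed.

Section CurvatureOfXi.
Context {R : realType}.
Local Notation E := 'rV[R]_5.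
Local Notation M := 'M[R]_5.
Variables (sigma : R) (U W : set E) (S : pcstruct R 4) (V1 V2 t1 t2 : E -> E).
Hypotheses (oU : open U) (WU : W `<=` U).
Hypothesis weak : weakly_para_cosymplectic U S.
Hypothesis ad : adapted_pair S sigma W V1 V2.
Hypothesis tn : forall x, W x -> forall v : E,
  nabla (met S) (fun=> v) V1 x = ev (t1 x) v *: V1 x /\
  nabla (met S) (fun=> v) V2 x = ev (t2 x) v *: V2 x.

Let oW : open W. Proof. by case: ad. Qed.
Let sV1 : smooth_mx W V1. Proof. by case: ad. Qed.
Let sV2 : smooth_mx W V2. Proof. by case: ad. Qed.
Let pr : pseudo_riemannian W (met S).
Proof.
have [[[_ _ _ [sg gT] _] _ _] _] := weak.
split; first exact: (smooth_mxS WU sg).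
by move=> x /WU; exact: gT.
Qed.
Let sxi : smooth_mx U (xi S). Proof. by have [[[_ ? _ _ _] _ _] _] := weak. Qed.

Definition low (V : E -> E) (x : E) : E := V x *m met S x.

Lemma smooth_low V : smooth_mx W V -> smooth_mx W (low V).
Proof. by move=> sV; have [sg _] := pr; exact: (smooth_mxM oW sV sg). Qed.

Lemma pd_low V (t : E -> E) x i j : smooth_mx W V -> W x ->
  (forall v : E, nabla (met S) (fun=> v) V x = ev (t x) v *: V x) ->
  pd i (fun y => low V y 0 j) x = t x 0 i * low V x 0 j + \sum_k low V x 0 k * chr (met S) x i j k.
Proof.
move=> sV Wx nV; rewrite -[LHS](pdmxE i (low V) x 0 j) (pdmx_lower i oW Wx sV pr).
rewrite nV -scalemxAl ev_deltar mxE [X in X + _]mxE [X in _ + X]mxE; congr (_ + _).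
by apply: eq_bigr => k _; rewrite [X in _ * X]mxE.
Qed.

Lemma ext_low V (t : E -> E) x i j : smooth_mx W V -> W x ->
  (forall v : E, nabla (met S) (fun=> v) V x = ev (t x) v *: V x) ->
  ext_d (low V) x i j = t x 0 i * low V x 0 j - t x 0 j * low V x 0 i.
Proof.
move=> sV Wx nV; rewrite /ext_d (pd_low i j sV Wx nV) (pd_low j i sV Wx nV).
have [_ gTu] := pr; have gs := sym_pd oW Wx (fun y Wy => (gTu y Wy).1).
have -> : \sum_k low V x 0 k * chr (met S) x j i k = \sum_k low V x 0 k * chr (met S) x i j k.
  by apply: eq_bigr => k _; rewrite (chr_sym j i k gs).
by rewrite opprD addrACA subrr addr0.
Qed.

(** The value of [- A] on the j-th coordinate field; being written with [V1], [V2] it can be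
    differentiated by [tau_1], [tau_2]. *)
Let dxi j (y : E) : E := - (low V1 y 0 j *: V1 y + (sigma * low V2 y 0 j) *: V2 y).

Lemma nabla_xi x j : W x -> nabla (met S) (fun=> delta_mx 0 j) (xi S) x = dxi j x.
Proof.
move=> Wx; have [_ gTu] := pr; have [gT gu] := gTu x Wx.
have [_ _ _ /(_ x Wx) [_ _ _ _ /(_ (delta_mx 0 j))]] := ad.
rewrite /Defs.shape /dxi !(bilC gT (delta_mx 0 j)) !bil_delta => <-.
by rewrite opprK.
Qed.

Lemma smooth_dxi j : smooth_mx W (dxi j).
Proof.
have l1 := smooth_entry (smooth_low sV1) 0 j; have l2 := smooth_entry (smooth_low sV2) 0 j.
have l2s := smoothM oW (smooth_cst sigma oW) l2.
exact: (smooth_mxN oW (smooth_mxD oW (smooth_mxZ oW l1 sV1) (smooth_mxZ oW l2s sV2))).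
Qed.

Lemma nabla2_xi x i j : W x ->
  nabla (met S) (fun=> delta_mx 0 i) (nabla (met S) (fun=> delta_mx 0 j) (xi S)) x =
  - ((pd i (fun y => low V1 y 0 j) x + low V1 x 0 j * t1 x 0 i) *: V1 x
     + (sigma * (pd i (fun y => low V2 y 0 j) x + low V2 x 0 j * t2 x 0 i)) *: V2 x).
Proof.
move=> Wx; have [n1 n2] := tn Wx (delta_mx 0 i).
have E0 y : W y -> dxi j y = nabla (met S) (fun=> delta_mx 0 j) (xi S) y by move=> Wy; rewrite nabla_xi.
rewrite (nabla_delta _ i oW Wx (smooth_mx_eq oW E0 (smooth_dxi j))).
rewrite -(pdmx_eq i oW Wx E0) -(E0 x Wx).
move: n1 n2; rewrite !ev_deltar (nabla_delta _ i oW Wx sV1) (nabla_delta _ i oW Wx sV2) => n1 n2.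
have l1 := smooth_entry (smooth_low sV1) 0 j; have l2 := smooth_entry (smooth_low sV2) 0 j.
have l2s := smoothM oW (smooth_cst sigma oW) l2.
rewrite /dxi (pdmxN i Wx (smooth_mxD oW (smooth_mxZ oW l1 sV1) (smooth_mxZ oW l2s sV2))).
rewrite (pdmxD i Wx (smooth_mxZ oW l1 sV1) (smooth_mxZ oW l2s sV2)).
rewrite (pdmxZ i Wx l1 sV1) (pdmxZ i Wx l2s sV2).
rewrite (pdM (smooth_derivable (smooth_cst sigma oW) Wx) (smooth_derivable l2 Wx)) pd_cst mul0r add0r.
rewrite mulNmx -opprD; congr (- _).
rewrite mulmxDl -!scalemxAl.
move: n1 n2; move: (pdmx i V1 x) (pdmx i V2 x) (V1 x *m _) (V2 x *m _) => A1 A2 B1 B2.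
move=> /(canRL (addrK _)) -> /(canRL (addrK _)) ->.
by apply/rowP => k; rewrite !mxE; ring.
Qed.

Lemma nabla_zero (X Z : E -> E) x : U x -> (forall y, U y -> Z y = 0) -> nabla (met S) X Z x = 0.
Proof.
move=> Ux Z0.
have Z0' y : U y -> (fun=> 0 : E) y = Z y by move=> /Z0 ->.
have sZ : smooth_mx U Z := smooth_mx_eq oU Z0' (smooth_mx_cst 0 oU).
rewrite (nabla_chr _ _ oU Ux sZ) big1 // => i _.
by rewrite (pdmx_eq i oU Ux Z0) pdmx_cst Z0 // mul0mx addr0 scaler0.
Qed.

Lemma nabla_null (X Z : E -> E) x : U x -> smooth_mx U Z -> X x = 0 -> nabla (met S) X Z x = 0.
Proof.
move=> Ux sZ X0; rewrite (nabla_chr _ _ oU Ux sZ) big1 // => i _.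
by rewrite X0 mxE scale0r.
Qed.

(* Since [phi xi = 0], the identity [R(X,Y) phi xi = phi R(X,Y) xi] puts
   [R(X,Y) xi], a combination of [V1] and [V2], in the kernel of [phi]. *)
Lemma tau_low x i j : sigma != 0 -> W x ->
  t1 x 0 i * low V1 x 0 j - t1 x 0 j * low V1 x 0 i = 0 /\
  t2 x 0 i * low V2 x 0 j - t2 x 0 j * low V2 x 0 i = 0.
Proof.
move=> sg0 Wx; have Ux := WU Wx.
have [[[_ _ _ [_ gTu] pc] _ _] wk] := weak.
have phixi y : U y -> endo (phi S) (xi S) y = 0.
  by move=> Uy; have [gT gu] := gTu y Uy; exact: (phi_xi gT gu (pc y Uy)).
have cd k : smooth_mx U (fun=> delta_mx 0 k : E) := smooth_mx_cst _ oU.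
have lie0 : lie (fun=> delta_mx 0 i : E) (fun=> delta_mx 0 j : E) x = 0.
  by rewrite /lie !derive_cst subrr.
have := wk _ _ _ (cd i) (cd j) sxi x Ux.
rewrite /curv (nabla_zero _ Ux (fun y Uy => nabla_zero _ Uy phixi)).
rewrite (nabla_zero _ Ux (fun y Uy => nabla_zero _ Uy phixi)) (nabla_zero _ Ux phixi) !subr0.
rewrite /endo (nabla2_xi i j Wx) (nabla2_xi j i Wx) (nabla_null Ux sxi lie0) subr0.
have [n1 n2] : (forall v : E, nabla (met S) (fun=> v) V1 x = ev (t1 x) v *: V1 x) /\
    (forall v : E, nabla (met S) (fun=> v) V2 x = ev (t2 x) v *: V2 x).
  by split=> v; have [] := tn Wx v.
have := ext_low i j sV1 Wx n1; have := ext_low i j sV2 Wx n2; rewrite /ext_d.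
have [_ _ _ /(_ x Wx) [[V10 V20] h1 h2 _ _]] := ad.
move: (pd i (fun y => low V2 y 0 j) x) (pd j (fun y => low V2 y 0 i) x).
move: (pd i (fun y => low V1 y 0 j) x) (pd j (fun y => low V1 y 0 i) x).
move: (low V1 x 0 i) (low V1 x 0 j) (low V2 x 0 i) (low V2 x 0 j).
move=> b1 b2 b3 b4 a3 a4 a1 a2 E2 E1.
set c1 := t1 x 0 i * _ - _; set c2 := t2 x 0 i * _ - _.
have -> : - ((a3 + b2 * t1 x 0 i) *: V1 x + (sigma * (a1 + b4 * t2 x 0 i)) *: V2 x) -
   - ((a4 + b1 * t1 x 0 j) *: V1 x + (sigma * (a2 + b3 * t2 x 0 j)) *: V2 x) =
   (- 2 * c1) *: V1 x + (- 2 * sigma * c2) *: V2 x.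
  have -> : a3 = a4 + c1 by move: E1; rewrite /c1; lra.
  have -> : a1 = a2 + c2 by move: E2; rewrite /c2; lra.
  by apply/rowP => k; rewrite /c1 /c2 !mxE; ring.
rewrite mulmxDl -!scalemxAl h1 h2 scalerN -scaleNr => /esym e.
have [z1 z2] := eigen_free V10 V20 h1 h2 e.
split; first by move: z1; lra.
move/eqP: z2; rewrite !mulf_eq0 (negPf sg0) oppr_eq0 pnatr_eq0 /= => /eqP; exact.
Qed.

End CurvatureOfXi.

Section DarbouxMap.
Context {R : realType}.
Local Notation E := 'rV[R]_5.
Local Notation M := 'M[R]_5.
Variables (sigma : R) (U W : set E) (S : pcstruct R 4) (V1 V2 t1 t2 : E -> E).
Hypotheses (oU : open U) (WU : W `<=` U) (sg0 : sigma != 0).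
Hypothesis weak : weakly_para_cosymplectic U S.
Hypothesis ad : adapted_pair S sigma W V1 V2.
Hypotheses (st1 : smooth_mx U t1) (st2 : smooth_mx U t2).
Hypothesis tn : forall x, W x -> forall v : E,
  nabla (met S) (fun=> v) V1 x = ev (t1 x) v *: V1 x /\
  nabla (met S) (fun=> v) V2 x = ev (t2 x) v *: V2 x.
Hypothesis contact : contact_form U (ricci_potential S t1 t2).

Local Notation low V := (low S V).

Lemma low_neq0 V x : U x -> V x != 0 -> exists j, low V x 0 j != 0.
Proof.
have [[[_ _ _ [_ gTu] _] _ _] _] := weak => Ux V0; have [_ gu] := gTu x Ux.
apply: contrapT => nj; move/eqP: V0; apply; rewrite -(mulmxK gu (V x)).
suff -> : V x *m met S x = 0 by rewrite mul0mx.
apply/rowP => j; rewrite [RHS]mxE; apply: contrapT => /eqP j0.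
by apply: nj; exists j.
Qed.

Lemma adapted_low_closed x i j : W x -> ext_d (low V1) x i j = 0 /\ ext_d (low V2) x i j = 0.
Proof.
move=> Wx; have [oW sV1 sV2 _] := ad.
have n1 v := (tn Wx v).1; have n2 v := (tn Wx v).2.
have [z1 z2] := tau_low oU WU weak ad tn i j sg0 Wx.
by rewrite (ext_low WU weak ad i j sV1 Wx n1) (ext_low WU weak ad i j sV2 Wx n2).
Qed.

Definition row5 (f0 f1 f2 f3 f4 : E -> R) (x : E) : E :=
  \row_k nth (fun=> 0) [:: f0; f1; f2; f3; f4] k x.

Lemma smooth_row5 (Q : set E) f0 f1 f2 f3 f4 : smooth Q f0 -> smooth Q f1 -> smooth Q f2 ->
  smooth Q f3 -> smooth Q f4 -> smooth_mx Q (row5 f0 f1 f2 f3 f4).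
Proof.
move=> s0 s1 s2 s3 s4; apply/smooth_mxP => i k.
have -> : (fun x => row5 f0 f1 f2 f3 f4 x i k) = nth (fun=> 0) [:: f0; f1; f2; f3; f4] k.
  by apply/funext => x; rewrite mxE.
by elim/ord5_ind: k; [exact: s0|exact: s1|exact: s2|exact: s3|exact: s4].
Qed.

Lemma jac_row5 f0 f1 f2 f3 f4 x i k :
  jac (row5 f0 f1 f2 f3 f4) x i k = pd i (nth (fun=> 0) [:: f0; f1; f2; f3; f4] k) x.
Proof. by rewrite mxE; apply: (f_equal (fun f => pd i f x)); apply/funext => y; rewrite mxE. Qed.

(** [poincare] integrates the three closed forms, and the proportionality factors between [tau_i]
    and [th_i] are the two remaining components of [F]. The contact condition is used at [x0] only,
    to make the Jacobian invertible there. *)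
Lemma darboux_map x0 : W x0 -> exists r (F : E -> E),
  [/\ 0 < r, ball x0 r `<=` W, smooth_mx (ball x0 r) F, jac F x0 \in unitmx &
   forall x, ball x0 r x ->
    [/\ Defs.eta S x = delta_mx 0 ct *m (jac F x)^T, low V1 x = delta_mx 0 cx1 *m (jac F x)^T,
        low V2 x = delta_mx 0 cx2 *m (jac F x)^T, t1 x = - F x 0 cy1 *: low V1 x &
        t2 x = F x 0 cy2 *: low V2 x]].
Proof.
move=> Wx0; have [oW sV1 sV2 adx] := ad; have Ux0 := WU Wx0.
have [[V10 V20] _ _ _ _] := adx x0 Wx0.
(* A component of [th_i] without zeros near [x0] serves as the denominator in the factor between
   [tau_i] and [th_i]. *)
have [j1 nz1] := low_neq0 Ux0 V10; have [j2 nz2] := low_neq0 Ux0 V20.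
have sl1 := smooth_low WU weak ad sV1; have sl2 := smooth_low WU weak ad sV2.
have l1 := smooth_entry sl1 0 j1; have l2 := smooth_entry sl2 0 j2.
have near_ne f : smooth W f -> f x0 != 0 -> \forall x \near x0, f x != 0.
  move=> sf f0.
  have o : open (W `&` f @^-1` [set y : R | y != 0]).
    exact: (open_preimage_in oW (fun y Wy => smooth_continuous sf Wy) (@open_neq R 0)).
  by apply: (@filterS _ (nbhs x0) _ _ _ _ (open_nbhs_nbhs (conj o (conj Wx0 f0)))) => y [].
have nW : \forall x \near x0, W x by apply: open_nbhs_nbhs.
have [r r0 Hr] := near_norm (filterI nW (filterI (near_ne _ l1 nz1) (near_ne _ l2 nz2))).
have {}Hr x : ball x0 r x -> [/\ W x, low V1 x 0 j1 != 0 & low V2 x 0 j2 != 0].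
  by rewrite -ball_normE /ball_ /= distrC => /Hr[? [? ?]].
pose Q : set E := ball x0 r; have oQ : open Q := ball_open x0 r.
have QW : Q `<=` W by move=> x /Hr[].
have QU : Q `<=` U by move=> x /QW; exact: WU.
have Qx0 : Q x0 by exact: ballxx.
have [[[_ _ seta _ _] ceta _] _] := weak.
have [ft sft dft] := poincare (smooth_mxS QU seta) (fun x Qx i j => ceta x (QU x Qx) i j).
have [f1 sf1 df1] := poincare (smooth_mxS QW sl1) (fun x Qx i j => (adapted_low_closed i j (QW x Qx)).1).
have [f2 sf2 df2] := poincare (smooth_mxS QW sl2) (fun x Qx i j => (adapted_low_closed i j (QW x Qx)).2).
pose y1 (x : E) : R := - (t1 x 0 j1 * (low V1 x 0 j1)^-1).
pose y2 (x : E) : R := t2 x 0 j2 * (low V2 x 0 j2)^-1.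
have sy1 : smooth Q y1.
  apply: (smoothN oQ); apply: (smoothM oQ (smooth_entry (smooth_mxS QU st1) 0 j1)).
  by apply: (smoothV oQ _ (smoothS QW l1)) => x /Hr[].
have sy2 : smooth Q y2.
  apply: (smoothM oQ (smooth_entry (smooth_mxS QU st2) 0 j2)).
  by apply: (smoothV oQ _ (smoothS QW l2)) => x /Hr[].
have t1E x : Q x -> t1 x = - y1 x *: low V1 x.
  move=> Qx; have [Wx n1 _] := Hr x Qx; apply/rowP => i; rewrite [RHS]mxE /y1 opprK.
  have [/eqP + _] := tau_low oU WU weak ad tn i j1 sg0 Wx; rewrite subr_eq0 => /eqP e.
  by rewrite mulrAC -e mulfK.
have t2E x : Q x -> t2 x = y2 x *: low V2 x.
  move=> Qx; have [Wx _ n2] := Hr x Qx; apply/rowP => i; rewrite [RHS]mxE /y2.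
  have [_ /eqP] := tau_low oU WU weak ad tn i j2 sg0 Wx; rewrite subr_eq0 => /eqP e.
  by rewrite mulrAC -e mulfK.
pose F := row5 ft f1 f2 y1 y2.
have jF x i k : jac F x i k = pd i (nth (fun=> 0) [:: ft; f1; f2; y1; y2] k) x := jac_row5 _ _ _ _ _ x i k.
have row_jac x k : delta_mx 0 k *m (jac F x)^T = \row_i jac F x i k :> E.
  by rewrite -rowE; apply/rowP => i; rewrite !mxE.
exists r, F; split; [exact: r0|exact: QW|exact: (smooth_row5 sft sf1 sf2 sy1 sy2)| |].
- have [_ /(_ x0 Ux0)] := contact.
  pose P := ricci_potential S t1 t2; rewrite -/P.
  have PE x j : Q x -> P x 0 j = Defs.eta S x 0 j + y1 x * low V1 x 0 j + y2 x * low V2 x 0 j.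
    move=> Qx; rewrite /P /ricci_potential t1E // t2E // scaleNr opprK.
    by rewrite mxE [X in X + _]mxE [X in _ + X + _]mxE [X in _ + X]mxE.
  have pdP i j : pd i (fun x => P x 0 j) x0 = pd i (fun x => Defs.eta S x 0 j) x0
      + (pd i y1 x0 * low V1 x0 0 j + y1 x0 * pd i (fun x => low V1 x 0 j) x0)
      + (pd i y2 x0 * low V2 x0 0 j + y2 x0 * pd i (fun x => low V2 x 0 j) x0).
    rewrite (pd_eq i oQ Qx0 (fun x Qx => PE x j Qx)).
    have e := smooth_entry (smooth_mxS QU seta) 0 j.
    have a1 := smooth_entry (smooth_mxS QW sl1) 0 j; have a2 := smooth_entry (smooth_mxS QW sl2) 0 j.
    have m1 := smoothM oQ sy1 a1; have m2 := smoothM oQ sy2 a2.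
    rewrite (pdD (smooth_derivable (smoothD oQ e m1) Qx0) (smooth_derivable m2 Qx0)).
    rewrite (pdD (smooth_derivable e Qx0) (smooth_derivable m1 Qx0)).
    rewrite (pdM (smooth_derivable sy1 Qx0) (smooth_derivable a1 Qx0)).
    by rewrite (pdM (smooth_derivable sy2 Qx0) (smooth_derivable a2 Qx0)).
  have DE i j : ext_d P x0 i j =
      pd i y1 x0 * low V1 x0 0 j - pd j y1 x0 * low V1 x0 0 i
      + (pd i y2 x0 * low V2 x0 0 j - pd j y2 x0 * low V2 x0 0 i).
    have [] := adapted_low_closed i j Wx0; have := ceta x0 Ux0 i j.
    rewrite /ext_d !pdP.
    move: (pd i (fun x => Defs.eta S x 0 j) x0) (pd j (fun x => Defs.eta S x 0 i) x0) => b0 b0'.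
    move: (pd i (fun x => low V1 x 0 j) x0) (pd j (fun x => low V1 x 0 i) x0) => b1 b1'.
    move: (pd i (fun x => low V2 x 0 j) x0) (pd j (fun x => low V2 x 0 i) x0) => b2 b2'.
    move: (low V1 x0 0 i) (low V1 x0 0 j) (low V2 x0 0 i) (low V2 x0 0 j) => l1i l1j l2i l2j.
    move: (pd i y1 x0) (pd j y1 x0) (pd i y2 x0) (pd j y2 x0) (y1 x0) (y2 x0) => ? ? ? ? ? ?.
    move=> /eqP; rewrite subr_eq0 => /eqP -> /eqP; rewrite subr_eq0 => /eqP -> /eqP.
    by rewrite subr_eq0 => /eqP ->; ring.
  rewrite (@contact_sum R (fun i => P x0 0 i) (fun i => pd i y1 x0) (fun i => low V1 x0 0 i)
    (fun i => pd i y2 x0) (fun i => low V2 x0 0 i) (ext_d P x0) DE).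
  rewrite mulf_eq0 negb_or => /andP[_]; rewrite -unitfE -unitmxE.
  (* The rows are the potential, [dy1], [dx1], [dy2], [dx2], all combinations of the rows of the
     transposed Jacobian; invertibility of the product passes to that factor. *)
  have -> : rows5 (fun i => P x0 0 i) (fun i => pd i y1 x0) (fun i => low V1 x0 0 i)
      (fun i => pd i y2 x0) (fun i => low V2 x0 0 i) =
    mxs [:: [:: 1; y1 x0; y2 x0; 0; 0]; [:: 0; 0; 0; 1; 0]; [:: 0; 1; 0; 0; 0];
            [:: 0; 0; 0; 0; 1]; [:: 0; 0; 1; 0; 0]] *m (jac F x0)^T.
    have jT k i : (jac F x0)^T k i = pd i (nth (fun=> 0) [:: ft; f1; f2; y1; y2] k) x0.
      by rewrite mxE jF.
    apply/matrixP => k i; rewrite [RHS]mxE sum5 !jT /= dft // df1 // df2 //.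
    rewrite [LHS]mxE ![mxs _ _ _]mxE.
    by elim/ord5_ind: k => /=; rewrite ?PE //; ring.
  by rewrite unitmx_mul unitmx_tr => /andP[].
- move=> x Qx; rewrite !row_jac; split.
  + by apply/rowP => i; rewrite [RHS]mxE jF /= dft.
  + by apply/rowP => i; rewrite [RHS]mxE jF /= df1.
  + by apply/rowP => i; rewrite [RHS]mxE jF /= df2.
  + by rewrite t1E // /F /row5 [X in _ = - X *: _]mxE.
  + by rewrite t2E // /F /row5 [X in _ = X *: _]mxE.
Qed.

End DarbouxMap.

(** * Normal charts *)

Section NormalChart.
Context {R : realType} {M : topologicalType}.
Local Notation E := 'rV[R]_5.
Variables (sigma : R) (A : set (chart R M 4)) (S : chart R M 4 -> pcstruct R 4)
  (tau1 tau2 : chart R M 4 -> E -> E).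
Hypothesis sg0 : sigma != 0.
Hypotheses (mA : smooth_manifold A) (fS : structure_field A S).
Hypotheses (f1 : covector_field A tau1) (f2 : covector_field A tau2).
Hypothesis good : forall c, A c ->
  [/\ weakly_para_cosymplectic (cimg c) (S c),
      sigma_type sigma (cimg c) (S c),
      tau_forms sigma (cimg c) (S c) (tau1 c) (tau2 c) &
      contact_form (cimg c) (ricci_potential (S c) (tau1 c) (tau2 c))].

(** The adapted pair in the new chart is the push-forward of the one used to build it. The pairs
    that [sigma_type] offers there might live on smaller sets and differ in sign, and would not
    lower to [dx1] and [dx2]. *)
Lemma normal_chart p : exists (d : chart R M 4) (y0 : E) (r : R) (V1 V2 : E -> E),
  [/\ A d, cdom d p, cimg d = ball y0 r, adapted_pair (S d) sigma (cimg d) V1 V2 &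
   forall y, cimg d y ->
    [/\ Defs.eta (S d) y = delta_mx 0 ct, low (S d) V1 y = delta_mx 0 cx1,
        low (S d) V2 y = delta_mx 0 cx2, tau1 d y = - y 0 cy1 *: delta_mx 0 cx1 &
        tau2 d y = y 0 cy2 *: delta_mx 0 cx2]].
Proof.
have [_ chA cover _ _] := mA; have [c Ac cp] := cover p.
have [wc stc [st1 st2 tfc] cc] := good Ac; have [_ oIc _ _ _] := chA c Ac.
have Ip : cimg c (ccoord c p) by exists p.
have [W [V1 [V2 [Wp WI ad]]]] := stc _ Ip.
have [r0 [F [r00 BW sF uF Fx]]] := darboux_map oIc WI sg0 wc ad st1 st2 (tfc W V1 V2 WI ad) cc Wp.
have oV : open (ball (ccoord c p) r0) by exact: ball_open.
have [d [D [r [h [Ad dp oD DV [Id dc FD hB sh]]]]]] :=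
  coordinate_change mA Ac oV (subset_trans BW WI) sF cp (ballxx _ r00) uF.
set y0 := F (ccoord c p) in Id FD hB sh.
have [wd _ [_ _ tfd] _] := good Ad.
have JE x : D x -> jac (trans c d) x = jac F x.
  move=> Dx; apply/matrixP => i k; rewrite !mxE; apply: (pd_eq i oD Dx) => z Dz.
  by have [_ _ ->] := FD z Dz.
have [oW sV1 sV2 adW] := ad.
have [[[_ sxic _ [_ gTuc] _] _ _] _] := wc.
have [[[_ sxid _ prd _] _ _] _] := wd; rewrite Id in sxid prd.
have rel (y : E) : ball y0 r y ->
  [/\ D (h y), F (h y) = y, W (h y), met (S c) (h y) \in unitmx &
   [/\ xi (S d) y = xi (S c) (h y) *m jac F (h y),
      phi (S c) (h y) *m jac F (h y) = jac F (h y) *m phi (S d) y,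
      met (S c) (h y) = jac F (h y) *m met (S d) y *m (jac F (h y))^T,
      Defs.eta (S c) (h y) = Defs.eta (S d) y *m (jac F (h y))^T &
      tau1 c (h y) = tau1 d y *m (jac F (h y))^T /\ tau2 c (h y) = tau2 d y *m (jac F (h y))^T]].
  move=> By; have [Dh Fh [q [dq cq qh qy]]] := hB y By.
  have [_ gu] := gTuc _ (WI _ (BW _ (DV _ Dh))).
  have [e1 e2] := fS; have := e2 c d q Ac Ad cq dq; have := e1 c d q Ac Ad cq dq.
  have := f1 Ac Ad cq dq; have := f2 Ac Ad cq dq; rewrite /= qh qy (JE _ Dh) => h1 h2 h3 [h4 h5 h6].
  by split=> //; exact: BW (DV _ Dh).
have FB x : D x -> ball y0 r (F x) by move=> /FD[].
have hF x : D x -> h (F x) = x by move=> /FD[].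
have DW x : D x -> W x by move=> /DV /BW.
have sFD : smooth_mx D F := smooth_mxS DV sF.
have gu x : D x -> met (S c) x \in unitmx by move=> Dx; have [] := gTuc _ (WI _ (DW _ Dx)).
have gE x : D x -> met (S c) x = jac F x *m met (S d) (F x) *m (jac F x)^T.
  by move=> Dx; have [_ _ _ _ [_ _ + _ _]] := rel _ (FB x Dx); rewrite hF.
have xiE x : D x -> xi (S c) x *m jac F x = xi (S d) (F x).
  by move=> Dx; have [_ _ _ _ [-> _ _ _ _]] := rel _ (FB x Dx); rewrite hF.
have oB : open (ball y0 r) by exact: ball_open.
have uJ := jac_unit gu gE.
have sxiD : smooth_mx D (xi (S c)) := smooth_mxS (subset_trans DW WI) sxic.
have sJ : smooth_mx (ball y0 r) (fun y => jac F (h y)).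
  by apply: (smooth_mx_comp oB oD (smooth_jac sFD) _ sh) => y By; have [] := rel y By.
pose V' (V : E -> E) (y : E) : E := V (h y) *m jac F (h y).
have sV' V : smooth_mx W V -> smooth_mx (ball y0 r) (V' V).
  move=> sV; apply: (smooth_mxM oB _ sJ).
  by apply: (smooth_mx_comp oB oW sV _ sh) => y By; have [] := rel y By.
have V'0 V y : ball y0 r y -> V (h y) != 0 -> V' V y != 0.
  move=> By; have [Dh _ _ _ _] := rel y By; apply: contra => /eqP e.
  by rewrite -(mulmxK (uJ _ Dh) (V (h y))) -/(V' V y) e mul0mx.
have bil' v w y : ball y0 r y ->
    bil (met (S d) y) (v *m jac F (h y)) (w *m jac F (h y)) = bil (met (S c) (h y)) v w.
  by move=> By; have [_ _ _ _ [_ _ -> _ _]] := rel y By; rewrite /bil trmx_mul !mulmxA.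
exists d, y0, r, (V' V1), (V' V2); split; [exact: Ad|exact: dp|exact: Id| |].
  rewrite Id; split; [exact: oB|exact: sV'|exact: sV'|] => y By.
  have [Dh Fh Wh _ [_ phiE _ _ _]] := rel y By.
  have [[V10 V20] h1 h2 h3 h4] := adW _ Wh.
  split.
  - by split; exact: V'0.
  - by rewrite /V' -mulmxA -phiE mulmxA h1 mulNmx.
  - by rewrite /V' -mulmxA -phiE mulmxA h2.
  - by rewrite bil'.
  - move=> v; have -> : v = v *m invmx (jac F (h y)) *m jac F (h y) by rewrite mulmxKV // uJ.
    move: (v *m invmx _) => {}v; rewrite !bil' //.
    have := nabla_transport oD oB sFD FB prd gu gE v Dh sxiD sxid xiE.
    rewrite Fh /Defs.shape => <-; rewrite -mulNmx -/(Defs.shape (S c) (h y) v) h4.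
    by rewrite mulmxDl -!scalemxAl.
rewrite Id => y By.
have [Dh Fh Wh _ [_ _ gEy etaE [t1E t2E]]] := rel y By.
have [a0 a1 a2 a3 a4] := Fx _ (DV _ Dh).
have uJT : (jac F (h y))^T \in unitmx by rewrite unitmx_tr uJ.
have inj (u v : E) : u *m (jac F (h y))^T = v *m (jac F (h y))^T -> u = v.
  by move=> e; rewrite -(mulmxK uJT u) e mulmxK.
have lowE V : low (S d) (V' V) y *m (jac F (h y))^T = low (S c) V (h y).
  by rewrite /low /V' gEy !mulmxA.
split; apply: inj.
- by rewrite -etaE a0.
- by rewrite lowE a1.
- by rewrite lowE a2.
- by rewrite -t1E a3 Fh a1 scalemxAl.
- by rewrite -t2E a4 Fh a2 scalemxAl.
Qed.

End NormalChart.

(* Eliminating [P] between the two equations by cross differentiation leaves [s m = 0]. *)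
Lemma twisted_gradient {R : realType} {n : nat} (U : set 'rV[R]_n.+1) (m f P : 'rV[R]_n.+1 -> R)
    (i k l : 'I_n.+1) (c s : R) : open U -> smooth U m -> smooth U f -> smooth U P -> l != k ->
  (forall x, U x -> pd k m x = pd l f x) ->
  (forall x, U x -> pd i m x - pd l P x = c + s * (x 0 k * m x)) ->
  (forall x, U x -> pd i f x - pd k P x = s * (x 0 k * f x)) ->
  forall x, U x -> s * m x = 0.
Proof.
move=> oU sm sf sP lk H1 H2 H3 x Ux.
have sc := smooth_coord k oU.
have scm := smoothM oU sc sm; have scf := smoothM oU sc sf.
have ss := smooth_cst s oU; have sC := smooth_cst c oU.
have := pd_eq k oU Ux H2; have := pd_eq l oU Ux H3.
rewrite (pdB (smooth_derivable (smooth_pd i sf) Ux) (smooth_derivable (smooth_pd k sP) Ux)).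
rewrite (pdB (smooth_derivable (smooth_pd i sm) Ux) (smooth_derivable (smooth_pd l sP) Ux)).
rewrite (pdD (smooth_derivable sC Ux) (smooth_derivable (smoothM oU ss scm) Ux)).
rewrite (pdM (smooth_derivable ss Ux) (smooth_derivable scm Ux)).
rewrite (pdM (smooth_derivable ss Ux) (smooth_derivable scf Ux)).
rewrite (pdM (smooth_derivable sc Ux) (smooth_derivable sm Ux)).
rewrite (pdM (smooth_derivable sc Ux) (smooth_derivable sf Ux)).
rewrite !pd_cst !pd_coord (negPf lk) eqxx (H1 x Ux).
rewrite (smooth_schwarz i k oU sm Ux) (pd_eq i oU Ux H1) -(smooth_schwarz i l oU sf Ux).
rewrite (smooth_schwarz k l oU sP Ux).
rewrite /= !mul0r !add0r mul1r mulrDr => -> h; lra.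
Qed.

(** * The metric and [phi] in normal coordinates *)

Section NormalMetric.
Context {R : realType}.
Local Notation E := 'rV[R]_5.
Local Notation M := 'M[R]_5.
Variables (sigma : R) (Q : set E) (S : pcstruct R 4) (V1 V2 t1 t2 : E -> E).
Hypothesis oQ : open Q.
Hypothesis weak : weakly_para_cosymplectic Q S.
Hypothesis ad : adapted_pair S sigma Q V1 V2.
Hypothesis tn : forall x, Q x -> forall v : E,
  nabla (met S) (fun=> v) V1 x = ev (t1 x) v *: V1 x /\
  nabla (met S) (fun=> v) V2 x = ev (t2 x) v *: V2 x.
Hypothesis nf : forall y, Q y ->
  [/\ Defs.eta S y = delta_mx 0 ct, low S V1 y = delta_mx 0 cx1, low S V2 y = delta_mx 0 cx2,
      t1 y = - y 0 cy1 *: delta_mx 0 cx1 & t2 y = y 0 cy2 *: delta_mx 0 cx2].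

Let QQ : Q `<=` Q. Proof. by []. Qed.
Let pr : pseudo_riemannian Q (met S). Proof. by have [[[_ _ _ ? _] _ _] _] := weak. Qed.
Let gT x : Q x -> (met S x)^T = met S x. Proof. by have [_ h] := pr; move=> /h[]. Qed.
Let gu x : Q x -> met S x \in unitmx. Proof. by have [_ h] := pr; move=> /h[]. Qed.
Let sV1 : smooth_mx Q V1. Proof. by case: ad. Qed.
Let sV2 : smooth_mx Q V2. Proof. by case: ad. Qed.
Local Notation g i j := (fun x => met S x i j).

Lemma smooth_g i j : smooth Q (g i j).
Proof. by have [sg _] := pr; exact: (smooth_entry sg i j). Qed.

Lemma gC x i j : Q x -> met S x i j = met S x j i.
Proof. by move=> Qx; rewrite -[in LHS](gT Qx) mxE. Qed.

Lemma delta_sum (k : 'I_5) (f : 'I_5 -> R) : \sum_j (delta_mx 0 k : E) 0 j * f j = f k.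
Proof.
rewrite (bigD1 k) //= big1 => [|j jk]; first by rewrite mxE !eqxx mul1r addr0.
by rewrite mxE (negPf jk) andbF mul0r.
Qed.

(** The form [th_1 = dx1] has constant components, so [pd_low] reads
    [0 = tau1_i (dx1)_j + Gamma_ij^x1]. *)
Lemma chr_x1 x i j : Q x -> chr (met S) x i j cx1 = x 0 cy1 * ((i == cx1) && (j == cx1))%:R.
Proof.
move=> Qx; have [_ l1 _ t1E _] := nf Qx.
have := pd_low QQ weak ad i j sV1 Qx (fun v => (tn Qx v).1).
rewrite l1 delta_sum t1E (pd_eq (g := fun=> (delta_mx 0 cx1 : E) 0 j) i oQ Qx); last first.
  by move=> y Qy; have [_ -> _ _ _] := nf Qy.
rewrite pd_cst !mxE eqxx /= => /eqP; rewrite eq_sym addr_eq0 => /eqP h.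
apply: (oppr_inj (esym _)); rewrite -h -mulrA -natrM mulnb mulNr; exact.
Qed.

Lemma chr_x2 x i j : Q x -> chr (met S) x i j cx2 = - x 0 cy2 * ((i == cx2) && (j == cx2))%:R.
Proof.
move=> Qx; have [_ _ l2 _ t2E] := nf Qx.
have := pd_low QQ weak ad i j sV2 Qx (fun v => (tn Qx v).2).
rewrite l2 delta_sum t2E (pd_eq (g := fun=> (delta_mx 0 cx2 : E) 0 j) i oQ Qx); last first.
  by move=> y Qy; have [_ _ -> _ _] := nf Qy.
rewrite pd_cst !mxE eqxx /= => /eqP; rewrite eq_sym addr_eq0 => /eqP h.
apply: (oppr_inj (esym _)); rewrite -h -mulrA -natrM mulnb mulNr opprK; exact.
Qed.

Lemma lower_xiE x : Q x -> xi S x *m met S x = delta_mx 0 ct.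
Proof.
by move=> Qx; have [<- _ _ _ _] := nf Qx; have [[[_ _ _ _ /(_ x Qx) pc] _ _] _] := weak; exact: (lower_xi pc).
Qed.

(** Here [eta = dt] has constant components, which leaves [Gamma_ij^t = - g(nabla_i xi, d_j) = g(A
    d_i, d_j)]. *)
Lemma chr_t x i j : Q x -> chr (met S) x i j ct =
  ((i == cx1) && (j == cx1))%:R + sigma * ((i == cx2) && (j == cx2))%:R.
Proof.
move=> Qx; have [_ l1 l2 _ _] := nf Qx.
have sxi : smooth_mx Q (xi S) by have [[[_ ? _ _ _] _ _] _] := weak.
have := pdmx_lower i oQ Qx sxi pr.
rewrite (pdmx_eq i oQ Qx lower_xiE) pdmx_cst (nabla_xi QQ weak ad i Qx) (lower_xiE Qx).
rewrite mulNmx mulmxDl -!scalemxAl -!/(low S _ x) l1 l2.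
move=> /rowP/(_ j); rewrite [RHS]mxE -rowE [X in _ + X]mxE [X in _ + X]mxE !mxE eqxx /=.
move=> /eqP; rewrite eq_sym addrC subr_eq0 => /eqP ->.
by rewrite -!mulnb !natrM mulrA.
Qed.

Lemma bil_low (V : E -> E) k x w : low S V x = delta_mx 0 k -> bil (met S x) (V x) w = w 0 k.
Proof. by move=> l; rewrite /bil -/(low S V x) l -rowE !mxE. Qed.

(** [V1] and [V2] are killed by [eta], null and mutually orthogonal, so they have no [t], [x1], [x2]
    components and span the plane of [d/dy1], [d/dy2]. Lowered, that plane is spanned by [dx1] and
    [dx2]. *)
Lemma met_dy x : Q x -> [/\ met S x cy1 ct = 0, met S x cy2 ct = 0, met S x cy1 cy1 = 0,
   met S x cy1 cy2 = 0 & met S x cy2 cy2 = 0] /\ met S x ct ct = 1.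
Proof.
move=> Qx; have [etaE l1 l2 _ _] := nf Qx.
have [[[_ _ _ _ /(_ x Qx) pc] _ _] _] := weak.
have [_ _ _ /(_ x Qx) [[V10 V20] h1 h2 h3 _]] := ad.
have h1' : V1 x *m phi S x = (-1) *: V1 x by rewrite h1 scaleN1r.
have h2' : V2 x *m phi S x = 1 *: V2 x by rewrite h2 scale1r.
have n1 : (-1 : R) != 0 by rewrite oppr_eq0 oner_eq0.
have [a0 a1] := eigen_null (gT Qx) (gu Qx) pc n1 h1' h1'.
have [b0 b2] := eigen_null (gT Qx) (gu Qx) pc (oner_neq0 _) h2' h2'.
rewrite etaE ev_delta in a0; rewrite etaE ev_delta in b0.
rewrite (bil_low _ l1) in a1; rewrite (bil_low _ l2) in b2.
have b1 : V2 x 0 cx1 = 0 by rewrite -(bil_low _ l1).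
have a2 : V1 x 0 cx2 = 0 by rewrite -(bil_low _ l2) (bilC (gT Qx)).
have E1 j : V1 x 0 cy1 * met S x cy1 j + V1 x 0 cy2 * met S x cy2 j = (delta_mx 0 cx1 : E) 0 j.
  by rewrite -l1 /low mxE sum5 a0 a1 a2 !mul0r !add0r.
have E2 j : V2 x 0 cy1 * met S x cy1 j + V2 x 0 cy2 * met S x cy2 j = (delta_mx 0 cx2 : E) 0 j.
  by rewrite -l2 /low mxE sum5 b0 b1 b2 !mul0r !add0r.
(* The determinant of [V1], [V2] in the [y] plane; it is nonzero because eigenvectors for -1 and 1
   are independent. *)
pose dl := V1 x 0 cy1 * V2 x 0 cy2 - V2 x 0 cy1 * V1 x 0 cy2.
have dl0 : dl != 0.
  apply/eqP => d0.
  have k1 : V2 x 0 cy2 *: V1 x + (- V1 x 0 cy2) *: V2 x = 0.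
    by apply/rowP; elim/ord5_ind; rewrite !mxE ?a0 ?a1 ?a2 ?b0 ?b1 ?b2; move: d0; rewrite /dl; lra.
  have k2 : V2 x 0 cy1 *: V1 x + (- V1 x 0 cy1) *: V2 x = 0.
    by apply/rowP; elim/ord5_ind; rewrite !mxE ?a0 ?a1 ?a2 ?b0 ?b1 ?b2; move: d0; rewrite /dl; lra.
  have [_ /eqP] := eigen_free V10 V20 h1 h2 k1; rewrite oppr_eq0 => /eqP z1.
  have [_ /eqP] := eigen_free V10 V20 h1 h2 k2; rewrite oppr_eq0 => /eqP z2.
  by move/eqP: V10; apply; apply/rowP; elim/ord5_ind; rewrite mxE.
have z j : j != cx1 -> j != cx2 -> met S x cy1 j = 0 /\ met S x cy2 j = 0.
  move=> j1 j2; have := E1 j; have := E2 j; rewrite !mxE (negPf j1) (negPf j2) /= => e2 e1.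
  split; apply: (mulfI dl0); rewrite mulr0 /dl.
    transitivity (V2 x 0 cy2 * (V1 x 0 cy1 * met S x cy1 j + V1 x 0 cy2 * met S x cy2 j)
      - V1 x 0 cy2 * (V2 x 0 cy1 * met S x cy1 j + V2 x 0 cy2 * met S x cy2 j)); first by ring.
    by rewrite e1 e2; ring.
  transitivity (V1 x 0 cy1 * (V2 x 0 cy1 * met S x cy1 j + V2 x 0 cy2 * met S x cy2 j)
    - V2 x 0 cy1 * (V1 x 0 cy1 * met S x cy1 j + V1 x 0 cy2 * met S x cy2 j)); first by ring.
  by rewrite e1 e2; ring.
have [z1 z2] := z ct isT isT; have [z3 _] := z cy1 isT isT; have [z4 z5] := z cy2 isT isT.
split=> //.
have x0 : xi S x 0 ct = 1 by have [_ + _ _] := pc 0 0; rewrite etaE ev_delta.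
have x1 : xi S x 0 cx1 = 0.
  rewrite -(bil_low (xi S x) l1) (bilC (gT Qx)).
  by rewrite /bil lower_xiE // -rowE !mxE.
have x2 : xi S x 0 cx2 = 0.
  rewrite -(bil_low (xi S x) l2) (bilC (gT Qx)).
  by rewrite /bil lower_xiE // -rowE !mxE.
have := lower_xiE Qx => /rowP/(_ ct); rewrite mxE sum5 x0 x1 x2 z1 z2 !mxE /=.
by move=> h; move: h; lra.
Qed.

(** For these [l], the unknown symbols with upper index [y1], [y2] are multiplied by zero entries of
    the metric, so the lowered symbol is known. *)
Lemma pd_met i j l x : Q x -> l \in [:: ct; cy1; cy2] ->
  pd i (g j l) x + pd j (g i l) x - pd l (g i j) x =
  2 * (((i == cx1) && (j == cx1))%:R * (met S x ct l + x 0 cy1 * met S x cx1 l)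
     + ((i == cx2) && (j == cx2))%:R * (sigma * met S x ct l - x 0 cy2 * met S x cx2 l)).
Proof.
move=> Qx li.
have [[z1 z2 z3 z4 z5] _] := met_dy Qx; have z6 := z4; rewrite gC // in z6.
have [w1 w2] : met S x cy1 l = 0 /\ met S x cy2 l = 0.
  by move: li; rewrite !inE => /or3P[] /eqP ->.
apply: (mulfI (_ : 2^-1 != 0 :> R)); first by rewrite invr_eq0 pnatr_eq0.
rewrite -(chr_lower i j l (gT Qx) (gu Qx)) mulKf ?pnatr_eq0 //.
rewrite mxE sum5 w1 w2 chr_t // chr_x1 // chr_x2 //.
by move: (met S x ct l) (met S x cx1 l) (met S x cx2 l) => *; ring.
Qed.

Lemma pd_met_cst i j k c x : Q x -> (forall y, Q y -> met S y j k = c) -> pd i (g j k) x = 0.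
Proof. by move=> Qx gc; rewrite (pd_eq i oQ Qx gc) pd_cst. Qed.

(** For [j = cx1] and [cx2] these are the entries [p] and [q] of [coframe], as
    [cof *m frame_gram *m cof^T] has the diagonal entries [2 p] and [2 q] there. *)
Definition half_g j x : R := 2^-1 * met S x j j.

Lemma smooth_half_g j : smooth Q (half_g j).
Proof. exact: (smoothM oQ (smooth_cst _ oQ) (smooth_g j j)). Qed.

Lemma pd_half_g i j x : Q x -> pd i (half_g j) x = 2^-1 * pd i (g j j) x.
Proof.
move=> Qx; rewrite /half_g (pdM (smooth_derivable (smooth_cst _ oQ) Qx) (smooth_derivable (smooth_g j j) Qx)).
by rewrite pd_cst mul0r add0r.
Qed.

Lemma pd_met_y l k j x : Q x -> k \in [:: cy1; cy2] -> l \in [:: ct; cy1; cy2] ->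
  pd k (g j l) x = pd l (g j k) x.
Proof.
move=> Qx kin lin.
have kl0 y : Q y -> met S y k l = 0.
  move=> Qy; have [[z1 z2 z3 z4 z5] _] := met_dy Qy; have z6 := z4; rewrite gC // in z6.
  by move: kin lin; rewrite !inE => /orP[] /eqP -> /or3P[] /eqP ->.
have := pd_met j k Qx lin; rewrite (pd_met_cst j Qx kl0) add0r.
have -> : (k == cx1) = false by move: kin; rewrite !inE => /orP[] /eqP ->.
have -> : (k == cx2) = false by move: kin; rewrite !inE => /orP[] /eqP ->.
by rewrite !andbF !mul0r addr0 mulr0 => /eqP; rewrite subr_eq0 => /eqP.
Qed.

Lemma pd_met_x1 l x : Q x -> l \in [:: ct; cy1; cy2] ->
  pd cx1 (g cx1 l) x - pd l (half_g cx1) x = (l == ct)%:R + 1 * (x 0 cy1 * met S x cx1 l).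
Proof.
move=> Qx lin; have := pd_met cx1 cx1 Qx lin; rewrite pd_half_g //= !mul0r addr0.
have [[z1 z2 z3 z4 z5] z6] := met_dy Qx.
have -> : met S x ct l = (l == ct)%:R.
  by move: lin; rewrite !inE => /or3P[] /eqP ->; rewrite ?eqxx ?z6 // gC.
by move: (pd cx1 (g cx1 l) x) (pd l (g cx1 cx1) x) => *; lra.
Qed.

Lemma pd_met_x2 l x : Q x -> l \in [:: ct; cy1; cy2] ->
  pd cx2 (g cx2 l) x - pd l (half_g cx2) x = sigma * (l == ct)%:R + (- 1) * (x 0 cy2 * met S x cx2 l).
Proof.
move=> Qx lin; have := pd_met cx2 cx2 Qx lin; rewrite pd_half_g //= !mul0r add0r.
have [[z1 z2 z3 z4 z5] z6] := met_dy Qx.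
have -> : met S x ct l = (l == ct)%:R.
  by move: lin; rewrite !inE => /or3P[] /eqP ->; rewrite ?eqxx ?z6 // gC.
by move: (pd cx2 (g cx2 l) x) (pd l (g cx2 cx2) x) => *; lra.
Qed.

(** Instances of [twisted_gradient]: for [x1], [m = g_(x1 l)], [f = g_(x1 y1)], [P = g_(x1 x1) / 2]
    and [s = 1]; for [x2] the analogue with [y2] and [s = -1]. The twist is the factor [y_i] of
    [tau_i]. *)
Lemma met_vanish x : Q x ->
  [/\ met S x cx1 ct = 0, met S x cx1 cy2 = 0, met S x cx2 ct = 0 & met S x cx2 cy1 = 0].
Proof.
have sgj := smooth_g; have sh := smooth_half_g.
have v1 l : l \in [:: ct; cy2] -> forall y, Q y -> 1 * met S y cx1 l = 0.
  move=> lin; have lin' : l \in [:: ct; cy1; cy2].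
    by move: lin; rewrite !inE => /orP[] /eqP ->.
  apply: (twisted_gradient (k := cy1) (l := l) (i := cx1) (c := (l == ct)%:R) oQ
    (sgj cx1 l) (sgj cx1 cy1) (sh cx1)).
  - by move: lin; rewrite !inE => /orP[] /eqP ->.
  - by move=> y Qy; rewrite (@pd_met_y l cy1 cx1 y Qy).
  - by move=> y Qy; exact: pd_met_x1.
  - by move=> y Qy; rewrite (@pd_met_x1 cy1 y Qy) // add0r.
have v2 l : l \in [:: ct; cy1] -> forall y, Q y -> -1 * met S y cx2 l = 0.
  move=> lin; have lin' : l \in [:: ct; cy1; cy2].
    by move: lin; rewrite !inE => /orP[] /eqP ->.
  apply: (twisted_gradient (k := cy2) (l := l) (i := cx2) (c := sigma * (l == ct)%:R) oQ
    (sgj cx2 l) (sgj cx2 cy2) (sh cx2)).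
  - by move: lin; rewrite !inE => /orP[] /eqP ->.
  - by move=> y Qy; rewrite (@pd_met_y l cy2 cx2 y Qy).
  - by move=> y Qy; exact: pd_met_x2.
  - by move=> y Qy; rewrite (@pd_met_x2 cy2 y Qy) // mulr0 add0r.
move=> Qx; split.
- by rewrite -[LHS]mul1r; exact: (v1 ct).
- by rewrite -[LHS]mul1r; exact: (v1 cy2).
- by apply/oppr_inj; rewrite oppr0 -mulN1r; exact: (v2 ct).
- by apply/oppr_inj; rewrite oppr0 -mulN1r; exact: (v2 cy1).
Qed.

Lemma normal_met x : Q x -> met S x = mxs
  [:: [:: 1; 0; 0; 0; 0]; [:: 0; 2 * half_g cx1 x; met S x cx1 cx2; met S x cx1 cy1; 0];
      [:: 0; met S x cx1 cx2; 2 * half_g cx2 x; 0; met S x cx2 cy2];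
      [:: 0; met S x cx1 cy1; 0; 0; 0]; [:: 0; 0; met S x cx2 cy2; 0; 0]].
Proof.
move=> Qx; have [[z1 z2 z3 z4 z5] z6] := met_dy Qx; have [v1 v2 v3 v4] := met_vanish Qx.
have c i j : met S x i j = met S x j i := gC i j Qx.
have hE j : 2 * half_g j x = met S x j j by rewrite /half_g mulVKf // pnatr_eq0.
rewrite !hE; apply/matrixP; elim/ord5_ind; elim/ord5_ind; rewrite [RHS]mxE //=; by rewrite c.
Qed.

Lemma pd_vanish i l x : Q x -> (l \in [:: ct; cy2] -> pd i (g cx1 l) x = 0) /\
  (l \in [:: ct; cy1] -> pd i (g cx2 l) x = 0).
Proof.
move=> Qx; split; rewrite !inE => /orP[] /eqP ->; apply: (pd_met_cst (c := 0) i Qx) => y Qy;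
  by have [v1 v2 v3 v4] := met_vanish Qy.
Qed.

Lemma normal_pd_x1 x : Q x ->
  [/\ pd ct (g cx1 cy1) x = 0, pd cy2 (g cx1 cy1) x = 0, pd ct (half_g cx1) x = -1,
      pd cy2 (half_g cx1) x = 0 &
      pd cy1 (half_g cx1) x = pd cx1 (g cx1 cy1) x - x 0 cy1 * met S x cx1 cy1].
Proof.
move=> Qx; have v i l (lin : l \in [:: ct; cy2]) := (pd_vanish i l Qx).1 lin.
have [w1 w2 _ _] := met_vanish Qx.
have e1 := pd_met_x1 Qx (isT : ct \in [:: ct; cy1; cy2]).
have e2 := pd_met_x1 Qx (isT : cy1 \in [:: ct; cy1; cy2]).
have e3 := pd_met_x1 Qx (isT : cy2 \in [:: ct; cy1; cy2]).
rewrite v //= w1 in e1; rewrite v //= w2 in e3; rewrite /= in e2.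
have y1 := @pd_met_y ct cy1 cx1 x Qx isT isT; have y2 := @pd_met_y cy2 cy1 cx1 x Qx isT isT.
rewrite v // in y1; rewrite v // in y2; split; [exact: esym y1|exact: esym y2| | |].
- by move: e1; clear e2 e3 y1 y2; move: (pd ct (half_g cx1) x) => *; lra.
- by move: e3; clear e1 e2 y1 y2; move: (pd cy2 (half_g cx1) x) => *; lra.
- by move: e2; clear e1 e3 y1 y2; move: (pd cy1 (half_g cx1) x) (pd cx1 (g cx1 cy1) x) => *; lra.
Qed.

Lemma normal_pd_x2 x : Q x ->
  [/\ pd ct (g cx2 cy2) x = 0, pd cy1 (g cx2 cy2) x = 0, pd ct (half_g cx2) x = - sigma,
      pd cy1 (half_g cx2) x = 0 &
      pd cy2 (half_g cx2) x = pd cx2 (g cx2 cy2) x + x 0 cy2 * met S x cx2 cy2].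
Proof.
move=> Qx; have v i l (lin : l \in [:: ct; cy1]) := (pd_vanish i l Qx).2 lin.
have [_ _ w1 w2] := met_vanish Qx.
have e1 := pd_met_x2 Qx (isT : ct \in [:: ct; cy1; cy2]).
have e2 := pd_met_x2 Qx (isT : cy1 \in [:: ct; cy1; cy2]).
have e3 := pd_met_x2 Qx (isT : cy2 \in [:: ct; cy1; cy2]).
rewrite v //= w1 in e1; rewrite v //= w2 in e2; rewrite /= in e3.
have y1 := @pd_met_y ct cy2 cx2 x Qx isT isT; have y2 := @pd_met_y cy1 cy2 cx2 x Qx isT isT.
rewrite v // in y1; rewrite v // in y2; split; [exact: esym y1|exact: esym y2| | |].
- by move: e1; clear e2 e3 y1 y2; move: (pd ct (half_g cx2) x) => *; lra.
- by move: e2; clear e1 e3 y1 y2; move: (pd cy1 (half_g cx2) x) => *; lra.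
- by move: e3; clear e1 e2 y1 y2; move: (pd cy2 (half_g cx2) x) (pd cx2 (g cx2 cy2) x) => *; lra.
Qed.

Lemma normal_pd_x12 x : Q x ->
  [/\ pd ct (g cx1 cx2) x = 0, pd cy1 (g cx1 cx2) x = pd cx2 (g cx1 cy1) x &
      pd cy2 (g cx1 cx2) x = pd cx1 (g cx2 cy2) x].
Proof.
move=> Qx; have v1 i l (lin : l \in [:: ct; cy2]) := (pd_vanish i l Qx).1 lin.
have v2 i l (lin : l \in [:: ct; cy1]) := (pd_vanish i l Qx).2 lin.
have e1 := pd_met cx1 cx2 Qx (isT : ct \in [:: ct; cy1; cy2]).
have e2 := pd_met cx1 cx2 Qx (isT : cy1 \in [:: ct; cy1; cy2]).
have e3 := pd_met cx1 cx2 Qx (isT : cy2 \in [:: ct; cy1; cy2]).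
rewrite (v1 cx2 ct isT) (v2 cx1 ct isT) /= in e1; rewrite (v2 cx1 cy1 isT) /= in e2.
rewrite (v1 cx2 cy2 isT) /= in e3; split.
- by move: e1; clear e2 e3; move: (pd ct (g cx1 cx2) x) => *; lra.
- by move: e2; clear e1 e3; move: (pd cy1 (g cx1 cx2) x) (pd cx2 (g cx1 cy1) x) => *; lra.
- by move: e3; clear e1 e2; move: (pd cy2 (g cx1 cx2) x) (pd cx1 (g cx2 cy2) x) => *; lra.
Qed.

Lemma normal_neq0 x : Q x -> met S x cx1 cy1 != 0 /\ met S x cx2 cy2 != 0.
Proof.
move=> Qx; have inj (k : 'I_5) : row k (met S x) != 0.
  apply/eqP => r0; have : (delta_mx 0 k : E) *m met S x *m invmx (met S x) = 0 by rewrite -rowE r0 mul0mx.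
  rewrite mulmxK ?gu // => /rowP/(_ k)/eqP; by rewrite !mxE !eqxx oner_eq0.
by split; [move: (inj cy1)|move: (inj cy2)]; apply: contra => /eqP z; rewrite normal_met // z;
  apply/eqP/rowP; elim/ord5_ind; rewrite !mxE.
Qed.

(** Skewness against [V1], [V2] gives the columns [cx1], [cx2], and the multiples [d/dy_i] of [V_i]
    give the rows [cy1], [cy2]. Here [r] and [s] are free because they add to a form of the coframe
    another one with the same [phi]-eigenvalue. *)
Lemma normal_phi x r s : Q x ->
  let cof := coframe (met S x cx1 cy1) (met S x cx2 cy2) (half_g cx1 x) (half_g cx2 x) r s in
  phi S x *m cof = cof *m frame_phi.
Proof.
move=> Qx /=; have [etaE l1 l2 _ _] := nf Qx.
have [a0 b0] := normal_neq0 Qx; have gE := normal_met Qx.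
have [[[_ _ _ _ /(_ x Qx) pc] _ _] _] := weak.
have [_ _ _ /(_ x Qx) [_ h1 h2 _ _]] := ad.
have skew := phi_skew (gT Qx) (gu Qx) pc.
have low_inj (v w : E) : v *m met S x = w *m met S x -> v = w.
  by move=> e; rewrite -(mulmxK (gu Qx) v) e mulmxK // gu.
have xiE : xi S x = delta_mx 0 ct.
  by apply: low_inj; rewrite lower_xiE // gE; apply/rowP; elim/ord5_ind; rewrite -rowE !mxE.
set P := phi S x in pc skew h1 h2 *.
set a := met S x cx1 cy1 in a0 gE *; set b := met S x cx2 cy2 in b0 gE *.
set p := half_g cx1 x in gE *; set q := half_g cx2 x in gE *.
have p0 k : P ct k = 0.
  have := phi_xi (gT Qx) (gu Qx) pc; rewrite xiE -rowE => /rowP/(_ k).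
  by rewrite !mxE.
have pt i : P i ct = 0.
  have := eta_phi (gT Qx) (gu Qx) pc (delta_mx 0 i).
  by rewrite etaE ev_delta -rowE !mxE.
have px1 i : P i cx1 = (i == cx1)%:R.
  have := skew (V1 x) (delta_mx 0 i); rewrite h1 bilNl !(bil_low _ l1) => /oppr_inj.
  by rewrite -rowE !mxE eqxx eq_sym.
have px2 i : P i cx2 = - (i == cx2)%:R.
  have := skew (V2 x) (delta_mx 0 i); rewrite h2 !(bil_low _ l2) -rowE !mxE eqxx eq_sym /=.
  by move=> ->; rewrite opprK.
have py1 k : P cy1 k = - (k == cy1)%:R.
  have e : a *: V1 x = delta_mx 0 cy1.
    apply: low_inj; rewrite -scalemxAl -/(low S V1 x) l1 gE.
    by apply/rowP; elim/ord5_ind; rewrite -rowE !mxE /=; ring.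
  have := congr1 (mulmx^~ P) e; rewrite -scalemxAl h1 scalerN e -rowE => /rowP/(_ k).
  by rewrite !mxE eqxx.
have py2 k : P cy2 k = (k == cy2)%:R.
  have e : b *: V2 x = delta_mx 0 cy2.
    apply: low_inj; rewrite -scalemxAl -/(low S V2 x) l2 gE.
    by apply/rowP; elim/ord5_ind; rewrite -rowE !mxE /=; ring.
  have := congr1 (mulmx^~ P) e; rewrite -scalemxAl h2 e -rowE => /rowP/(_ k).
  by rewrite !mxE eqxx.
have sk i j : (P *m met S x) i j = - (P *m met S x) j i.
  have := skew (delta_mx 0 i) (delta_mx 0 j); rewrite (bilC (gT Qx) (delta_mx 0 i)) !bil_delta.
  by rewrite -!rowE -!row_mul !mxE.
have sq0 i k : i != ct -> (P *m P) i k = (i == k)%:R.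
  move=> i0; have [+ _ _ _] := pc (delta_mx 0 i) 0; rewrite etaE ev_delta -mulmxA -rowE.
  move=> /rowP/(_ k); rewrite !mxE eqxx [ct == i]eq_sym (negPf i0) mul0r subr0 => ->.
  by rewrite eq_sym.
(* The diagonal entries at [cx1] and [cy2] are both 1, so the entry [(cx1, cy2)] of [P *m P] is
   twice [P cx1 cy2]; likewise for [C0] with -1. *)
have B0 : P cx1 cy2 = 0.
  have := sq0 cx1 cy2 isT; rewrite mxE sum5 pt px1 px2 py1 py2 /=.
  by move: (P ct cy2) (P cx1 cy2) (P cx2 cy2) (P cx1 cy1) => *; lra.
have C0 : P cx2 cy1 = 0.
  have := sq0 cx2 cy1 isT; rewrite mxE sum5 pt px1 px2 py1 py2 /=.
  by move: (P ct cy1) (P cx1 cy1) (P cx2 cy1) (P cx2 cy2) => *; lra.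
(* Diagonal entries of the skew matrix [P *m met S x] vanish, which determines this entry and
   [P cx2 cy2]. *)
have A0 : P cx1 cy1 = - 2 * p / a.
  have := sk cx1 cx1; rewrite mxE sum5 gE !mxE /= pt px1 px2 B0 /= => h.
  by apply: (mulIf a0); rewrite mulfVK //; move: h; lra.
have D0 : P cx2 cy2 = 2 * q / b.
  have := sk cx2 cx2; rewrite mxE sum5 gE !mxE /= pt px1 px2 C0 /= => h.
  by apply: (mulIf b0); rewrite mulfVK //; move: h; lra.
have PE : P = mxs [:: [:: 0; 0; 0; 0; 0]; [:: 0; 1; 0; - 2 * p / a; 0]; [:: 0; 0; - 1; 0; 2 * q / b];
    [:: 0; 0; 0; - 1; 0]; [:: 0; 0; 0; 0; 1]].
  by apply/matrixP; elim/ord5_ind; elim/ord5_ind; rewrite [RHS]mxE /=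
    ?p0 ?pt ?px1 ?px2 ?py1 ?py2 ?A0 ?B0 ?C0 ?D0 //= ?oppr0.
rewrite PE; move: p q a b a0 b0 {gE skew pc h1 h2 p0 pt px1 px2 py1 py2 sk sq0 B0 C0 A0 D0 PE} => p q a b a0 b0.
apply/matrixP => i j; rewrite [LHS]mxE [RHS]mxE !sum5 !mxE.
by elim/ord5_ind: i; elim/ord5_ind: j => /=; field; rewrite ?a0 ?b0.
Qed.

End NormalMetric.

(** * Recovering the model functions by quadratures *)

Section Potentials.
Context {R : realType}.
Local Notation E := 'rV[R]_5.
Variables (sigma : R) (c : E) (r : R).
Local Notation Q := (ball c r).
Variables (a b p q h : E -> R).
Hypotheses (sa : smooth Q a) (sb : smooth Q b) (sp : smooth Q p) (sq : smooth Q q) (sh : smooth Q h).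
Hypotheses (a0 : forall x, Q x -> a x != 0) (b0 : forall x, Q x -> b x != 0).
Hypothesis d1 : forall x, Q x -> [/\ pd ct a x = 0, pd cy2 a x = 0, pd ct p x = -1, pd cy2 p x = 0 &
  pd cy1 p x = pd cx1 a x - x 0 cy1 * a x].
Hypothesis d2 : forall x, Q x -> [/\ pd ct b x = 0, pd cy1 b x = 0, pd ct q x = - sigma,
  pd cy1 q x = 0 & pd cy2 q x = pd cx2 b x + x 0 cy2 * b x].
Hypothesis d12 : forall x, Q x ->
  [/\ pd ct h x = 0, pd cy1 h x = pd cx2 a x & pd cy2 h x = pd cx1 b x].

(** Integrating [a] along [y1] and [b] along [y2] determines [f1] and [f2] up to functions of [x1],
    [x2]. That freedom is spent on matching [h], the entry [g_(x1 x2)]. *)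
Lemma potentials_exist : exists f1 u f2 v : E -> R,
  model_functions Q f1 u f2 v (fun=> 0) /\
  (forall x, Q x -> [/\ pd cy1 f1 x = a x, pd cy2 f2 x = b x, fn_p f1 u x = p x,
    fn_q sigma f2 v x = q x & pd cx2 f1 x + pd cx1 f2 x = h x]).
Proof.
have oQ : open (Q : set E) by exact: ball_open.
pose F1 := intk c r cy1 a; have sF1 : smooth Q F1 := intk_smooth cy1 sa.
pose f2 := intk c r cy2 b; have sf2 : smooth Q f2 := intk_smooth cy2 sb.
have F1_other j x : j != cy1 -> (forall y, Q y -> pd j a y = 0) -> Q x -> pd j F1 x = 0.
  by move=> jk aj Qx; rewrite /F1 (pd_intk_other sa Qx jk) (intk0 cy1 aj Qx).
have f2_other j x : j != cy2 -> (forall y, Q y -> pd j b y = 0) -> Q x -> pd j f2 x = 0.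
  by move=> jk bj Qx; rewrite /f2 (pd_intk_other sb Qx jk) (intk0 cy2 bj Qx).
have F1t x : Q x -> pd ct F1 x = 0 by apply: F1_other => // y /d1[].
have F1y2 x : Q x -> pd cy2 F1 x = 0 by apply: F1_other => // y /d1[].
have F1y1 x : Q x -> pd cy1 F1 x = a x by move=> Qx; exact: pd_intk_same.
have f2t x : Q x -> pd ct f2 x = 0 by apply: f2_other => // y /d2[].
have f2y1 x : Q x -> pd cy1 f2 x = 0 by apply: f2_other => // y /d2[].
have f2y2 x : Q x -> pd cy2 f2 x = b x by move=> Qx; exact: pd_intk_same.
(* The part of [h] still missing. It depends on [x1], [x2] alone, so adding its primitive along [x2]
   to [F1] keeps the derivatives in [t], [y1], [y2]. *)
pose H (x : E) : R := h x - pd cx2 F1 x - pd cx1 f2 x.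
have sF1' := smooth_pd cx2 sF1; have sf2' := smooth_pd cx1 sf2.
have sH : smooth Q H := smoothB oQ (smoothB oQ sh sF1') sf2'.
have pdH j x : Q x -> pd j H x = pd j h x - pd j (pd cx2 F1) x - pd j (pd cx1 f2) x.
  move=> Qx; rewrite /H (pdB (smooth_derivable (smoothB oQ sh sF1') Qx) (smooth_derivable sf2' Qx)).
  by rewrite (pdB (smooth_derivable sh Qx) (smooth_derivable sF1' Qx)).
have Ht x : Q x -> pd ct H x = 0.
  move=> Qx; have [ht _ _] := d12 Qx.
  by rewrite pdH // ht (pd0_pd cx2 oQ sF1 F1t Qx) (pd0_pd cx1 oQ sf2 f2t Qx) !subr0.
have Hy1 x : Q x -> pd cy1 H x = 0.
  move=> Qx; have [_ hy _] := d12 Qx; rewrite pdH // hy (pd0_pd cx1 oQ sf2 f2y1 Qx).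
  by rewrite (smooth_schwarz cx2 cy1 oQ sF1 Qx) (pd_eq cx2 oQ Qx F1y1) !subr0 subrr.
have Hy2 x : Q x -> pd cy2 H x = 0.
  move=> Qx; have [_ _ hy] := d12 Qx; rewrite pdH // hy (pd0_pd cx2 oQ sF1 F1y2 Qx).
  by rewrite (smooth_schwarz cx1 cy2 oQ sf2 Qx) (pd_eq cx1 oQ Qx f2y2) !subr0 subrr.
pose K := intk c r cx2 H; have sK : smooth Q K := intk_smooth cx2 sH.
have K_other j x : j != cx2 -> (forall y, Q y -> pd j H y = 0) -> Q x -> pd j K x = 0.
  by move=> jk Hj Qx; rewrite /K (pd_intk_other sH Qx jk) (intk0 cx2 Hj Qx).
pose f1 (x : E) : R := F1 x + K x; have sf1 : smooth Q f1 := smoothD oQ sF1 sK.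
have pdf1 j x : Q x -> pd j f1 x = pd j F1 x + pd j K x.
  by move=> Qx; exact: (pdD (smooth_derivable sF1 Qx) (smooth_derivable sK Qx)).
have f1t x : Q x -> pd ct f1 x = 0 by move=> Qx; rewrite pdf1 // F1t // K_other // addr0.
have f1y2 x : Q x -> pd cy2 f1 x = 0 by move=> Qx; rewrite pdf1 // F1y2 // K_other // addr0.
have f1y1 x : Q x -> pd cy1 f1 x = a x by move=> Qx; rewrite pdf1 // F1y1 // K_other // addr0.
have f1x2 x : Q x -> pd cx2 f1 x + pd cx1 f2 x = h x.
  move=> Qx; rewrite pdf1 // [pd cx2 K x](pd_intk_same cx2 sH Qx) /H.
  by move: (pd cx2 F1 x) (pd cx1 f2 x) => *; ring.
(* [u] and [v] are solved from the prescribed coefficients of [dx1] in [theta3] and of [dx2] in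
   [theta4]; adding [t] and [sigma t] makes them independent of [t]. *)
pose u (x : E) : R := p x + x 0 ct - pd cx1 f1 x.
pose v (x : E) : R := q x + sigma * x 0 ct - pd cx2 f2 x.
have st := smooth_coord ct oQ; have ss := smooth_cst sigma oQ; have sst := smoothM oQ ss st.
have sf1' := smooth_pd cx1 sf1; have sf2'' := smooth_pd cx2 sf2.
have su : smooth Q u := smoothB oQ (smoothD oQ sp st) sf1'.
have sv : smooth Q v := smoothB oQ (smoothD oQ sq sst) sf2''.
have pdu j x : Q x -> pd j u x = pd j p x + (j == ct)%:R - pd j (pd cx1 f1) x.
  move=> Qx; rewrite /u (pdB (smooth_derivable (smoothD oQ sp st) Qx) (smooth_derivable sf1' Qx)).
  by rewrite (pdD (smooth_derivable sp Qx) (smooth_derivable st Qx)) pd_coord.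
have pdv j x : Q x -> pd j v x = pd j q x + sigma * (j == ct)%:R - pd j (pd cx2 f2) x.
  move=> Qx; rewrite /v (pdB (smooth_derivable (smoothD oQ sq sst) Qx) (smooth_derivable sf2'' Qx)).
  rewrite (pdD (smooth_derivable sq Qx) (smooth_derivable sst Qx)).
  by rewrite (pdM (smooth_derivable ss Qx) (smooth_derivable st Qx)) pd_cst mul0r add0r pd_coord.
have ut x : Q x -> pd ct u x = 0.
  by move=> Qx; have [_ _ e _ _] := d1 Qx; rewrite pdu // e (pd0_pd cx1 oQ sf1 f1t Qx) addNr subr0.
have uy2 x : Q x -> pd cy2 u x = 0.
  by move=> Qx; have [_ _ _ e _] := d1 Qx; rewrite pdu // e (pd0_pd cx1 oQ sf1 f1y2 Qx) addr0 subr0.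
have uy1 x : Q x -> pd cy1 u x = - (x 0 cy1 * a x).
  move=> Qx; have [_ _ _ _ e] := d1 Qx.
  rewrite pdu // e (smooth_schwarz cx1 cy1 oQ sf1 Qx) (pd_eq cx1 oQ Qx f1y1) addr0.
  by rewrite addrAC subrr add0r.
have vt x : Q x -> pd ct v x = 0.
  by move=> Qx; have [_ _ e _ _] := d2 Qx; rewrite pdv // e (pd0_pd cx2 oQ sf2 f2t Qx) mulr1 addNr subr0.
have vy1 x : Q x -> pd cy1 v x = 0.
  by move=> Qx; have [_ _ _ e _] := d2 Qx; rewrite pdv // e (pd0_pd cx2 oQ sf2 f2y1 Qx) mulr0 addr0 subr0.
have vy2 x : Q x -> pd cy2 v x = x 0 cy2 * b x.
  move=> Qx; have [_ _ _ _ e] := d2 Qx.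
  rewrite pdv // e (smooth_schwarz cx2 cy2 oQ sf2 Qx) (pd_eq cx2 oQ Qx f2y2) mulr0 addr0.
  by rewrite addrAC subrr add0r.
have dep1 f : smooth Q f -> (forall x, Q x -> pd ct f x = 0) -> (forall x, Q x -> pd cy2 f x = 0) ->
    depends_on Q [:: cx1; cx2; cy1] f.
  move=> sf ft fy; apply: (indep_depends sf); elim/ord5_ind => ni; [exact: ft|by case/negP: ni|by case/negP: ni|by case/negP: ni|exact: fy].
have dep2 f : smooth Q f -> (forall x, Q x -> pd ct f x = 0) -> (forall x, Q x -> pd cy1 f x = 0) ->
    depends_on Q [:: cx1; cx2; cy2] f.
  move=> sf ft fy; apply: (indep_depends sf); elim/ord5_ind => ni; [exact: ft|by case/negP: ni|by case/negP: ni|exact: fy|by case/negP: ni].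
exists f1, u, f2, v; split.
  split.
  - by split; [exact: sf1|exact: su].
  - by split; [exact: sf2|exact: sv].
  - exact: smooth_cst.
  - split; [exact: (dep1 _ sf1 f1t f1y2)|exact: (dep1 _ su ut uy2)|] => x Qx.
    by rewrite f1y1 // uy1 // addNr; split=> //; exact: a0.
  - split; [exact: (dep2 _ sf2 f2t f2y1)|exact: (dep2 _ sv vt vy1)|] => x Qx.
    by rewrite f2y2 // vy2 // subrr; split=> //; exact: b0.
move=> x Qx; split; [exact: f1y1|exact: f2y2| | |exact: f1x2].
- by rewrite /fn_p /u; move: (pd cx1 f1 x) => *; ring.
- by rewrite /fn_q /v; move: (pd cx2 f2 x) => *; ring.
Qed.

End Potentials.

Lemma model_converse {R : realType} (sigma : R) (Q : set 'rV[R]_5) (c : 'rV[R]_5) (r : R)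
    (S : pcstruct R 4) (V1 V2 t1 t2 : 'rV[R]_5 -> 'rV[R]_5) :
  Q = ball c r -> weakly_para_cosymplectic Q S -> adapted_pair S sigma Q V1 V2 ->
  (forall x, Q x -> forall v : 'rV[R]_5,
    nabla (met S) (fun=> v) V1 x = ev (t1 x) v *: V1 x /\
    nabla (met S) (fun=> v) V2 x = ev (t2 x) v *: V2 x) ->
  (forall y, Q y ->
    [/\ Defs.eta S y = delta_mx 0 ct, low S V1 y = delta_mx 0 cx1, low S V2 y = delta_mx 0 cx2,
        t1 y = - y 0 cy1 *: delta_mx 0 cx1 & t2 y = y 0 cy2 *: delta_mx 0 cx2]) ->
  exists f1 u f2 v f3 : 'rV[R]_5 -> R,
    model_functions Q f1 u f2 v f3 /\ model_structure sigma Q f1 u f2 v f3 S.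
Proof.
move=> QE weak ad tn nf; have oQ : open Q by rewrite QE; exact: ball_open.
have gg i j := smooth_g weak i j; have hg i := smooth_half_g oQ weak i.
have nz x (Qx : Q x) := normal_neq0 oQ weak ad tn nf Qx.
have d1 x (Qx : Q x) := normal_pd_x1 oQ weak ad tn nf Qx.
have d2 x (Qx : Q x) := normal_pd_x2 oQ weak ad tn nf Qx.
have d12 x (Qx : Q x) := normal_pd_x12 oQ weak ad tn nf Qx.
have := potentials_exist (sigma := sigma) (c := c) (r := r); rewrite -QE => pot.
have [f1 [u [f2 [v [mf mE]]]]] := pot _ _ _ _ _ (gg cx1 cy1) (gg cx2 cy2) (hg cx1) (hg cx2) (gg cx1 cx2)
  (fun x Qx => (nz x Qx).1) (fun x Qx => (nz x Qx).2) d1 d2 d12.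
exists f1, u, f2, v, (fun=> 0); split=> // x Qx.
have [e1 e2 e3 e4 e5] := mE x Qx; have [etaE l1 l2 _ _] := nf x Qx.
have gE := normal_met oQ weak ad tn nf Qx.
have [[[_ _ _ [_ gTu] _] _ _] _] := weak; have [_ gu] := gTu x Qx.
split.
- have e : delta_mx 0 ct *m met S x = delta_mx 0 ct :> 'rV[R]_5.
    by rewrite gE; apply/rowP; elim/ord5_ind; rewrite -rowE !mxE.
  by rewrite -[LHS](mulmxK gu) (lower_xiE weak nf Qx) -{1}e mulmxK.
- exact: etaE.
- apply/model_phi_frame; rewrite /cof e1 e2 e3 e4.
  exact: (normal_phi oQ weak ad tn nf _ _ Qx).
- rewrite model_met_frame /cof e1 e2 e3 e4 {1}gE -e5.
  move: (half_g S cx1 x) (half_g S cx2 x) (met S x cx1 cy1) (met S x cx2 cy2) => p q a b.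
  move: (pd cx2 f1 x) (pd cx1 f2 x) => k l.
  apply/matrixP => i j; rewrite [RHS]mxE sum5.
  rewrite ![(_ *m frame_gram) i _]mxE !sum5 !mxE.
  by elim/ord5_ind: i; elim/ord5_ind: j => /=; ring.
Qed.

Theorem theorem7 (R : realType) (sigma : R)
    (hsigma : sigma = 1 \/ sigma = -1) :
  (forall (U : set 'rV[R]_5) (f1 u f2 v f3 : 'rV[R]_5 -> R),
     domain U ->
     model_functions U f1 u f2 v f3 ->
     (exists S : pcstruct R 4, model_structure sigma U f1 u f2 v f3 S) /\
     (forall S : pcstruct R 4, model_structure sigma U f1 u f2 v f3 S ->
        [/\ weakly_para_cosymplectic U S,
            para_kaehler_leaves U S,
            (sigma = -1 -> hyperbolic U S) /\ (sigma = 1 -> elliptic U S),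
            (exists tau1 tau2 : 'rV[R]_5 -> 'rV[R]_5,
               tau_forms sigma U S tau1 tau2) /\
            (forall tau1 tau2 : 'rV[R]_5 -> 'rV[R]_5,
               tau_forms sigma U S tau1 tau2 ->
               contact_form U (ricci_potential S tau1 tau2) /\
               (forall x, U x ->
                  ricci_potential S tau1 tau2 x = normal_potential x)) &
            let alpha := fun x => (pd cy1 f1 x)^-1 in
            let beta := fun x => - (pd cy2 f2 x)^-1 in
            (forall x, U x -> forall a : R,
               eigenvalue (ricci_op (met S) x) a <->
               [\/ a = 0, a = - alpha x | a = - beta x]) /\
            (forall (W : set 'rV[R]_5) (V1 V2 : 'rV[R]_5 -> 'rV[R]_5),
               W `<=` U -> adapted_pair S sigma W V1 V2 ->
               forall x, W x ->
                 V1 x *m ricci_op (met S) x = - alpha x *: V1 x /\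
                 V2 x *m ricci_op (met S) x = - beta x *: V2 x)]))
  /\
  (forall (M : topologicalType) (A : set (chart R M 4))
          (S : chart R M 4 -> pcstruct R 4)
          (tau1 tau2 : chart R M 4 -> 'rV[R]_5 -> 'rV[R]_5),
     smooth_manifold A ->
     structure_field A S ->
     covector_field A tau1 ->
     covector_field A tau2 ->
     (forall c, A c ->
        [/\ weakly_para_cosymplectic (cimg c) (S c),
            para_kaehler_leaves (cimg c) (S c),
            sigma_type sigma (cimg c) (S c),
            tau_forms sigma (cimg c) (S c) (tau1 c) (tau2 c) &
            contact_form (cimg c)
              (ricci_potential (S c) (tau1 c) (tau2 c))]) ->
     forall p : M,
       exists (c : chart R M 4) (f1 u f2 v f3 : 'rV[R]_5 -> R),
         [/\ A c, cdom c p,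
             model_functions (cimg c) f1 u f2 v f3,
             model_structure sigma (cimg c) f1 u f2 v f3 (S c) &
             forall x, cimg c x ->
               ricci_potential (S c) (tau1 c) (tau2 c) x
               = normal_potential x]).
Proof.
have sg0 : sigma != 0 by case: hsigma => ->; rewrite ?oppr_eq0 oner_neq0.
split=> [U f1 u f2 v f3 dU F|M A S tau1 tau2 mA fS ft1 ft2 good p].
  exact: (model_direct hsigma dU F).
have good' c : A c -> [/\ weakly_para_cosymplectic (cimg c) (S c), sigma_type sigma (cimg c) (S c),
    tau_forms sigma (cimg c) (S c) (tau1 c) (tau2 c) &
    contact_form (cimg c) (ricci_potential (S c) (tau1 c) (tau2 c))].
  by move=> /good[].
have [d [y0 [r [V1 [V2 [Ad dp Id ad nf]]]]]] := normal_chart sg0 mA fS ft1 ft2 good' p.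
have [wd _ [_ _ tfd] _] := good' d Ad.
have tn := tfd (cimg d) V1 V2 (@subset_refl _ _) ad.
have [f1 [u [f2 [v [f3 [mf ms]]]]]] := model_converse Id wd ad tn nf.
exists d, f1, u, f2, v, f3; split=> // x dx.
have [etaE _ _ e1 e2] := nf x dx.
by rewrite /ricci_potential e1 e2 etaE scaleNr opprK.
Qed.
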